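(* Let $k,l$ be natural numbers with $1<k\le l$ and let $m=k+l-1$. Every $\left(12l\left\lceil\frac{2m}{k-1}\right\rceil+6m-4\right)$-edge-connected bipartite simple graph whose number of edges is divisible by $m$ has an $S(k,l)$-decomposition. In particular, every $(72k+236)$-edge-connected bipartite simple graph whose number of edges is divisible by $2k$ has an $S(k,k+1)$-decomposition.
   Context: $S(k,l)$ denotes the bistar: the tree consisting of two adjacent vertices of degrees $k$ and $l$ respectively, all other vertices being leaves (so it has $k+l-1$ edges). An $H$-decomposition of a graph $G$ is a partition of $E(G)$ into subgraphs isomorphic to $H$. *)

(* Defs.v *)
From mathcomp Require Import all_boot.
Set Implicit Arguments. Unset Strict Implicit. Unset Printing Implicit Defensive.

Section Graphs.
Variable V : finType.

Definition edges (e : rel V) : {set {set V}} :=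
  [set [set x; y] | x in V, y in V & e x y].

Definition simple_graph (e : rel V) : Prop := symmetric e /\ irreflexive e.

Definition bipartite (e : rel V) : Prop :=
  exists c : V -> bool, forall x y, e x y -> c x != c y.

Definition connected (e : rel V) : Prop := forall x y, connect e x y.

Definition del_edges (e : rel V) (F : {set {set V}}) : rel V :=
  fun x y => e x y && ([set x; y] \notin F).

Definition edge_connected (r : nat) (e : rel V) : Prop :=
  forall F : {set {set V}}, F \subset edges e -> #|F| < r ->
    connected (del_edges e F).

Definition is_bistar (k l : nat) (e : rel V) (H : {set {set V}}) : Prop :=
  exists (u v : V) (A B : {set V}),
    [/\ u != v, e u v, u \notin A :|: B, v \notin A :|: B & [disjoint A & B]] /\
    [/\ #|A| = k.-1, #|B| = l.-1,
        (forall a, a \in A -> e u a), (forall b, b \in B -> e v b) &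
            H = [set [set u; v]] :|: [set [set u; a] | a in A]
                  :|: [set [set v; b] | b in B]].

Definition has_bistar_decomposition (k l : nat) (e : rel V) : Prop :=
  exists P : {set {set {set V}}},
    partition P (edges e) /\ forall H, H \in P -> is_bistar k l e H.

End Graphs.

Definition ceil_div (a b : nat) : nat := (a + b.-1) %/ b.

(* Main.v *)
(**
Orient the edges of the bipartite graph so that every vertex receives half of
its degree and every vertex set avoiding a root is entered often. By Edmonds'
theorem on branchings one can then reserve edge sets W, R1, R2 that are still
highly connected although they use only a bounded part of each in-degree. Split
the remaining edges according to their heads and attach R1, R2 to the two parts.

Highly connected graphs have orientations with prescribed out-degrees modulo k,
as in the theorem of Lovasz, Thomassen, Wu and Zhang. Orienting W modulo U
distributes it over the two parts so that in either part all degrees on the side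
of the heads are divisible by U. Orienting R1 and R2 modulo f, with exactly half
of the edges at every head side vertex directed out, yields in each part G a
subgraph F which takes the fraction f/U of every head side degree and whose other
degrees are divisible by f. Here (U, f) = (2k-1, k) if k = l and (2(k+l-1), k+l)
otherwise; in the second case one bistar may have to be removed first, for
parity.

By Koenig's theorem F splits into f factors with proportional degrees, and these,
with the edges of G outside F, provide sets C, A, B of edges with d_A = p d_C on
one side and d_B = q d_C on the other. Such a triple decomposes greedily into
bistars with central edges in C; their two sets of leaves lie in different colour
classes.
*)
Require Import Defs.
From mathcomp Require Import all_boot.
From mathcomp Require Import all_order all_algebra.
From mathcomp Require Import zify ring lra.
Set Implicit Arguments. Unset Strict Implicit. Unset Printing Implicit Defensive.
Import Order.TTheory GRing.Theory Num.Theory.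

(** The obstacle is that the degrees of F on the head side must be an exact fraction of those of G,
    while on the other side only residues modulo f matter. So the orientation theorem is needed in a
    mixed form, with congruences on one colour class and exact bisection on the other. The exact
    vertices form an independent set and are eliminated by splitting off. Its bound 3k - 2 is the
    surplus 2k - 2 carried by the induction plus k, the largest distance of an integer from the
    multiples of 2k.

    Since bisection yields halves only, f/U should be close to one half. For k = l it is k/(2k - 1).
    For k < l the two positions of the bistar relative to the colouring are used equally often,
    which gives (k + l)/(2(k + l - 1)); the price is the factor two in U, hence the parity of the
    number of bistars.

    The in-degree spent on W, R1 and R2 is at most (3U - 2) + 2(3f - 2), linear in m. The ceiling in
    the hypothesis is at least 5, so the connectivity is at least 72k - 10 if k = l and 36m + 56 if
    k < l; the inequalities between degrees are checked from these values. *)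

Lemma disjP (T : finType) (A B : {set T}) :
  reflect (forall x, x \in A -> x \notin B) [disjoint A & B].
Proof. by rewrite disjoint_subset; apply: (iffP subsetP) => h x /h. Qed.

(** * Counting in sets of ordered pairs *)

Section Count.
Variable T : finType.
Implicit Types (P Q : pred T) (A B : {set T}).

Definition cnt P A := #|[set p in A | P p]|.

Lemma cntE P A : cnt P A = \sum_(p in A) P p.
Proof.
rewrite /cnt -sum1_card big_mkcond [RHS]big_mkcond /=; apply: eq_bigr => p _.
by rewrite inE; case: (p \in A); case: (P p).
Qed.

Lemma cntD P A B : A \subset B -> cnt P B = cnt P A + cnt P (B :\: A).
Proof. by move=> s; rewrite !cntE (big_setID A) /= (setIidPr s). Qed.

Lemma cntU P A B : [disjoint A & B] -> cnt P (A :|: B) = cnt P A + cnt P B.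
Proof.
move=> d; rewrite (cntD P (subsetUl A B)) setDUl setDv set0U.
by move: d; rewrite disjoint_sym => /setDidPl ->.
Qed.

Lemma cnt_mono P A B : A \subset B -> cnt P A <= cnt P B.
Proof. by move=> s; rewrite (cntD P s) leq_addr. Qed.

Lemma cnt_all P A : (forall p, p \in A -> P p) -> cnt P A = #|A|.
Proof. by move=> h; apply: eq_card => p; rewrite inE; case pA: (p \in A); rewrite //= h. Qed.

Lemma cnt0 P A : (forall p, p \in A -> ~~ P p) -> cnt P A = 0.
Proof.
move=> h; apply/eqP; rewrite cards_eq0; apply/eqP/setP => p; rewrite !inE.
by case pA: (p \in A); rewrite //= (negbTE (h p pA)).
Qed.

Lemma eq_cnt P Q A : (forall p, p \in A -> P p = Q p) -> cnt P A = cnt Q A.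
Proof. by move=> h; rewrite !cntE; apply: eq_bigr => p pA; rewrite h. Qed.

Lemma cnt_set1 P x : cnt P [set x] = P x.
Proof. by rewrite cntE big_set1. Qed.

Lemma cnt_gt0 P A : 0 < cnt P A -> exists2 p, p \in A & P p.
Proof. by case/card_gt0P => p; rewrite inE => /andP [pA Pp]; exists p. Qed.

End Count.

Section Pairs.
Variable V : finType.
Implicit Types (R F : {set V * V}) (A : {set V}) (v : V).

Definition deg1 R v := cnt (fun p => p.1 == v) R.
Definition deg2 R v := cnt (fun p => p.2 == v) R.
Definition edge_cut R A := cnt (fun p => (p.1 \in A) (+) (p.2 \in A)) R.

Lemma pair_sum (R : {set V * V}) (f : V -> V -> nat) :
  \sum_(p in R) f p.1 p.2 = \sum_u \sum_v ((u, v) \in R) * f u v.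
Proof.
rewrite pair_big /= big_mkcond /=; apply: eq_bigr => -[u v] _ /=.
by case: ((u, v) \in R); rewrite ?mul1n ?mul0n.
Qed.

Lemma deg1E R v : deg1 R v = \sum_u ((v, u) \in R).
Proof.
rewrite /deg1 cntE (pair_sum R (fun u _ => u == v)) (bigD1 v) //=.
rewrite [X in _ + X]big1 => [|u /negbTE uv]; last by rewrite big1 // => w _; rewrite uv muln0.
by rewrite addn0; apply: eq_bigr => u _; rewrite eqxx muln1.
Qed.

Lemma deg2E R v : deg2 R v = \sum_u ((u, v) \in R).
Proof.
rewrite /deg2 cntE (pair_sum R (fun _ u => u == v)); apply: eq_bigr => u _.
rewrite (bigD1 v) //= [X in _ + X]big1 => [|w /negbTE wv]; last by rewrite wv muln0.
by rewrite eqxx muln1 addn0.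
Qed.

Lemma sum_deg1 R : \sum_v deg1 R v = #|R|.
Proof.
rewrite -sum1_card (partition_big (fun p : V * V => p.1) predT) //=; apply: eq_bigr => v _.
by rewrite /deg1 /cnt -sum1_card; apply: eq_bigl => p; rewrite inE.
Qed.

Lemma sum_deg2 R : \sum_v deg2 R v = #|R|.
Proof.
rewrite -sum1_card (partition_big (fun p : V * V => p.2) predT) //=; apply: eq_bigr => v _.
by rewrite /deg2 /cnt -sum1_card; apply: eq_bigl => p; rewrite inE.
Qed.

Definition sided (c : pred V) R := forall p, p \in R -> c p.1 && ~~ c p.2.

Lemma deg1_side c R v : sided c R -> ~~ c v -> deg1 R v = 0.
Proof.
move=> s cv; apply: cnt0 => p /s /andP [c1 _]; by apply: contraNneq cv => <-.
Qed.

Lemma deg2_side c R v : sided c R -> c v -> deg2 R v = 0.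
Proof.
move=> s cv; apply: cnt0 => p /s /andP [_ c2]; by apply: contraNneq c2 => ->.
Qed.

End Pairs.

(** * Hall's theorem, branchings and balanced orientations *)

Section Hall.
Variables (I J : finType) (r : I -> J -> bool).
Implicit Types (D S : {set I}) (T : {set J}).

Definition nbrs S := [set j | [exists i in S, r i j]].

Lemma nbrsU S S' : nbrs (S :|: S') = nbrs S :|: nbrs S'.
Proof.
apply/setP => j; rewrite !inE; apply/existsP/orP => [[i]|].
  by rewrite inE => /andP [/orP [iS|iS] rij]; [left | right]; apply/existsP; exists i; rewrite iS.
by case=> /existsP [i /andP [iS rij]]; exists i; rewrite inE iS rij ?orbT.
Qed.

(** Induction on the size of [D]. A proper nonempty subset that has no spare neighbour is matched
    first and the rest afterwards; if there is none, any first choice is affordable because every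
    neighbourhood has an element to spare. The matching is option-valued because [J] may be
    empty. *)
Lemma hall_in n D T : #|D| <= n -> (forall S, S \subset D -> #|S| <= #|nbrs S :&: T|) ->
  exists phi : I -> option J,
    (forall i, i \in D -> exists2 j, j \in T & phi i = Some j /\ r i j) /\
    {in D &, injective phi}.
Proof.
elim: n D T => [|n IH] D T.
  rewrite leqn0 cards_eq0 => /eqP -> _; exists (fun=> None).
  by split=> [i|i i']; rewrite inE.
move=> cD h.
have [D0|[i0 i0D]] := set_0Vmem D.
  by exists (fun=> None); rewrite D0; split=> [i|i i']; rewrite inE.
have [/existsP [S /and4P [SD S0 SnD /eqP eS]]|tight] := boolP [exists S : {set I},
    [&& S \subset D, S != set0, S != D & #|S| == #|nbrs S :&: T|]].
  have cS : #|S| < #|D| by apply: proper_card; rewrite properEneq SnD.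
  have [||f1 [f1T f1i]] := IH S (nbrs S :&: T); first by rewrite -ltnS (leq_trans cS).
    move=> S' sS'; apply: leq_trans (h S' (subset_trans sS' SD)) _.
    apply: subset_leq_card; apply/subsetP => j; rewrite !inE => /andP [/existsP [i /andP [iS' rij]] ->].
    rewrite andbT; apply/andP; split; apply/existsP; exists i; rewrite rij andbT //.
    exact: (subsetP sS').
  (* A set S' outside [S] inherits the condition from the union of S' and [S], since [S] has exactly
     as many neighbours as elements. *)
  have [||f2 [f2T f2i]] := IH (D :\: S) (T :\: nbrs S).
    have := cardsID S D; rewrite (setIidPr SD) => e; move: S0; rewrite -card_gt0; lia.
    move=> S' sS'.
    have dS : [disjoint S' & S].
      by rewrite -setI_eq0; apply/eqP/setP => i; rewrite !inE; apply/negP => /andP [/(subsetP sS')]; rewrite inE => /andP [/negbTE ->].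
    have hU : S' :|: S \subset D.
      rewrite subUset SD andbT; apply: subset_trans sS' _; exact: subsetDl.
    have := h _ hU; rewrite cardsU; move: dS; rewrite -setI_eq0 => /eqP ->.
    rewrite cards0 subn0 eS nbrsU.
    have -> : (nbrs S' :|: nbrs S) :&: T = (nbrs S' :&: (T :\: nbrs S)) :|: (nbrs S :&: T).
      by apply/setP => j; rewrite !in_setU !in_setI !in_setD in_setU; case: (j \in nbrs S); case: (j \in nbrs S'); case: (j \in T).
    rewrite cardsU => hh; have : #|S'| + #|nbrs S :&: T| <= #|nbrs S' :&: (T :\: nbrs S)| + #|nbrs S :&: T|.
      by apply: leq_trans hh (leq_subr _ _).
    by rewrite leq_add2r.
  exists (fun i => if i \in S then f1 i else f2 i); split=> [i iD|i i' iD i'D].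
    case: ifP => iS.
      by have [j] := f1T i iS; rewrite inE => /andP [_ jT] hj; exists j.
    have [|j] := f2T i; first by rewrite inE iS.
    by rewrite inE => /andP [_ jT] hj; exists j.
  case: ifP => iS; case: ifP => i'S e.
  - exact: f1i.
  - have [j] := f1T i iS; rewrite inE => /andP [jN _] [ej _].
    have [|j'] := f2T i'; first by rewrite inE i'S.
    rewrite inE => /andP [j'N _] [ej' _].
    by move: e j'N; rewrite ej ej' => -[<-]; rewrite jN.
  - have [j] := f1T i' i'S; rewrite inE => /andP [jN _] [ej _].
    have [|j'] := f2T i; first by rewrite inE iS.
    rewrite inE => /andP [j'N _] [ej' _].
    by move: e j'N; rewrite ej ej' => -[->]; rewrite jN.
  - by apply: f2i => //; rewrite inE ?iS ?i'S.
have : 0 < #|nbrs [set i0] :&: T|.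
  by apply: leq_trans (h _ _); rewrite ?cards1 ?sub1set.
case/card_gt0P => j0; rewrite inE => /andP [j0N j0T].
have r0 : r i0 j0 by move: j0N; rewrite inE => /existsP [i]; rewrite inE => /andP [/eqP ->].
have [||f [fT fi]] := IH (D :\ i0) (T :\ j0).
- by move: cD; rewrite (cardsD1 i0 D) i0D.
- move=> S sS; have SD := subset_trans sS (subD1set D i0).
  have [->|S0] := eqVneq S set0; first by rewrite cards0.
  have SnD : S != D.
    by apply/negP => /eqP e; have := subsetP sS i0; rewrite e i0D !inE eqxx => /(_ isT).
  have : #|S| < #|nbrs S :&: T|.
    rewrite ltn_neqAle h // andbT; apply: contra tight => e.
    by apply/existsP; exists S; rewrite SD S0 SnD.
  have -> : nbrs S :&: (T :\ j0) = (nbrs S :&: T) :\ j0.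
    by apply/setP => j; rewrite !in_setI !in_setD1 in_setI; case: (j == j0); rewrite ?andbF.
  by rewrite (cardsD1 j0 (nbrs S :&: T)); case: (j0 \in _) => /=; rewrite ?add1n ?add0n ?ltnS // => /ltnW.
exists (fun i => if i == i0 then Some j0 else f i); split=> [i iD|i i' iD i'D].
  case: eqP => [->|/eqP ii]; first by exists j0.
  have [|j] := fT i; first by rewrite !inE ii.
  by rewrite inE => /andP [_ jT] hj; exists j.
have nf a : a \in D -> a != i0 -> f a <> Some j0.
  move=> aD ai; have [|j] := fT a; first by rewrite !inE ai.
  by rewrite !inE => /andP [jj _] [-> _] [ejj]; rewrite ejj eqxx in jj.
case: (eqVneq i i0) => [->|ii]; case: (eqVneq i' i0) => [->|ii'] // e.
- by case: (nf i').
- by case: (nf i).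
- by apply: fi; rewrite // !inE ?ii ?ii'.
Qed.

Lemma hall D (T : {set J}) : (forall S, S \subset D -> #|S| <= #|nbrs S :&: T|) ->
  exists phi : I -> option J,
    (forall i, i \in D -> exists2 j, j \in T & phi i = Some j /\ r i j) /\
    {in D &, injective phi}.
Proof. exact: hall_in. Qed.

End Hall.

(** * Edmonds' theorem on disjoint branchings *)

Section Digraph.
Variables (T V : finType) (hd tl : T -> V) (z : V).
Implicit Types (E B : {set T}) (A S : {set V}).

Definition cutin E A := cnt (fun p => (hd p \in A) && (tl p \notin A)) E.
Definition indeg E v := cnt (fun p => hd p == v) E.

(** These are the sets that a branching with root [z] has to enter. *)
Definition rootless A := (A != set0) && (z \notin A).

Lemma cutin_submod E A A' : cutin E (A :&: A') + cutin E (A :|: A') <= cutin E A + cutin E A'.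
Proof.
rewrite /cutin !cntE -!big_split /=; apply: leq_sum => p _; rewrite !inE.
by case: (hd p \in A); case: (hd p \in A'); case: (tl p \in A); case: (tl p \in A').
Qed.

Lemma cutin_setD1 E e A : e \in E ->
  cutin E A = ((hd e \in A) && (tl e \notin A)) + cutin (E :\ e) A.
Proof. by move=> eE; rewrite /cutin !cntE (big_setD1 e). Qed.

(* Lovasz's proof of Edmonds' theorem: the branching B on S grows by an arc that
   leaves S inside an inclusion-minimal critical set. *)
Lemma branching_extend E N B S : z \in S -> B \subset E ->
  (forall p, p \in B -> hd p \in S /\ tl p \in S) ->
  (forall A, rootless A -> N <= cutin (E :\: B) A) ->
  (forall v, indeg B v <= (v \in S)) ->
  (forall A, rootless A -> A :&: S != set0 -> 0 < cutin B A) ->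
  (forall A, rootless A -> N < cutin E A) ->
  exists B', [/\ B' \subset E, forall A, rootless A -> 0 < cutin B' A,
     forall v, indeg B' v <= 1 & forall A, rootless A -> N <= cutin (E :\: B') A].
Proof.
have [n] := ubnP #|~: S|; elim: n B S => // n IH B S cS zS BE BS EB iB cB cE.
have [S1|SnT] := eqVneq S setT.
  exists B; split=> // [A oA|v]; last by apply: leq_trans (iB v) (leq_b1 _).
  by apply: cB => //; rewrite S1 setIT; case/andP: oA.
have [v0 v0S] : exists v, v \notin S.
  by apply/existsP; rewrite -negb_forall; apply: contra SnT => /forallP h; apply/eqP/setP => v; rewrite inE h.
suff [e [eE heS teS he]] : exists e, [/\ e \in E :\: B, hd e \notin S, tl e \in S &
    forall A, rootless A -> hd e \in A -> tl e \notin A -> N < cutin (E :\: B) A].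
  move: eE; rewrite inE => /andP [eB eE].
  apply: (IH (e |: B) (hd e |: S)) => //.
  - apply: (@leq_trans #|~: S|); last by rewrite -ltnS.
    apply: proper_card.
    apply/properP; split; first by rewrite setCS subsetUr.
    by exists (hd e); rewrite ?inE ?heS // eqxx.
  - by rewrite inE zS orbT.
  - by rewrite subUset sub1set eE.
  - move=> p; rewrite !inE => /orP [/eqP ->|/BS [-> ->]]; last by rewrite !orbT.
    by rewrite eqxx teS orbT.
  - move=> A oA; have eEB : e \in E :\: B by rewrite inE eB.
    have := EB A oA; have := he A oA; rewrite (cutin_setD1 A eEB).
    have -> : E :\: (e |: B) = (E :\: B) :\ e by apply/setP => p; rewrite !inE negb_or andbA.
    case: (hd e \in A) => //=; case: (tl e \in A) => //= h1 h2.
    by have := h1 isT isT; rewrite add1n ltnS.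
  - move=> v; rewrite /indeg cntE big_setU1 //= -cntE -/(indeg B v).
    have := iB v; rewrite !inE [v == _]eq_sym; case: eqP => [<-|_] //=; rewrite (negbTE heS); lia.
  - move=> A oA; have eEB : e \in e |: B by rewrite !inE eqxx.
    have [AS|AS _] := eqVneq (A :&: S) set0.
      move=> /set0Pn [v]; rewrite !inE => /andP [vA /orP [/eqP ve|vS]]; last first.
        by move/setP/(_ v): AS; rewrite !inE vA vS.
      rewrite (cutin_setD1 A eEB) -ve vA /=; case: (boolP (tl e \in A)) => // tA.
      by move/setP/(_ (tl e)): AS; rewrite !inE tA teS.
    apply: leq_trans (cB A oA AS) _; exact: cnt_mono (subsetUr _ _).
have outB A p : A :&: S = set0 -> p \in B -> hd p \notin A.
  move=> AS /BS [hS _]; apply/negP => hA; by move/setP/(_ (hd p)): AS; rewrite !inE hA hS.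
have cutout A : A :&: S = set0 -> cutin (E :\: B) A = cutin E A.
  move=> AS; rewrite /cutin (cntD _ BE) [X in _ = X + _]cnt0 // => p pB.
  by rewrite (negbTE (outB A p AS pB)).
pose crit := [pred A : {set V} | [&& rootless A, A :\: S != set0 & cutin (E :\: B) A <= N]].
have [/existsP [A0 cA0]|nocrit] := boolP [exists A, crit A]; last first.
  have oS : rootless (~: S).
    by rewrite /rootless inE zS andbT; apply/set0Pn; exists v0; rewrite inE.
  have CS : ~: S :&: S = set0 by rewrite setIC setICr.
  have := cE _ oS; rewrite -(cutout _ CS) => pos.
  have [e eE] := cnt_gt0 (leq_ltn_trans (leq0n N) pos).
  rewrite !inE negbK => /andP [hS tS]; exists e; split=> // A oA hA tA.
  rewrite ltnNge; apply: contra nocrit => le; apply/existsP; exists A; rewrite /= oA le andbT.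
  by apply/set0Pn; exists (hd e); rewrite inE hS.
have [A /minsetP [/and3P [oA AS lA] minA] _] := minset_exists cA0.
have oAS : rootless (A :\: S).
  by move/andP: oA => [_ zA]; rewrite /rootless AS inE (negbTE zA) andbF.
have AS0 : (A :\: S) :&: S = set0 by apply/setP => v; rewrite !inE; case: (v \in S); rewrite ?andbF.
have lt : cutin (E :\: B) A < cutin (E :\: B) (A :\: S).
  by rewrite (cutout _ AS0); apply: leq_ltn_trans lA (cE _ oAS).
(* No arc of [B] has its head in A \ S, so that set is entered more than [N] times and hence more
   often than [A]. An arc that makes the difference runs from A ∩ S to A \ S. *)
have [e eE /and3P [hAS tAS hA]] : exists2 e, e \in E :\: B &
    [&& hd e \in A :\: S, tl e \notin A :\: S & ~~ ((hd e \in A) && (tl e \notin A))].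
  have [/existsP [e /andP [eE h]]|no] := boolP [exists e, (e \in E :\: B) &&
    [&& hd e \in A :\: S, tl e \notin A :\: S & ~~ ((hd e \in A) && (tl e \notin A))]].
    by exists e.
  move: lt; rewrite ltnNge /cutin !cntE => /negP []; apply: leq_sum => e eE.
  move: no; rewrite negb_exists => /forallP /(_ e); rewrite eE /=.
  by case: (hd e \in A :\: S); case: (tl e \in A :\: S); case: ((hd e \in A) && _).
move: hAS tAS hA; rewrite !inE => /andP [hS hA]; rewrite hA negb_and !negbK.
move=> h tA; move: h; rewrite tA orbF => tS.
(* If [e] entered a second critical set A', submodularity would make A ∩ A' critical as well; it
   misses the tail of [e], against the minimality of [A]. *)
exists e; split=> // A' oA' hA' tA'; rewrite ltnNge; apply/negP => lA'.
have oI : rootless (A :&: A').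
  apply/andP; split; first by apply/set0Pn; exists (hd e); rewrite inE hA.
  by rewrite inE; move/andP: oA => [_ /negbTE ->].
have oU : rootless (A :|: A').
  apply/andP; split; first by apply/set0Pn; exists (hd e); rewrite inE hA.
  by rewrite inE negb_or; move/andP: oA => [_ ->]; move/andP: oA' => [_ ->].
have lI : cutin (E :\: B) (A :&: A') <= N.
  by move: (cutin_submod (E :\: B) A A') (EB _ oU) lA lA'; clear; lia.
have /setP /(_ (tl e)) : A :&: A' = A.
  apply: minA (subsetIl _ _); rewrite /= oI lI andbT.
  by apply/set0Pn; exists (hd e); rewrite !inE hS hA.
by rewrite inE tA (negbTE tA').
Qed.

Lemma branching E N : (forall A, rootless A -> N < cutin E A) ->
  exists B : {set T}, [/\ B \subset E, forall A, rootless A -> 0 < cutin B A,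
     forall v, indeg B v <= 1 & forall A, rootless A -> N <= cutin (E :\: B) A].
Proof.
move=> h; apply: (@branching_extend E N set0 [set z]) => //.
- by rewrite inE.
- exact: sub0set.
- by move=> p; rewrite in_set0.
- by move=> A oA; rewrite setD0 ltnW ?h.
- by move=> v; rewrite /indeg cnt0 // => p; rewrite inE.
- move=> A /andP [_ zA] /set0Pn [v]; rewrite !inE => /andP [vA /eqP e].
  by rewrite -e vA in zA.
Qed.

(** Each branching lowers the connectivity of what remains by one and uses at most one in-arc of a
    vertex. This is how a highly connected set of edges is reserved at a bounded cost in
    in-degree. *)
Lemma branching_packing t E N : (forall A, rootless A -> N + t <= cutin E A) ->
  exists W : {set T}, [/\ W \subset E, forall A, rootless A -> t <= cutin W A,
     forall v, indeg W v <= t & forall A, rootless A -> N <= cutin (E :\: W) A].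
Proof.
elim: t E N => [|t IH] E N h.
  exists set0; split=> //; first exact: sub0set.
    by move=> v; rewrite /indeg cnt0 // => p; rewrite inE.
  by move=> A oA; rewrite setD0 -[N]addn0 h.
have [A oA|W [WE cW iW rW]] := IH E N.+1; first by rewrite addSnnS h.
have [B [BE cB iB rB]] := branching rW.
have dWB : [disjoint W & B].
  rewrite -setI_eq0; apply/eqP/setP => p; rewrite !inE; apply/negP => /andP [pW /(subsetP BE)].
  by rewrite inE pW.
exists (W :|: B); split.
- rewrite subUset WE; apply: subset_trans BE _; exact: subsetDl.
- by move=> A oA; rewrite /cutin cntU // -addn1 leq_add ?cW ?cB.
- by move=> v; rewrite /indeg cntU // -addn1 leq_add ?iW ?iB.
- by move=> A oA; rewrite -setDDl; exact: rB.
Qed.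

End Digraph.

(** * Balanced orientations with large in-cuts *)

Section Orient.
Variable V : finType.
Implicit Types (E : {set V * V}) (A S : {set V}).
Variables (E : {set V * V}) (z : V) (N : nat).
Hypothesis loopless : forall p, p \in E -> p.1 != p.2.

Definition deg v := cnt (fun p => (p.1 == v) || (p.2 == v)) E.
Definition inner A := cnt (fun p => (p.1 \in A) && (p.2 \in A)) E.
Definition touching A := cnt (fun p => (p.1 \in A) || (p.2 \in A)) E.

Hypothesis cut2 : forall A, rootless z A -> N.*2 <= edge_cut E A.

Lemma sum_mem A v : \sum_(a in A) (v == a) = (v \in A).
Proof.
case: (boolP (v \in A)) => vA.
  by rewrite (bigD1 v) //= eqxx big1 // => a /andP [_ /negbTE]; rewrite eq_sym => ->.
by rewrite big1 // => a aA; case: eqP => // va; rewrite va aA in vA.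
Qed.

Lemma sum_deg A : \sum_(v in A) deg v = (inner A).*2 + edge_cut E A.
Proof.
rewrite /deg /inner /edge_cut -addnn !cntE -!big_split /=.
under eq_bigr do rewrite cntE.
rewrite exchange_big /=; apply: eq_bigr => p pE.
rewrite (eq_bigr (fun v => (p.1 == v) + (p.2 == v))) => [|v _].
  by rewrite big_split /= !sum_mem; case: (p.1 \in A); case: (p.2 \in A).
have ne := loopless pE; case: (eqVneq p.1 v) => [<-|_] /=; last by case: (p.2 == v).
by rewrite eq_sym (negbTE ne).
Qed.

(** The in-degree aimed at: half of the degree, rounded up at the odd vertices of [U] and down at
    the other odd vertices. *)
Definition rounded_half (U : {set V}) v := (deg v)./2 + ((v \in U) && odd (deg v)).
(** The heads of the edges inside [A] use up [inner A] of the in-degrees of [A]. So the inequality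
    says that in-degrees of this size force [A] to be entered at least [N] times. *)
Definition admissible (U : {set V}) := (z \notin U) &&
  [forall A : {set V}, rootless z A ==> (inner A + N <= \sum_(v in A) rounded_half U v)].

Lemma admissible_top : admissible (~: [set z]).
Proof.
rewrite /admissible !inE eqxx /=; apply/forallP => A; apply/implyP => oA.
rewrite -leq_double doubleD; apply: leq_trans (_ : \sum_(v in A) deg v <= _).
  by rewrite sum_deg leq_add2l; exact: cut2.
rewrite -mul2n big_distrr /=; apply: leq_sum => v vA; rewrite /rounded_half !inE.
have -> : v != z by move/andP: oA => [_]; apply: contraNneq => <-.
have := odd_double_half (deg v); lia.
Qed.

Lemma inner_supermod A A' : inner A + inner A' <= inner (A :|: A') + inner (A :&: A').
Proof.
rewrite /inner !cntE -!big_split /=; apply: leq_sum => p _; rewrite !inE.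
by case: (p.1 \in A); case: (p.1 \in A'); case: (p.2 \in A); case: (p.2 \in A').
Qed.

Lemma sumUI (f : V -> nat) A A' :
  \sum_(v in A :|: A') f v + \sum_(v in A :&: A') f v = \sum_(v in A) f v + \sum_(v in A') f v.
Proof.
have E0 B : \sum_(v in B) f v = \sum_v (v \in B) * f v.
  by rewrite big_mkcond; apply: eq_bigr => v _; case: (v \in B); rewrite ?mul1n ?mul0n.
rewrite !E0 -!big_split; apply: eq_bigr => v _; rewrite !inE /=.
by case: (v \in A); case: (v \in A'); rewrite /= ?mul0n ?mul1n ?addn0.
Qed.

(* For an inclusion-minimal admissible U every odd vertex of U lies in a tight
   set, and uncrossing tight sets gives the last bound, which is Hall's condition
   for assigning to v exactly f v incident edges as in-edges. *)
Lemma orientation_demand : exists f : V -> nat,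
  [/\ forall v, (deg v)./2 <= f v,
      forall A, rootless z A -> inner A + N <= \sum_(v in A) f v &
      forall S, \sum_(v in S) f v <= touching S].
Proof.
have [U /minsetP [/andP [zU /forallP gU] minU] _] := minset_exists admissible_top.
pose f := rounded_half U; exists f.
have fA A : rootless z A -> inner A + N <= \sum_(v in A) f v by move=> oA; exact: (implyP (gU A)).
split=> //; first by move=> v; rewrite leq_addr.
pose tight A := rootless z A && (\sum_(v in A) f v == inner A + N).
have tightU A A' : tight A -> tight A' -> A :&: A' != set0 -> tight (A :|: A').
  move=> /andP [oA /eqP tA] /andP [oA' /eqP tA'] I0.
  have [/andP [A0 zA] /andP [A'0 zA']] := (oA, oA').
  have oI : rootless z (A :&: A') by rewrite /rootless I0 inE (negbTE zA).
  have oU : rootless z (A :|: A').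
    rewrite /rootless inE negb_or zA zA' /= andbT; apply: contra A0 => /eqP e.
    by rewrite -subset0 -e subsetUl.
  rewrite /tight oU /=; have := fA _ oI; have := fA _ oU.
  have := inner_supermod A A'; have := sumUI f A A'; rewrite tA tA'; clear; lia.
(* By minimality [v] cannot be rounded down, so the bound fails for some set that contains [v];
   before the change that bound was an equality. *)
have inU v : v \in U -> odd (deg v) -> exists2 A, tight A & v \in A.
  move=> vU od.
  have [/existsP [A /andP [tA vA]]|no] := boolP [exists A : {set V}, tight A && (v \in A)]; first by exists A.
  have : U :\ v = U.
    apply: minU; last exact: subD1set.
    rewrite /admissible !inE negb_and zU orbT /=; apply/forallP => A; apply/implyP => oA.
    have fl := fA A oA.
    have fe a : a != v -> rounded_half (U :\ v) a = f a by rewrite /rounded_half !inE => ->.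
    have [vA|vA] := boolP (v \in A); last first.
      rewrite (eq_bigr f) // => a aA; apply: fe; by apply: contraNneq vA => <-.
    have : \sum_(v in A) f v != inner A + N.
      by apply: contra no => e; apply/existsP; exists A; rewrite /tight oA e vA.
    rewrite (bigD1 v) //= in fl *; rewrite [X in _ <= X](bigD1 v) //=.
    have -> : \sum_(i in A | i != v) rounded_half (U :\ v) i = \sum_(i in A | i != v) f i.
      by apply: eq_bigr => a /andP [_ av]; exact: fe.
    have -> : f v = (rounded_half (U :\ v) v).+1 by rewrite /f /rounded_half !inE eqxx vU od /= addn0 addn1.
    by move: fl; rewrite /f /rounded_half !inE eqxx vU od /= addn0; lia.
  by move/setP/(_ v); rewrite !inE eqxx vU.
(* On a tight set twice the demand is 2 [inner A] + 2N, which the cut condition bounds by the degree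
   sum. Maximal tight sets are disjoint by uncrossing and are peeled off one at a time; the vertices
   left over demand at most half of their degree. *)
have half S : (forall A, tight A -> A :&: S != set0 -> A \subset S) ->
    (\sum_(v in S) f v).*2 <= \sum_(v in S) deg v.
  have [n] := ubnP #|S|; elim: n S => // n IH S cS hS.
  have [/existsP [v /and3P [vS vU od]]|no] := boolP [exists v, [&& v \in S, v \in U & odd (deg v)]]; last first.
    rewrite -mul2n big_distrr /=; apply: leq_sum => v vS.
    move: no; rewrite negb_exists => /forallP /(_ v); rewrite vS /= => h.
    by rewrite /f /rounded_half (negbTE h) addn0; have := odd_double_half (deg v); lia.
  have [A0 tA0 vA0] := inU v vU od.
  have [A /maxsetP [/andP [tA vA] maxA] _] := @maxset_exists _ [pred A : {set V} | tight A && (v \in A)] A0 (introT andP (conj tA0 vA0)).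
  have AS : A \subset S.
    by apply: hS => //; apply/set0Pn; exists v; rewrite inE vA vS.
  have dj A' : tight A' -> A' :&: (S :\: A) != set0 -> A' :&: A = set0.
    move=> tA' /set0Pn [w]; rewrite !inE => /and3P [wA' wA wS].
    apply/eqP; apply: contraTT wA => I0; rewrite negbK.
    have <- : A' :|: A = A.
      by apply: maxA; rewrite ?subsetUr //= tightU // inE vA orbT.
    by rewrite inE wA'.
  have := IH (S :\: A) _ _.
  have sp (g : V -> nat) : \sum_(v in S) g v = \sum_(v in A) g v + \sum_(v in S :\: A) g v.
    by rewrite (big_setID A) /= (setIidPr AS).
  rewrite !sp doubleD => h; apply: leq_add; last first.
    apply: h.
      apply: leq_trans (_ : #|S| <= n); last by rewrite -ltnS.
      apply: proper_card; apply/properP; split; first exact: subsetDl.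
      by exists v => //; rewrite inE vA.
    move=> A' tA' I0; have d := dj A' tA' I0.
    have A'S : A' \subset S.
      apply: hS => //; apply: contra I0 => /eqP e; rewrite -subset0 -e; apply: setIS; exact: subsetDl.
    apply/subsetP => w wA'; rewrite inE (subsetP A'S) // andbT.
    by apply/negP => wA; move/setP/(_ w): d; rewrite !inE wA' wA.
  move/andP: tA => [oA /eqP ->]; rewrite sum_deg doubleD leq_add2l; exact: cut2.
move=> S; have [n] := ubnP #|S|; elim: n S => // n IH S cS.
have [/existsP [A /and3P [tA I0 AS]]|no] := boolP [exists A : {set V},
   [&& tight A, A :&: S != set0 & ~~ (A \subset S)]]; last first.
  rewrite -leq_double; apply: leq_trans (half S _) _.
    move=> A tA I0; apply: contraR no => AS; apply/existsP; exists A; by rewrite tA I0.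
  rewrite sum_deg /inner /edge_cut /touching -!mul2n !cntE !big_distrr -big_split /=; apply: leq_sum => p _.
  by case: (p.1 \in S); case: (p.2 \in S).
have sp (g : V -> nat) (X Y : {set V}) : \sum_(v in X) g v = \sum_(v in X :&: Y) g v + \sum_(v in X :\: Y) g v.
  by rewrite (big_setID Y).
have oAS : rootless z (A :\: S).
  by move/andP: tA => [/andP [_ zA] _]; rewrite /rootless inE (negbTE zA) andbF andbT setD_eq0.
have lt : #|S :\: A| < n.
  apply: leq_trans (_ : #|S| <= n); last by rewrite -ltnS.
  apply: proper_card; apply/properP; split; first exact: subsetDl.
  by case/set0Pn: I0 => v; rewrite inE => /andP [vA vS]; exists v; rewrite // inE vA.
(* For a tight [A] that crosses [S], the equality on [A] and the lower bound on A \ S limit the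
   demand of A ∩ S by the difference of their [inner] values. The rest of [S] is covered by
   induction. *)
have h1 := IH _ lt; have h2 := fA _ oAS; have [_ /eqP h3] := andP tA.
have h4 : touching (S :\: A) + inner A <= touching S + inner (A :\: S).
  rewrite /touching /inner !cntE -!big_split /=; apply: leq_sum => p _; rewrite !inE.
  by case: (p.1 \in A); case: (p.1 \in S); case: (p.2 \in A); case: (p.2 \in S).
rewrite (sp f S A); rewrite (sp f A S) setIC in h3; lia.
Qed.

Theorem balanced_orientation : exists hd : V * V -> V,
  [/\ forall p, p \in E -> hd p = p.1 \/ hd p = p.2,
      forall v, (deg v)./2 <= indeg hd E v &
      forall A, rootless z A -> N <= cnt (fun p => (hd p \in A) && ~~ ((p.1 \in A) && (p.2 \in A))) E].
Proof.
have [f [f0 fA fS]] := orientation_demand.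
pose I := {v : V & 'I_(f v)}.
pose r (i : I) (p : V * V) := (p.1 == tag i) || (p.2 == tag i).
have [|phi [phiT phiI]] := @hall I _ r setT E.
  move=> S _; pose S' := [set tag i | i in S].
  apply: leq_trans (_ : \sum_(v in S') f v <= _).
    rewrite -sum1_card (partition_big (fun i : I => tag i) (mem S')) /=; last by move=> i iS; exact: imset_f.
    apply: leq_sum => v _; rewrite sum1_card.
    apply: leq_trans (_ : #|[set Tagged (fun v => 'I_(f v)) j | j : 'I_(f v)]| <= _); last first.
      by apply: leq_trans (leq_imset_card _ _) _; rewrite card_ord.
    apply: subset_leq_card; apply/subsetP => -[w j] /andP [_ /eqP /= wv].
    by move: j; rewrite wv => j; exact: imset_f.
  apply: leq_trans (fS S') _; apply: subset_leq_card; apply/subsetP => p; rewrite !inE => /andP [pE].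
  rewrite pE andbT => h; apply/existsP.
  by case/orP: h => /imsetP [i iS e]; exists i; rewrite iS /r e eqxx ?orbT.
pose hd p := if [pick i | phi i == Some p] is Some i then tag i else p.1.
have hdE i p : phi i = Some p -> hd p = tag i.
  move=> e; rewrite /hd; case: pickP => [i' /eqP e'|/(_ i)]; last by rewrite e eqxx.
  by congr tag; apply: phiI; rewrite ?inE // e e'.
have le v : f v <= indeg hd E v.
  pose g (j : 'I_(f v)) := odflt (z, z) (phi (Tagged (fun v => 'I_(f v)) j)).
  have gS j : phi (Tagged (fun v => 'I_(f v)) j) = Some (g j).
    by have [|p _ [e _]] := phiT (Tagged (fun v => 'I_(f v)) j); rewrite ?inE // /g e.
  have gI : injective g.
    move=> j j' e; have : Tagged (fun v => 'I_(f v)) j = Tagged (fun v => 'I_(f v)) j'.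
      by apply: phiI; rewrite ?inE // !gS e.
    by move/eqP; rewrite eq_Tagged /= => /eqP.
  rewrite -[X in X <= _]card_ord -cardsT -(card_imset _ gI); apply: subset_leq_card.
  apply/subsetP => p /imsetP [j _ ->]; rewrite inE (hdE _ _ (gS j)) eqxx andbT.
  have [|q qE [e _]] := phiT (Tagged (fun v => 'I_(f v)) j); first by rewrite inE.
  by move: e; rewrite gS => -[->].
exists hd; split=> [p pE|v|A oA].
- rewrite /hd; case: pickP => [i /eqP e|_]; last by left.
  have [|q qE [e' h]] := phiT i; first by rewrite inE.
  by move: e' h; rewrite e => -[<-] /orP [/eqP ->|/eqP ->]; [left | right].
- exact: leq_trans (f0 v) (le v).
- have h1 := fA A oA.
  have h2 : \sum_(v in A) f v <= \sum_(v in A) indeg hd E v by apply: leq_sum => v _.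
  have h3 : \sum_(v in A) indeg hd E v = cnt (fun p => hd p \in A) E.
    rewrite /indeg cntE; under eq_bigr do rewrite cntE.
    by rewrite exchange_big; apply: eq_bigr => p _; rewrite sum_mem.
  have h4 : cnt (fun p => hd p \in A) E <=
      cnt (fun p => (hd p \in A) && ~~ ((p.1 \in A) && (p.2 \in A))) E + inner A.
    rewrite /inner !cntE -big_split /=; apply: leq_sum => p _.
    by case: (hd p \in A); case: (p.1 \in A); case: (p.2 \in A).
  by move: h1 h2 h4; rewrite h3; clear; lia.
Qed.

End Orient.

(** * Factors of bipartite multigraphs *)

Lemma subset_card (T : finType) (A : {set T}) n : n <= #|A| -> exists2 B : {set T}, B \subset A & #|B| = n.
Proof.
elim: n => [|n IH] h; first by exists set0; rewrite ?sub0set ?cards0.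
have [B BA cB] := IH (ltnW h).
have : 0 < #|A :\: B| by rewrite cardsD (setIidPr BA) cB subn_gt0.
case/card_gt0P => x; rewrite inE => /andP [xB xA].
by exists (x |: B); rewrite ?subUset ?sub1set ?xA // cardsU1 xB cB.
Qed.

Section Fibres.
Variables (T I : finType) (g : T -> I).
Implicit Types E F L : {set T}.

(** With a projection as [g] these are the degrees on one side of a bipartite multigraph with edge
    set [E]. A general [g] allows vertices to be split. *)
Definition fibre E i := cnt (fun p => g p == i) E.

Lemma fibreE E i : fibre E i = #|[set p in E | g p == i]|. Proof. by []. Qed.

Lemma sum_fibre E (S : {set I}) : \sum_(i in S) fibre E i = cnt (fun p => g p \in S) E.
Proof.
rewrite /fibre cntE; under eq_bigr do rewrite cntE.
by rewrite exchange_big; apply: eq_bigr => p _; rewrite sum_mem.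
Qed.

Lemma choose_fibres L (h : I -> nat) : (forall i, h i <= fibre L i) ->
  exists2 L' : {set T}, L' \subset L & forall i, fibre L' i = h i.
Proof.
move=> hL.
have /fin_all_exists [B hB] i : exists B : {set T}, B \subset [set p in L | g p == i] /\ #|B| = h i.
  by have [B sB cB] := subset_card (hL i); exists B.
exists [set p in L | p \in B (g p)]; first by apply/subsetP => p; rewrite inE => /andP [].
move=> i; have [sB <-] := hB i; rewrite fibreE; apply: eq_card => p; rewrite !inE.
apply/idP/idP => [/andP [/andP [_ pB] /eqP <-] //|pB].
by have := subsetP sB p pB; rewrite inE => /andP [pL /eqP e]; rewrite pL e pB eqxx.
Qed.

(** Splits every vertex into vertices of degree [f]. One type of labels has to serve all fibres, and
    labels beyond the number of parts of a vertex account for the value 0. *)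
Lemma group_fibres E f : 0 < f -> (forall i, f %| fibre E i) ->
  exists h : T -> 'I_#|T|.+1, forall i n, let c := cnt (fun p => (g p, h p) == (i, n)) E in
    c = 0 \/ c = f.
Proof.
move=> f0 hE.
have G (B : {set T}) q : #|B| = q * f -> exists h : T -> nat,
    (forall p, p \in B -> h p < q) /\ (forall n, n < q -> cnt (fun p => h p == n) B = f).
  elim: q B => [|q IH] B.
    rewrite mul0n => /eqP; rewrite cards_eq0 => /eqP ->.
    by exists (fun=> 0); split=> // p; rewrite inE.
  move=> cB; have [C CB cC] : exists2 C : {set T}, C \subset B & #|C| = f.
    by apply: subset_card; rewrite cB mulSn leq_addr.
  have [|h [h1 h2]] := IH (B :\: C).
    by rewrite cardsD (setIidPr CB) cB cC mulSn addKn.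
  exists (fun p => if p \in C then q else h p); split=> [p pB|n].
    by case: ifP => // pC; rewrite ltnW // ltnS h1 // inE pC.
  rewrite (cntD _ CB) ltnS leq_eqVlt => /orP [/eqP ->|nq].
    rewrite cnt_all => [|p ->]; last by rewrite eqxx.
    rewrite cnt0 ?addn0 // => p pBC; have := h1 p pBC; move: pBC; rewrite inE => /andP [/negbTE -> _].
    by move=> h'; rewrite neq_ltn h'.
  rewrite cnt0 => [|p ->]; last by rewrite neq_ltn nq orbT.
  rewrite add0n -(h2 n nq); apply: eq_cnt => p; by rewrite inE => /andP [/negbTE ->].
have /fin_all_exists [h hh] i : exists h : T -> nat,
    (forall p, p \in [set p in E | g p == i] -> h p < fibre E i %/ f) /\
    (forall n, n < fibre E i %/ f -> cnt (fun p => h p == n) [set p in E | g p == i] = f).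
  by apply: G; rewrite divnK // hE.
have hb p : p \in E -> h (g p) p < #|T|.+1.
  move=> pE; have [h1 _] := hh (g p); rewrite ltnS ltnW //.
  apply: leq_trans (h1 p _) _; first by rewrite inE pE eqxx.
  apply: leq_trans (leq_div _ _) _; exact: max_card.
exists (fun p => inord (h (g p) p)) => i n /=.
have [h1 h2] := hh i.
have -> : cnt (fun p => (g p, inord (h (g p) p)) == (i, n)) E =
          cnt (fun p => h i p == n) [set p in E | g p == i].
  apply: eq_card => p; rewrite !inE xpair_eqE; case pE: (p \in E) => //=.
  by case: eqP => //= <-; rewrite -val_eqE /= inordK // hb.
have [lt|ge] := ltnP n (fibre E i %/ f); first by right; exact: h2.
left; apply: cnt0 => p /h1 lt; apply/negP => /eqP e; by rewrite e ltnNge ge in lt.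
Qed.

End Fibres.

Lemma fibre_pair (T I K : finType) (g : T -> I) (h : T -> K) (E : {set T}) i :
  fibre g E i = \sum_n fibre (fun p => (g p, h p)) E (i, n).
Proof.
rewrite /fibre cntE; under [RHS]eq_bigr do rewrite cntE.
rewrite exchange_big /=; apply: eq_bigr => p _.
rewrite (bigD1 (h p)) //= big1 => [|n nh]; first by rewrite xpair_eqE eqxx andbT addn0.
by rewrite xpair_eqE [h p == n]eq_sym (negbTE nh) andbF.
Qed.

Section Factors.
Variables (T I J : finType).
Implicit Types E M : {set T}.

(** Counting edges gives Hall's condition for the vertices of positive degree on the first side. On
    the second side the matching is nowhere too large and the totals agree, so equality holds at
    every vertex. *)
Lemma perfect_transversal (gx : T -> I) (gy : T -> J) E f : 0 < f ->
  (forall i, fibre gx E i = 0 \/ fibre gx E i = f) -> (forall j, fibre gy E j = 0 \/ fibre gy E j = f) ->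
  exists2 M : {set T}, M \subset E &
    (forall i, f * fibre gx M i = fibre gx E i) /\ (forall j, f * fibre gy M j = fibre gy E j).
Proof.
move=> f0 hx hy.
pose D := [set i | 0 < fibre gx E i].
pose r i j := [exists e in E, (gx e == i) && (gy e == j)].
have [|phi [phiT phiI]] := @hall I J r D setT.
  move=> S SD; rewrite setIT -(leq_pmul2l f0).
  have -> : f * #|S| = \sum_(i in S) fibre gx E i.
    rewrite mulnC -sum_nat_const; apply: eq_bigr => i /(subsetP SD); rewrite inE.
    by have [->|->] := hx i.
  apply: leq_trans (_ : \sum_(j in nbrs r S) fibre gy E j <= _).
    rewrite !sum_fibre !cntE; apply: leq_sum => e eE.
    case: (boolP (gx e \in S)) => // eS; rewrite lt0b inE.
    by apply/existsP; exists (gx e); rewrite eS; apply/existsP; exists e; rewrite eE !eqxx.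
  rewrite mulnC -sum_nat_const; apply: leq_sum => j _; have [->|->] //:= hy j.
have pick i : exists e : option T, i \in D -> exists2 e', e = Some e' & e' \in E /\ gx e' = i /\ phi i = Some (gy e').
  have [iD|iD] := boolP (i \in D); last by exists None.
  have [j _ [e1 /existsP [e /andP [eE /andP [/eqP ex /eqP ey]]]]] := phiT i iD.
  by exists (Some e) => _; exists e; rewrite // e1 ey.
have [c hc] := fin_all_exists pick.
pose M := [set e in E | (gx e \in D) && (c (gx e) == Some e)].
have ME : M \subset E by apply/subsetP => e; rewrite inE => /andP [].
have Mx i : i \in D -> fibre gx M i = 1.
  move=> iD; have [e ce [eE [ei _]]] := hc i iD.
  rewrite fibreE; apply/eqP/cards1P; exists e; apply/setP => e'; rewrite !inE.
  apply/idP/eqP => [/andP [/andP [_ /andP [_ /eqP h]] /eqP e'i]|->].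
    by move: h; rewrite e'i ce => -[].
  by rewrite eE ei; move: (iD); rewrite inE => ->; rewrite ce !eqxx.
have Mx0 i : i \notin D -> fibre gx M i = 0.
  move=> iD; apply: cnt0 => e; rewrite inE => /andP [_ /andP [h _]].
  by apply: contraNneq iD => <-.
have My1 j : fibre gy M j <= 1.
  rewrite fibreE; apply/card_le1_eqP => e e'; rewrite !inE.
  move=> /andP [/andP [eE /andP [eD /eqP ce]] /eqP ej] /andP [/andP [e'E /andP [e'D /eqP ce']] /eqP e'j].
  have eD' : gx e \in D by rewrite inE.
  have e'D' : gx e' \in D by rewrite inE.
  have [a ca [_ [_ pa]]] := hc _ eD'; have [b cb [_ [_ pb]]] := hc _ e'D'.
  move: ca cb; rewrite ce ce' => -[ea] [eb].
  have eg : gx e = gx e' by apply: phiI => //; rewrite pa pb -ea -eb ej e'j.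
  by apply: Some_inj; rewrite -ce -ce' eg.
have My0 j : fibre gy E j = 0 -> fibre gy M j = 0.
  by move=> e; apply/eqP; rewrite -leqn0 -e; exact: cnt_mono.
have sums : f * \sum_j fibre gy M j = \sum_j fibre gy E j.
  have tot (K : finType) (h : T -> K) A : \sum_j fibre h A j = #|A|.
    have -> : \sum_j fibre h A j = \sum_(j in setT) fibre h A j by apply: eq_bigl => j; rewrite inE.
    by rewrite sum_fibre cnt_all // => p _; rewrite inE.
  rewrite !tot -(tot _ gx M) -(tot _ gx E) big_distrr; apply: eq_bigr => i _ /=.
  have [iD|iD] := boolP (i \in D).
    by rewrite Mx // muln1; move: iD; rewrite inE; have [->|->] := hx i.
  by rewrite Mx0 // muln0; move: iD; rewrite inE lt0n negbK => /eqP ->.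
exists M => //; split=> [i|j].
  have [iD|iD] := boolP (i \in D).
    by rewrite Mx // muln1; move: iD; rewrite inE; have [->|->] := hx i.
  by rewrite Mx0 // muln0; move: iD; rewrite inE lt0n negbK => /eqP ->.
have le j' : f * fibre gy M j' <= fibre gy E j'.
  have [e|->] := hy j'; first by rewrite e My0 // muln0.
  by rewrite -[X in _ <= X]muln1 leq_mul2l My1 orbT.
have := sums; rewrite big_distrr /= => /eqP.
rewrite eq_sym => e; apply/eqP; rewrite eqn_leq le /=.
move: e; rewrite (bigD1 j) //= [X in _ == X](bigD1 j) //= => /eqP e.
have : \sum_(i | i != j) f * fibre gy M i <= \sum_(i | i != j) fibre gy E i by apply: leq_sum => i _.
by move: e; clear; lia.
Qed.

End Factors.

(** Split the vertices into vertices of degree [f], take a perfect matching there, and merge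
    again. *)
Lemma factor_matching (T I J : finType) (gx : T -> I) (gy : T -> J) (E : {set T}) f : 0 < f ->
  (forall i, f %| fibre gx E i) -> (forall j, f %| fibre gy E j) ->
  exists2 M : {set T}, M \subset E &
    (forall i, f * fibre gx M i = fibre gx E i) /\ (forall j, f * fibre gy M j = fibre gy E j).
Proof.
move=> f0 hx hy.
have [h hh] := group_fibres f0 hx; have [h' hh'] := group_fibres f0 hy.
have [||M ME [Mx My]] := @perfect_transversal _ _ _ (fun p => (gx p, h p)) (fun p => (gy p, h' p)) E f f0.
- by move=> [i n]; exact: hh.
- by move=> [i n]; exact: hh'.
exists M => //; split=> [i|j].
  by rewrite (fibre_pair gx h) (fibre_pair gx h E) big_distrr; apply: eq_bigr => n _ /=.
by rewrite (fibre_pair gy h') (fibre_pair gy h' E) big_distrr; apply: eq_bigr => n _ /=.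
Qed.

(** After [t] matchings are removed, a degree f q has become (f - t) q, so the previous lemma
    applies to the rest with f - t in place of [f]. *)
Lemma partial_factor (T I J : finType) (gx : T -> I) (gy : T -> J) (E : {set T}) f t : t <= f ->
  (forall i, f %| fibre gx E i) -> (forall j, f %| fibre gy E j) ->
  exists2 F : {set T}, F \subset E &
    (forall i, f * fibre gx F i = t * fibre gx E i) /\ (forall j, f * fibre gy F j = t * fibre gy E j).
Proof.
move=> tf hx hy; elim: t tf => [|t IH] tf.
  by exists set0; rewrite ?sub0set //; split=> i; rewrite /fibre cnt0 ?muln0 // => p; rewrite inE.
have [F FE [Fx Fy]] := IH (ltnW tf).
have f0 : 0 < f by apply: leq_trans tf.
have rest (K : finType) (g : T -> K) i : f * fibre g F i = t * fibre g E i -> f %| fibre g E i ->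
    fibre g (E :\: F) i = (f - t) * (fibre g E i %/ f).
  have := cntD (fun p => g p == i) FE; rewrite -!/(fibre _ _ _) => e h /dvdnP [q eq].
  move: h; rewrite eq mulnA [t * q * f]mulnC => /eqP; rewrite eqn_pmul2l // => /eqP h.
  by rewrite mulnK // mulnBl; move: e; rewrite eq h [f * q]mulnC; clear; lia.
have [|||M ME [Mx My]] := @factor_matching _ _ _ gx gy (E :\: F) (f - t); first by rewrite subn_gt0.
- by move=> i; rewrite rest // dvdn_mulr.
- by move=> i; rewrite rest // dvdn_mulr.
have dFM : [disjoint F & M].
  rewrite -setI_eq0; apply/eqP/setP => p; rewrite !inE; apply/negP => /andP [pF /(subsetP ME)].
  by rewrite inE pF.
have fin (K : finType) (g : T -> K) i : f * fibre g F i = t * fibre g E i -> f %| fibre g E i ->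
    (f - t) * fibre g M i = fibre g (E :\: F) i -> f * fibre g (F :|: M) i = t.+1 * fibre g E i.
  move=> h d; rewrite rest // => /eqP; rewrite eqn_pmul2l ?subn_gt0 // => /eqP e.
  by rewrite /fibre cntU // -!/(fibre _ _ _) mulnDr h e mulnC [f * _]mulnC divnK // mulSn addnC mulnC.
exists (F :|: M); last by split=> i; apply: fin.
rewrite subUset FE; apply: subset_trans ME _; exact: subsetDl.
Qed.

(** * Distance to the multiples of 2k *)

Section Norm.
Local Open Scope ring_scope.
Variable k : nat.
Hypothesis k_gt0 : (0 < k)%N.

(** The distance of [z] to the nearest multiple of 2k. Since the modulus is even, the distance has
    the parity of [z], which all parity arguments below use. *)
Definition cdist (z : int) : int :=
  let r := (z %% (2 * k)%:Z)%Z in Num.min r ((2 * k)%:Z - r).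

Lemma cdist_ex z : exists q r, [/\ z = q * (2 * k)%:Z + r, `|r| <= k%:Z & cdist z = `|r|].
Proof.
have d0 : (2 * k)%:Z != 0 by lia.
have E := divz_eq z (2 * k)%:Z.
have r0 := modz_ge0 z d0.
have r1 : (z %% (2 * k)%:Z)%Z < (2 * k)%:Z by apply: ltz_pmod; lia.
rewrite /cdist; move: E r0 r1.
move: (z %/ (2 * k)%:Z)%Z (z %% (2 * k)%:Z)%Z => q r E r0 r1.
have [le|lt] := leP r k%:Z.
  exists q, r; split=> //; lia.
exists (q + 1), (r - (2 * k)%:Z); split; [rewrite E; ring | lia | lia].
Qed.

Lemma cdist_le z q r : z = q * (2 * k)%:Z + r -> cdist z <= `|r|.
Proof.
move=> E; have [q' [r' [E' b ->]]] := cdist_ex z.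
have {}E : r = (q' - q) * (2 * k)%:Z + r' by lia.
have [|/eqP n0] := eqVneq (q' - q) 0 => [h|]; first by move: E; rewrite h; lia.
have : 1 <= `|q' - q| by lia.
move: (q' - q) E => s E s1.
have : (2 * k)%:Z <= `|s * (2 * k)%:Z| by rewrite normrM; nia.
lia.
Qed.

Lemma cdist_eq z q r : z = q * (2 * k)%:Z + r -> `|r| <= k%:Z -> cdist z = `|r|.
Proof.
move=> E b; apply/eqP; rewrite eq_le (cdist_le E) /=.
have [q' [r' [E' b' ->]]] := cdist_ex z.
have {}E : r' = (q - q') * (2 * k)%:Z + r by lia.
have [|/eqP n0] := eqVneq (q - q') 0 => [h|]; first by move: E; rewrite h; lia.
have : 1 <= `|q - q'| by lia.
move: (q - q') E => s E s1.
have : (2 * k)%:Z <= `|s * (2 * k)%:Z| by rewrite normrM; nia.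
lia.
Qed.

Lemma cdist_ge0 z : 0 <= cdist z.
Proof. by have [q [r [_ _ ->]]] := cdist_ex z. Qed.

Lemma cdist_lek z : cdist z <= k%:Z.
Proof. by have [q [r [_ ? ->]]] := cdist_ex z. Qed.

Lemma cdistN z : cdist (- z) = cdist z.
Proof.
have [q [r [E b ->]]] := cdist_ex z.
have E1 : - z = (- q) * (2 * k)%:Z + (- r) by rewrite E; ring.
by rewrite (cdist_eq E1) normrN.
Qed.

Lemma cdist_cong z z' : ((2 * k)%:Z %| z - z')%Z -> cdist z = cdist z'.
Proof.
move=> /dvdzP [s Es]; have [q [r [E b ->]]] := cdist_ex z'.
apply: (@cdist_eq _ (s + q)) => //.
by rewrite mulrDl -addrA -E -Es subrK.
Qed.

Lemma cdistD a b : cdist (a + b) <= cdist a + cdist b.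
Proof.
have [q [r [E _ ->]]] := cdist_ex a; have [q' [r' [E' _ ->]]] := cdist_ex b.
apply: le_trans (ler_normD r r').
by apply: (@cdist_le _ (q + q')); rewrite E E'; ring.
Qed.

Lemma cdist_par z : (2 %| z - cdist z)%Z.
Proof.
have [q [r [-> _ ->]]] := cdist_ex z.
have [h|h] := leP 0 r.
  have -> : q * (2 * k)%:Z + r - `|r| = (q * k%:Z) * 2 by rewrite ger0_norm //; lia.
  exact: dvdz_mull.
have -> : q * (2 * k)%:Z + r - `|r| = (q * k%:Z + r) * 2 by rewrite ltr0_norm //; lia.
exact: dvdz_mull.
Qed.

Lemma cdist0_dvd z : cdist z = 0 -> ((2 * k)%:Z %| z)%Z.
Proof.
have [q [r [-> _ ->]]] := cdist_ex z => /eqP; rewrite normr_eq0 => /eqP ->.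
by rewrite addr0 dvdz_mull.
Qed.

Lemma cdistD_le z j : cdist (z + j) <= cdist z + `|j|.
Proof.
apply: le_trans (cdistD z j) _; rewrite lerD2l.
by apply: (@cdist_le _ 0); rewrite mul0r add0r.
Qed.

Lemma cdist_step z : cdist (z - 1) = cdist z - 1 \/ cdist (z - 1) = cdist z + 1.
Proof.
have [q [r [E b Er]]] := cdist_ex z.
have [h|h] := ltP 0 r.
  left; rewrite Er (@cdist_eq _ q (r - 1)) ?E; lia.
have [h'|h'] := ltP (- k%:Z) r.
  right; rewrite Er (@cdist_eq _ q (r - 1)) ?E; lia.
left; rewrite Er (@cdist_eq _ (q - 1) (k%:Z - 1)) ?E; lia.
Qed.

Lemma cdist_stepE z : cdist z != 0 -> cdist (z - 1) = cdist z - 1 \/ cdist (z + 1) = cdist z - 1.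
Proof.
have [q [r [E b Er]]] := cdist_ex z => n0.
have [h|h] := ltP 0 r.
  left; rewrite Er (@cdist_eq _ q (r - 1)) ?E; lia.
right; rewrite Er (@cdist_eq _ q (r + 1)) ?E; lia.
Qed.

Lemma cdist_k z : cdist z = k%:Z -> cdist (z - 1) = k%:Z - 1 /\ cdist (z + 1) = k%:Z - 1.
Proof.
have [q [r [E b ->]]] := cdist_ex z => rk.
have [h|h] := leP 0 r.
  by rewrite (@cdist_eq (z - 1) q (r - 1)) ?(@cdist_eq (z + 1) (q + 1) (r + 1 - (2 * k)%:Z)) ?E; split || idtac; lia.
by rewrite (@cdist_eq (z + 1) q (r + 1)) ?(@cdist_eq (z - 1) (q - 1) (r - 1 + (2 * k)%:Z)) ?E; split || idtac; lia.
Qed.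

(** If a step down shortens the distance, then [z] lies above its nearest multiple of 2k; a midpoint
    between two multiples counts as lying above the lower one. *)
Lemma cdist_pos z : cdist (z - 1) = cdist z - 1 -> ((2 * k)%:Z %| z - cdist z)%Z.
Proof.
have [q [r [E b Er]]] := cdist_ex z => h.
have [r0|r0] := leP 0 r.
  by rewrite Er ger0_norm // E addrK dvdz_mull.
have [h'|h'] := ltP (- k%:Z) r.
  move: h; rewrite Er (@cdist_eq _ q (r - 1)) ?E; lia.
have -> : z - cdist z = (q - 1) * (2 * k)%:Z by rewrite Er E; lia.
exact: dvdz_mull.
Qed.

Lemma cdist_add z j : ((2 * k)%:Z %| z - cdist z)%Z -> 0 <= j -> cdist z + j <= k%:Z ->
  cdist (z + j) = cdist z + j.
Proof.
move=> /dvdzP [q E] j0 b; have z0 := cdist_ge0 z.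
have EE : z + j = q * (2 * k)%:Z + (cdist z + j) by rewrite -E; ring.
rewrite (cdist_eq EE) ger0_norm //; lia.
Qed.

End Norm.

(** * Orientations with prescribed net degrees modulo 2k *)

Section Weights.
Local Open Scope ring_scope.
Variable V : finType.
Implicit Types (w o : V -> V -> int) (f : V -> int) (A B : {set V}) (u v a b : V) (c : int).

Definition tot f A := \sum_(v in A) f v.
Definition cutw w A := \sum_(u in A) \sum_(v | v \notin A) w u v.
Definition dw w v := \sum_u w v u.
Definition net o v := \sum_u (o v u - o u v).

Definition bump f u c : V -> int := fun a => f a + (if a == u then c else 0).
Definition arc u v c : V -> V -> int := fun a b => if (a == u) && (b == v) then c else 0.
Definition aadd o u v c : V -> V -> int := fun a b => o a b + arc u v c a b.
(** A multigraph is a symmetric function, so an undirected edge is recorded in both orders. *)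
Definition eadd w u v c : V -> V -> int := aadd (aadd w u v c) v u c.

Lemma sum_if1 (P : pred V) u c :
  \sum_(i | P i) (if i == u then c else 0) = if P u then c else 0.
Proof.
rewrite -big_mkcondr /=; case: ifP => Pu.
  by rewrite (big_pred1 u) // => a /=; case: eqP => [->|]; rewrite ?Pu ?andbF.
by rewrite big_pred0 // => a /=; case: eqP => [->|]; rewrite ?Pu ?andbF.
Qed.

Lemma tot_bump f u c A : tot (bump f u c) A = tot f A + (if u \in A then c else 0).
Proof.
by rewrite /tot /bump big_split /= sum_if1.
Qed.

Lemma cutw_aadd w u v c A :
  cutw (aadd w u v c) A = cutw w A + (if (u \in A) && (v \notin A) then c else 0).
Proof.
rewrite /cutw /aadd; under eq_bigr do rewrite big_split /=.
rewrite big_split /=; congr (_ + _).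
have E a : \sum_(b | b \notin A) arc u v c a b = if a == u then (if v \notin A then c else 0) else 0.
  by rewrite /arc; case: (a == u) => /=; [rewrite sum_if1 | rewrite big1].
by under eq_bigr do rewrite E; rewrite sum_if1; case: (u \in A).
Qed.

Lemma cutw_eadd w u v c A :
  cutw (eadd w u v c) A = cutw w A + (if (u \in A) (+) (v \in A) then c else 0).
Proof.
by rewrite /eadd !cutw_aadd; case: (u \in A); case: (v \in A); rewrite /= ?addr0 // ?addr0.
Qed.

Lemma dw_aadd w u v c a : dw (aadd w u v c) a = dw w a + (if a == u then c else 0).
Proof.
rewrite /dw /aadd big_split /=; congr (_ + _).
rewrite /arc; case: (a == u) => /=; last by rewrite big1.
by rewrite sum_if1.
Qed.

Lemma dw_eadd w u v c a : dw (eadd w u v c) a =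
  dw w a + (if a == u then c else 0) + (if a == v then c else 0).
Proof. by rewrite /eadd !dw_aadd. Qed.

Lemma net_aadd o u v c a : net (aadd o u v c) a =
  net o a + (if a == u then c else 0) - (if a == v then c else 0).
Proof.
rewrite /net !sumrB -!/(dw _ _).
have E (g : V -> V -> int) : \sum_i aadd g u v c i a = \sum_i g i a + (if a == v then c else 0).
  rewrite /aadd big_split /=; congr (_ + _); rewrite /arc.
  case: (a == v); last by rewrite big1 // => i _; rewrite andbF.
  under eq_bigr do rewrite andbT.
  by rewrite sum_if1.
rewrite -/(dw (aadd o u v c) a) dw_aadd E /dw; ring.
Qed.

Definition size_w w : int := \sum_u dw w u.

Lemma size_eadd w u v c : size_w (eadd w u v c) = size_w w + c + c.
Proof.
rewrite /size_w; under eq_bigr do rewrite dw_eadd.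
by rewrite !big_split /= !sum_if1.
Qed.

Definition symw w := forall a b, w a b = w b a.
Definition irrw w := forall a, w a a = 0.

Lemma eadd_sym w u v c : symw w -> symw (eadd w u v c).
Proof.
move=> s a b; rewrite /eadd /aadd /arc s -!addrA; congr (_ + _).
by rewrite addrC [(a == v) && _]andbC [(a == u) && _]andbC.
Qed.

Lemma eadd_irr w u v c : u != v -> irrw w -> irrw (eadd w u v c).
Proof.
move=> uv s a; rewrite /eadd /aadd /arc s.
case: (eqVneq a u) => [->|] /=; rewrite ?(negbTE uv) ?addr0 //=.
by rewrite andbF addr0.
Qed.

Lemma eadd_ge0 w u v c : u != v -> symw w -> (forall a b, 0 <= w a b) -> 0 <= w u v + c ->
  forall a b, 0 <= eadd w u v c a b.
Proof.
move=> uv s ge h a b; rewrite /eadd /aadd /arc; have := ge a b.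
case: (eqVneq a u) => [->|_]; case: (eqVneq b v) => [->|_] /=; rewrite ?(negbTE uv) ?addr0 //=.
  by rewrite andbC eq_sym (negbTE uv) addr0.
by case: (eqVneq a v) => [->|_] //=; case: (eqVneq b u) => [->|_] //=; rewrite ?addr0 // s.
Qed.

Lemma eadd_out w u v c a b : ~~ ((a == u) && (b == v)) -> ~~ ((a == v) && (b == u)) ->
  eadd w u v c a b = w a b.
Proof. by rewrite /eadd /aadd /arc => /negbTE -> /negbTE ->; rewrite !addr0. Qed.

Lemma tot_split f A B : A \subset B -> tot f B = tot f A + tot f (B :\: A).
Proof. by move=> sub; rewrite /tot (big_setID A) /= (setIidPr sub). Qed.

Lemma totC f A : tot f setT = tot f A + tot f (~: A).
Proof. by rewrite (tot_split _ (subsetT A)) setTD. Qed.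

Lemma tot1 f v : tot f [set v] = f v.
Proof. by rewrite /tot big_set1. Qed.

Lemma cutw1 w v : irrw w -> cutw w [set v] = dw w v.
Proof.
move=> irr; rewrite /cutw big_set1 /dw [RHS](bigD1 v) //= irr add0r.
by apply: eq_bigl => u; rewrite in_set1.
Qed.

Lemma cutwC w A : symw w -> cutw w (~: A) = cutw w A.
Proof.
move=> s; rewrite /cutw [RHS]exchange_big /=.
rewrite (eq_bigl (fun v => v \notin A)); last by move=> v; rewrite in_setC.
apply: eq_bigr => v _; rewrite (eq_bigl (fun u => u \in A)) => [|u]; last by rewrite in_setC negbK.
exact: eq_bigr.
Qed.

Lemma tot_ge0 f A : (forall a, 0 <= f a) -> 0 <= tot f A.
Proof. by move=> h; apply: sumr_ge0 => ? _. Qed.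

Lemma sum_sym_even w A : symw w -> irrw w ->
  (2 %| \sum_(u in A) \sum_(v in A) w u v)%Z.
Proof.
move=> s ir; move En : #|A| => n; elim: n A En => [|n IH] A.
  by move=> /cards0_eq ->; rewrite big_set0.
move=> En; have [x xA] : exists x, x \in A by apply/set0Pn; rewrite -card_gt0 En.
have E (g : V -> int) : \sum_(u in A) g u = g x + \sum_(u in A :\ x) g u by rewrite (big_setD1 x).
rewrite E; under [X in _ + X]eq_bigr do rewrite E; rewrite E ir add0r big_split /=.
rewrite addrA; apply: rpredD; last by apply: IH; rewrite [#|_|](cardsD1 x) xA in En; case: En.
rewrite (eq_bigr (fun u => w u x)) => [|u _]; last exact: s.
by apply/dvdzP; exists (\sum_(u in A :\ x) w u x); ring.
Qed.

Lemma sum_dw w A : \sum_(u in A) dw w u = cutw w A + \sum_(u in A) \sum_(v in A) w u v.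
Proof.
rewrite /cutw -big_split /=; apply: eq_bigr => u _.
by rewrite /dw (bigID (mem A)) /= addrC.
Qed.

Lemma cutw_setU1 w A x : symw w -> irrw w -> x \notin A ->
  cutw w (x |: A) = cutw w A + dw w x - 2 * \sum_(v in A) w x v.
Proof.
move=> s ir xA.
rewrite /cutw big_setU1 //=.
have E u : \sum_(v | v \notin A) w u v = w u x + \sum_(v | v \notin x |: A) w u v.
  rewrite (bigD1 x) //=; congr (_ + _); apply: eq_bigl => v.
  by rewrite in_setU1 negb_or andbC.
under [X in _ = X + _ - _]eq_bigr do rewrite E.
rewrite [in RHS]big_split /= [X in _ = X + _ + _ - _](eq_bigr (fun v => w x v)); last by move=> v _; exact: s.
have -> : dw w x = \sum_(v in A) w x v + \sum_(v | v \notin x |: A) w x v.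
  by rewrite /dw (bigID (mem A)) /= E ir add0r.
ring.
Qed.

Lemma cutw_par w f A : symw w -> irrw w -> (forall v, 2 %| f v - dw w v)%Z ->
  (2 %| tot f A - cutw w A)%Z.
Proof.
move=> s ir h.
have -> : tot f A - cutw w A = \sum_(u in A) (f u - dw w u) + \sum_(u in A) \sum_(v in A) w u v.
  by rewrite sumrB sum_dw -/(tot f A); ring.
apply: rpredD; last exact: sum_sym_even.
by apply: rpred_sum => i _; exact: h.
Qed.

(** When a contraction is undone, this shares the out-arcs of a merged bundle among the edges that
    were merged. *)
Lemma distribute (c : V -> int) A t : (forall u, 0 <= c u) -> 0 <= t <= tot c A ->
  exists p : V -> int, (forall u, 0 <= p u <= c u) /\ tot p A = t.
Proof.
move=> c0; move En : #|A| => n; elim: n A t En => [|n IH] A t.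
  move=> /cards0_eq ->; rewrite /tot big_set0 => h; exists (fun => 0); split=> [u|]; first by rewrite c0 lexx.
  by rewrite big_set0; lia.
move=> En; have [x xA] : exists x, x \in A by apply/set0Pn; rewrite -card_gt0 En.
have E (g : V -> int) : tot g A = g x + tot g (A :\ x) by rewrite /tot (big_setD1 x).
rewrite E => h; have cx := c0 x.
have t0 := tot_ge0 (A :\ x) c0.
have [||p [pc pt]] := IH (A :\ x) (t - Num.min t (c x)).
- by rewrite [#|_|](cardsD1 x) xA in En; case: En.
- by have [] := leP t (c x); lia.
exists (fun u => if u == x then Num.min t (c x) else p u); split=> [u|].
  by case: eqP => [->|_] //; have [] := leP t (c x); lia.
rewrite E eqxx /tot (eq_bigr p) -/(tot p _) ?pt; first by have [] := leP t (c x); lia.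
by move=> u; rewrite in_setD1 => /andP [/negbTE ->].
Qed.

End Weights.

(** * States of the induction and contraction of tight sets *)

Section States.
Local Open Scope ring_scope.
Variables (V : finType) (k : nat).
Hypothesis k_gt1 : (1 < k)%N.
Local Notation N := ((2 * k)%:Z).
Local Notation K := ((2 * k)%:Z - 2).
Local Notation nn := (cdist k).
Implicit Types (A B : {set V}) (u v x y : V).

Let k_gt0 : (0 < k)%N. Proof. exact: ltnW. Qed.

(* wt is a multigraph; gout v and gin v count ghost arcs at v without a second end,
   already oriented out of and into v. The arcs of wt are to be oriented with net
   out-degree dem modulo 2k on modv and exactly dem elsewhere; vertices of the
   latter kind are balanced once the ghosts are counted. *)
Record state := State { wt : V -> V -> int; gout : V -> int; gin : V -> int;
  dem : V -> int; modv : {set V} }.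
Implicit Types S : state.

Definition demanded S A := ~~ [disjoint modv S & A] && ~~ (modv S \subset A).
Definition gcut S A := cutw (wt S) A + tot (gout S) A + tot (gin S) A.
(** In every solution the net number of arcs leaving [A], ghosts included, is congruent to this
    modulo 2k. Hence at least [cdist] of it many arcs have to cross the boundary of [A]. *)
Definition tau S A := tot (dem S) A + tot (gout S) A - tot (gin S) A.
Definition ghosts S := tot (gout S) setT + tot (gin S) setT.
Definition gnet S := tot (gout S) setT - tot (gin S) setT.
Definition active S := modv S :|: [set v | 0 < dw (wt S) v].

(** [v_cut] asks for a surplus of 2k - 2 over what the residue forces. [v_gh] is a bound in the
    opposite direction, and it is what the tightness of a set becomes when the edges leaving the set
    turn into ghosts. [v_maj] makes sure that each ghost at an exact vertex can be paired with an
    edge when that vertex is split off. *)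
Record valid S : Prop := Valid {
  v_sym : symw (wt S);
  v_irr : irrw (wt S);
  v_w0 : forall u v, 0 <= wt S u v;
  v_go0 : forall u, 0 <= gout S u;
  v_gi0 : forall u, 0 <= gin S u;
  v_ex : forall x, x \notin modv S -> dem S x + gout S x - gin S x = 0;
  v_maj : forall x, x \notin modv S -> gout S x + gin S x <= dw (wt S) x;
  v_ind : forall x y, x \notin modv S -> y \notin modv S -> wt S x y = 0;
  v_cut : forall A, demanded S A -> K + nn (tau S A) <= gcut S A;
  v_gh : ghosts S <= K + nn (gnet S);
  v_sum : (N %| tot (dem S) setT)%Z;
  v_par : forall v, (2 %| dem S v - dw (wt S) v)%Z }.

Definition solvable S := exists o : V -> V -> int,
  [/\ forall u v, 0 <= o u v, forall u v, o u v + o v u = wt S u v,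
      forall v, v \in modv S -> (N %| dem S v - net o v)%Z
    & forall v, v \notin modv S -> dem S v = net o v].

Definition msize S := (#|active S| + #|modv S|)%N.

Lemma demandedP S A : reflect ((exists2 y, y \in modv S & y \in A) /\ (exists2 y, y \in modv S & y \notin A))
  (demanded S A).
Proof.
apply: (iffP andP) => [[/pred0Pn [y /andP [yS yA]] /subsetPn [z zS zA]]|[[y yS yA] [z zS zA]]].
  by split; [exists y | exists z].
by split; [apply/pred0Pn; exists y; apply/andP | apply/subsetPn; exists z].
Qed.

Lemma dw_ge0 S v : valid S -> 0 <= dw (wt S) v.
Proof. by move=> vS; apply: sumr_ge0 => u _; exact: v_w0. Qed.

(** By parity a cut that is not tight exceeds its bound by at least two. *)
Lemma gcut_parity S A : valid S -> (2 %| gcut S A - nn (tau S A))%Z.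
Proof.
move=> vS.
have h1 := cutw_par A (v_sym vS) (v_irr vS) (v_par vS).
have h2 := cdist_par k_gt0 (tau S A).
have -> : gcut S A - nn (tau S A) =
  (tau S A - nn (tau S A)) - (tot (dem S) A - cutw (wt S) A) + tot (gin S) A * 2.
  by rewrite /gcut /tau; ring.
by apply: rpredD; [apply: rpredB | apply: dvdz_mull].
Qed.

Lemma tot0 (f : V -> int) A : (forall u, u \in A -> f u = 0) -> tot f A = 0.
Proof. by move=> h; apply: big1. Qed.

Lemma tot_pred (f : V -> int) (A B : {set V}) :
  tot (fun u => if u \in A then f u else 0) B = tot f (B :&: A).
Proof.
rewrite /tot -big_mkcondr /=; apply: eq_bigl => u; by rewrite in_setI.
Qed.

(* A tight set A is contracted to a. The orientation found for the contracted graph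
   turns the arcs that leave A into ghosts of the state localised to A. *)
Section Contract.
Variables (S : state) (A : {set V}) (a : V).
Hypotheses (vS : valid S) (dA : demanded S A) (aA : a \in A) (aS : a \in modv S).
Hypothesis tight : gcut S A <= K + nn (tau S A).

(** The vertex type is kept: the vertices of [A] other than [a] remain as isolated vertices outside
    [modv]. *)
Definition collapse v := if v \in A then a else v.
Definition push (f : V -> int) u := \sum_(v | collapse v == u) f v.
Definition cwt u v := if u == v then 0 else \sum_(u' | collapse u' == u) \sum_(v' | collapse v' == v) wt S u' v'.
Definition contracted := State cwt (push (gout S)) (push (gin S)) (push (dem S)) (collapse @: modv S).

Lemma collapse_in v : v \in A -> collapse v = a. Proof. by rewrite /collapse => ->. Qed.
Lemma collapse_out v : v \notin A -> collapse v = v. Proof. by rewrite /collapse => /negbTE ->. Qed.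

Lemma collapse_eq_out u v : v \notin A -> (collapse u == v) = (u == v).
Proof.
move=> vA; rewrite /collapse; case: ifP => // uA.
case: eqP => [av|_]; first by rewrite -av aA in vA.
by case: eqP => // uv; rewrite -uv uA in vA.
Qed.

Lemma collapse_eq_a u : (collapse u == a) = (u \in A).
Proof.
rewrite /collapse; case: ifP => uA; rewrite ?eqxx //.
by case: eqP => // ua; rewrite ua aA in uA.
Qed.

Lemma collapse_eq_in u v : v \in A -> v != a -> (collapse u == v) = false.
Proof.
move=> vA va; rewrite /collapse; case: ifP => uA; first by rewrite eq_sym (negbTE va).
by case: eqP => // uv; rewrite uv vA in uA.
Qed.

Lemma push_out f v : v \notin A -> push f v = f v.
Proof. by move=> vA; rewrite /push (big_pred1 v) // => u; rewrite collapse_eq_out. Qed.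

Lemma push_a f : push f a = tot f A.
Proof. by rewrite /push /tot; apply: eq_bigl => u; rewrite collapse_eq_a. Qed.

Lemma push_in f v : v \in A -> v != a -> push f v = 0.
Proof. by move=> vA va; rewrite /push big_pred0 // => u; rewrite collapse_eq_in. Qed.

Lemma tot_push f B : tot (push f) B = tot f (collapse @^-1: B).
Proof.
rewrite /tot /push [RHS](partition_big collapse (mem B)) /=; last by move=> u; rewrite in_set.
apply: eq_bigr => u uB; apply: eq_bigl => v; rewrite in_set.
by case: eqP => [->|]; rewrite ?uB ?andbF.
Qed.

Lemma cutw_cwt B : cutw cwt B = cutw (wt S) (collapse @^-1: B).
Proof.
rewrite /cutw.
transitivity (\sum_(u in B) push (fun u' => \sum_(v | v \notin B) push (wt S u') v) u).
  apply: eq_bigr => u uB; rewrite /push exchange_big /=; apply: eq_bigr => v vB.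
  by rewrite /cwt; case: eqP => // uv; rewrite -uv uB in vB.
rewrite -/(tot _ B) tot_push /tot; apply: eq_bigr => u _.
have -> : \sum_(v | v \notin B) push (wt S u) v = tot (push (wt S u)) (~: B).
  by apply: eq_bigl => v; rewrite in_setC.
rewrite tot_push; apply: eq_bigl => v; by rewrite !in_set.
Qed.

Lemma cwt_a v : v \notin A -> cwt a v = tot (fun u => wt S u v) A.
Proof.
move=> vA; rewrite /cwt; case: eqP => [av|_]; first by rewrite -av aA in vA.
rewrite /tot; apply: eq_big => [u|u _]; first by rewrite collapse_eq_a.
by rewrite (big_pred1 v) // => v'; rewrite collapse_eq_out.
Qed.

Lemma cwt_out u v : u \notin A -> v \notin A -> cwt u v = wt S u v.
Proof.
move=> uA vA; rewrite /cwt; case: eqP => [->|_]; first by rewrite (v_irr vS).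
rewrite (big_pred1 u) => [|u']; last by rewrite collapse_eq_out.
by rewrite (big_pred1 v) // => v'; rewrite collapse_eq_out.
Qed.

Lemma cwt_sym : symw cwt.
Proof.
move=> u v; rewrite /cwt eq_sym; case: eqP => // _; rewrite exchange_big /=.
by apply: eq_bigr => v' _; apply: eq_bigr => u' _; exact: (v_sym vS).
Qed.

Lemma cwt_irr : irrw cwt. Proof. by move=> u; rewrite /cwt eqxx. Qed.

Lemma cwt_in u v : u \in A -> u != a -> cwt u v = 0.
Proof.
move=> uA ua; rewrite /cwt; case: eqP => // _.
by rewrite big_pred0 // => u'; rewrite collapse_eq_in.
Qed.

Lemma dw_cwt v : v \notin A -> dw cwt v = dw (wt S) v.
Proof.
move=> vA; rewrite -cutw1; last exact: cwt_irr.
rewrite cutw_cwt -cutw1; last exact: (v_irr vS).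
by congr cutw; apply/setP => u; rewrite !inE collapse_eq_out.
Qed.

Lemma contracted_notin x : x \notin modv contracted -> (x \notin A /\ x \notin modv S) \/ (x \in A /\ x != a).
Proof.
move=> xS; have [xA|xA] := boolP (x \in A); [right|left]; split=> //.
  by apply: contraNneq xS => ->; rewrite -(collapse_in aA) imset_f.
by apply: contra xS => xS; rewrite -(collapse_out xA) imset_f.
Qed.

Lemma gcut_contracted B : gcut contracted B = gcut S (collapse @^-1: B).
Proof. by rewrite /gcut /= cutw_cwt !tot_push. Qed.
Lemma tau_contracted B : tau contracted B = tau S (collapse @^-1: B).
Proof. by rewrite /tau /= !tot_push. Qed.

Lemma valid_contracted : valid contracted.
Proof.
split.
- exact: cwt_sym.
- exact: cwt_irr.
- move=> u v /=; rewrite /cwt; case: eqP => // _.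
  by apply: sumr_ge0 => ? _; apply: sumr_ge0 => ? _; exact: (v_w0 vS).
- by move=> u; apply: sumr_ge0 => ? _; exact: (v_go0 vS).
- by move=> u; apply: sumr_ge0 => ? _; exact: (v_gi0 vS).
- move=> x /contracted_notin [[xA xS]|[xA xa]] /=; first by rewrite !push_out // (v_ex vS).
  by rewrite !push_in.
- move=> x /contracted_notin [[xA xS]|[xA xa]] /=; first by rewrite !push_out // dw_cwt // (v_maj vS).
  by rewrite !push_in // addr0; apply: sumr_ge0 => v _; rewrite cwt_in.
- move=> x y /contracted_notin [[xA xS]|[xA xa]] /contracted_notin [[yA yS]|[yA ya]] /=.
  + by rewrite cwt_out // (v_ind vS).
  + by rewrite cwt_sym cwt_in.
  + by rewrite cwt_in.
  + by rewrite cwt_in.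
- move=> B /demandedP [[y yS yB] [z zS zB]]; rewrite gcut_contracted tau_contracted; apply: (v_cut vS).
  have [y' y'S Ey] := imsetP yS; have [z' z'S Ez] := imsetP zS.
  by apply/demandedP; split; [exists y' | exists z']; rewrite // in_set -?Ey -?Ez.
- have := v_gh vS; rewrite /ghosts /gnet /= !tot_push.
  by have -> : collapse @^-1: [set: V] = setT by apply/setP => u; rewrite !in_set.
- have := v_sum vS; rewrite /= !tot_push.
  by have -> : collapse @^-1: [set: V] = setT by apply/setP => u; rewrite !in_set.
- move=> v; rewrite /= -tot1 -(cutw1 _ cwt_irr) tot_push cutw_cwt.
  exact: cutw_par (v_sym vS) (v_irr vS) (v_par vS).
Qed.

Lemma msize_contracted : (1 < #|A :&: active S|)%N -> (msize contracted < msize S)%N.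
Proof.
move=> h; rewrite /msize -addSn; apply: leq_add; last exact: leq_imset_card.
have sub : active contracted \subset a |: (active S :\: A).
  apply/subsetP => v; rewrite in_setU1 in_setD.
  have [vA|vA] := boolP (v \in A) => /=.
    rewrite orbF /active in_setU in_set => /orP [|].
      case/imsetP => u uS Ev; move: vA; rewrite Ev /collapse.
      by case: ifP => // ->.
    apply: contraTT => va; rewrite -leNgt /dw big1 // => u _; exact: cwt_in.
  rewrite /active !in_setU !in_set /= dw_cwt // => /orP [|->]; last by rewrite !orbT.
  case/imsetP => u uS Ev; apply/orP; right; apply/orP; left.
  move: Ev; rewrite /collapse; case: ifP => [_ va|_ ->] //.
  by rewrite va aA in vA.
apply: leq_ltn_trans (subset_leq_card sub) _.
rewrite cardsU1 in_setD aA /= add1n.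
by have := cardsID A (active S); rewrite setIC => <-; rewrite -[X in (X < _)%N]add1n ltn_add2r.
Qed.

Variable o1 : V -> V -> int.
Hypotheses (o1_ge0 : forall u v, 0 <= o1 u v) (o1_w : forall u v, o1 u v + o1 v u = cwt u v).
Hypothesis o1_ms : forall v, v \in modv contracted -> (N %| dem contracted v - net o1 v)%Z.
Hypothesis o1_ex : forall v, v \notin modv contracted -> dem contracted v = net o1 v.

(** The contracted orientation only tells how many of the edges between an outside vertex [v] and
    [A] are directed out of [A]; [p] chooses at which ends in [A]. *)
Lemma cross_ex : exists p : V -> V -> int,
  forall v, v \notin A -> (forall u, 0 <= p v u <= wt S u v) /\ tot (p v) A = o1 a v.
Proof.
have H v : exists p : V -> int, v \notin A -> (forall u, 0 <= p u <= wt S u v) /\ tot p A = o1 a v.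
  have [vA|vA] := boolP (v \in A); first by exists (fun=> 0).
  have [||p hp] := @distribute V (fun u => wt S u v) A (o1 a v).
  - by move=> u; exact: (v_w0 vS).
  - by rewrite o1_ge0 -cwt_a // -o1_w lerDl o1_ge0.
  by exists p.
by have [p hp] := fin_all_exists H; exists p.
Qed.

Variable p : V -> V -> int.
Hypothesis p_w : forall v, v \notin A -> forall u, 0 <= p v u <= wt S u v.
Hypothesis p_tot : forall v, v \notin A -> tot (p v) A = o1 a v.

Definition xnet u := \sum_(v | v \notin A) (2 * p v u - wt S u v).
Definition localised := State (fun u v => if (u \in A) && (v \in A) then wt S u v else 0)
  (fun u => if u \in A then gout S u + \sum_(v | v \notin A) p v u else 0)
  (fun u => if u \in A then gin S u + \sum_(v | v \notin A) (wt S u v - p v u) else 0)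
  (fun u => if u \in A then dem S u - xnet u else 0) (modv S :&: A).

Lemma xnetE u : xnet u = \sum_(v | v \notin A) p v u - \sum_(v | v \notin A) (wt S u v - p v u).
Proof. by rewrite /xnet -sumrB; apply: eq_bigr => v _; ring. Qed.

Lemma tau_localised B : tau localised B = tau S (B :&: A).
Proof.
rewrite /tau /= !tot_pred /tot -!big_split -!sumrB /=.
by apply: eq_bigr => u _; rewrite xnetE; ring.
Qed.

Lemma gcut_localised B : gcut localised B = gcut S (B :&: A).
Proof.
rewrite /gcut /= !tot_pred.
have -> : cutw (wt localised) B = \sum_(u in B :&: A) \sum_(v | (v \in A) && (v \notin B)) wt S u v.
  rewrite /cutw /= [LHS](eq_bigr (fun u => if u \in A then
    \sum_(v | (v \in A) && (v \notin B)) wt S u v else 0)).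
    by rewrite -/(tot _ B) tot_pred.
  move=> u uB; case: ifP => uA /=; last by rewrite big1.
  by rewrite -big_mkcondr /=; apply: eq_bigl => v; rewrite andbC.
rewrite /cutw /tot -!big_split /=; apply: eq_bigr => u.
rewrite in_setI => /andP [uB uA].
rewrite [X in _ = X + _ + _](bigID (mem A)) /=.
have -> : \sum_(i | (i \notin B :&: A) && (i \in A)) wt S u i =
          \sum_(v | (v \in A) && (v \notin B)) wt S u v.
  by apply: eq_bigl => v; rewrite in_setI; case: (v \in A); case: (v \in B).
have -> : \sum_(i | (i \notin B :&: A) && (i \notin A)) wt S u i = \sum_(v | v \notin A) wt S u v.
  by apply: eq_bigl => v; rewrite in_setI; case: (v \in A); case: (v \in B).
rewrite sumrB; ring.
Qed.

Lemma net_o1_in v : v \in A -> o1 a v = 0 /\ o1 v a = 0.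
Proof.
move=> vA; have : cwt a v = 0.
  by have [->|va] := eqVneq v a; [exact: cwt_irr | rewrite cwt_sym cwt_in].
by rewrite -o1_w; have := o1_ge0 a v; have := o1_ge0 v a; lia.
Qed.

Lemma tot_xnet : tot xnet A = net o1 a.
Proof.
rewrite /tot /xnet exchange_big /= /net [RHS](bigID (mem A)) /=.
rewrite [X in _ = X + _]big1 => [|v vA]; last by have [-> ->] := net_o1_in vA; rewrite subr0.
rewrite add0r; apply: eq_bigr => v vA.
rewrite sumrB -mulr_sumr -!/(tot _ A) p_tot // -cwt_a // -o1_w; ring.
Qed.

Lemma valid_localised : valid localised.
Proof.
have aI : a \in modv contracted by rewrite -(collapse_in aA) imset_f.
split.
- by move=> u v /=; rewrite andbC (v_sym vS).
- by move=> u /=; rewrite (v_irr vS) if_same.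
- by move=> u v /=; case: ifP => // _; exact: (v_w0 vS).
- move=> u /=; case: ifP => // _; rewrite addr_ge0 ?(v_go0 vS) //.
  by apply: sumr_ge0 => v vA; have /andP [] := p_w vA u.
- move=> u /=; case: ifP => // _; rewrite addr_ge0 ?(v_gi0 vS) //.
  by apply: sumr_ge0 => v vA; have /andP [] := p_w vA u; rewrite subr_ge0.
- move=> x /=; rewrite in_setI; case: ifP => // xA; rewrite andbT => xS.
  have := v_ex vS xS; rewrite xnetE.
  move: (\sum_(v | _) _) (\sum_(v | _) _) => s t; lia.
- move=> x /=; rewrite in_setI.
  have [xA|xA] := boolP (x \in A); last first.
    move=> _; rewrite addr0; apply: sumr_ge0 => u _; by rewrite /= (negbTE xA).
  rewrite andbT => xS.
  have /demandedP [[y yS yA] [z zS zA]] := dA.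
  (* Removing the exact vertex [x] does not change [tau], so by tightness A \ x has at least as
     large a cut as [A]. Hence [x] has at least as many edges inside [A] as it has edges to the
     outside and ghosts together. *)
  have dAx : demanded S (A :\ x).
    apply/demandedP; split; [exists y => // | exists z => //]; rewrite in_setD1 ?negb_and ?zA ?orbT //.
    by rewrite yA andbT; apply: contraNneq xS => <-.
  have := v_cut vS dAx.
  have xAx : x \notin A :\ x by rewrite in_setD1 eqxx.
  have Etot f : tot f A = f x + tot f (A :\ x) by rewrite /tot (big_setD1 x).
  have Et : tau S (A :\ x) = tau S A.
    by rewrite /tau !Etot; have := v_ex vS xS; lra.
  have EA := cutw_setU1 (v_sym vS) (v_irr vS) xAx; rewrite setD1K // in EA.
  move: tight; rewrite Et /gcut !Etot EA.
  have -> : dw (wt localised) x = \sum_(v in A :\ x) wt S x v.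
    rewrite /dw /= xA /= -big_mkcond /= (big_setD1 x) //= (v_irr vS) add0r //.
  have -> : dw (wt S) x = \sum_(v in A :\ x) wt S x v + \sum_(v | v \notin A) wt S x v.
    rewrite /dw (bigID (mem A)) /=; congr (_ + _).
    by rewrite (big_setD1 x) //= (v_irr vS) add0r.
  rewrite sumrB; lra.
- move=> x y /=; rewrite !in_setI; case: (x \in A); case: (y \in A) => //=; rewrite !andbT.
  exact: (v_ind vS).
- move=> B /demandedP [[y yS yB] [z zS zB]]; rewrite gcut_localised tau_localised; apply: (v_cut vS).
  move: yS zS; rewrite !in_setI => /andP [yS yA] /andP [zS zA].
  apply/demandedP; split; [exists y | exists z] => //; rewrite in_setI ?yB ?yA //.
  by rewrite (negbTE zB).
(* The edges that leave [A] have all become ghosts, so [v_gh] for the localised state is the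
   tightness of [A]. *)
- have Eg : ghosts localised = gcut S A.
    have <- : gcut localised setT = gcut S A by rewrite gcut_localised setTI.
    rewrite /ghosts /gcut /cutw [X in _ = X + _ + _]big1 ?add0r // => u _.
    by rewrite big_pred0 // => v; rewrite in_setT.
  rewrite Eg; apply: le_trans tight _; rewrite lerD2l.
  rewrite (cdist_cong k_gt0 (z' := gnet localised)) //.
  have <- : tau localised setT = tau S A by rewrite tau_localised setTI.
  have -> : tau localised setT - gnet localised = tot (dem localised) setT by rewrite /tau /gnet; ring.
  by rewrite /= tot_pred setTI /tot sumrB -!/(tot _ A) tot_xnet -push_a; exact: o1_ms.
- by rewrite /= tot_pred setTI /tot sumrB -!/(tot _ A) tot_xnet -push_a; exact: o1_ms.
- move=> v /=; have [vA|vA] := boolP (v \in A); last first.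
    by rewrite /dw big1 ?subr0 // => u _; rewrite /= (negbTE vA).
  have -> : dw (wt localised) v = \sum_(u in A) wt S v u.
    by rewrite /dw /= vA /= -big_mkcond.
  have -> : dem S v - xnet v - \sum_(u in A) wt S v u = (dem S v - dw (wt S) v) +
     (\sum_(u | u \notin A) (wt S v u - p u v)) * 2.
    rewrite xnetE /dw [in RHS](bigID (mem A)) /= !sumrB; ring.
  by apply: rpredD; [exact: (v_par vS) | exact: dvdz_mull].
Qed.

Lemma msize_localised : (msize localised < msize S)%N.
Proof.
have /demandedP [_ [z zS zA]] := dA.
rewrite /msize -addSn; apply: leq_add; last by apply: subset_leq_card; exact: subsetIl.
apply: proper_card; apply/properP; split; last first.
  exists z; first by rewrite in_setU zS.
  rewrite in_setU in_setI (negbTE zA) andbF /= in_set -leNgt /dw big1 // => u _.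
  by rewrite /= (negbTE zA).
apply/subsetP => v; rewrite !in_setU !in_set => /orP [/andP [-> _] //|].
move=> h; apply/orP; right; apply: lt_le_trans h _; apply: ler_sum => u _ /=.
by case: ifP => // _; exact: (v_w0 vS).
Qed.

Variable o2 : V -> V -> int.
Hypotheses (o2_ge0 : forall u v, 0 <= o2 u v) (o2_w : forall u v, o2 u v + o2 v u = wt localised u v).
Hypothesis o2_ms : forall v, v \in modv localised -> (N %| dem localised v - net o2 v)%Z.
Hypothesis o2_ex : forall v, v \notin modv localised -> dem localised v = net o2 v.

Definition glued u v := if u \in A then (if v \in A then o2 u v else p v u)
  else (if v \in A then wt S u v - p u v else o1 u v).

Lemma net_glued_in u : u \in A -> net glued u = net o2 u + xnet u.
Proof.
move=> uA; rewrite /net (bigID (mem A)) /= [in RHS](bigID (mem A)) /=.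
rewrite [X in _ = _ + X + _]big1 => [|v vA]; last first.
  have := o2_w u v; rewrite /= (negbTE vA) andbF.
  have := o2_ge0 u v; have := o2_ge0 v u; lia.
rewrite addr0; congr (_ + _); first by apply: eq_bigr => v vA; rewrite /glued uA vA.
apply: eq_bigr => v vA; rewrite /glued uA (negbTE vA) (v_sym vS v u); ring.
Qed.

Lemma net_glued_out u : u \notin A -> net glued u = net o1 u.
Proof.
move=> uA; rewrite /net (bigID (mem A)) /= [in RHS](bigID (mem A)) /=.
congr (_ + _); last by apply: eq_bigr => v vA; rewrite /glued (negbTE uA) (negbTE vA).
rewrite [RHS](big_setD1 a) //= [X in _ = _ + X]big1 => [|v]; last first.
  rewrite in_setD1 => /andP [va vA].
  have := o1_w u v; rewrite cwt_sym cwt_in //.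
  have := o1_ge0 u v; have := o1_ge0 v u; lia.
rewrite addr0.
have -> : o1 u a - o1 a u = cwt a u - 2 * o1 a u by rewrite -o1_w; ring.
rewrite cwt_a // -p_tot // /tot mulr_sumr -sumrB; apply: eq_bigr => v vA.
by rewrite /glued (negbTE uA) vA (v_sym vS u v); ring.
Qed.

Lemma contract_solvable : solvable S.
Proof.
have inS1 v : v \notin A -> (v \in modv contracted) = (v \in modv S).
  move=> vA; apply/idP/idP => [/imsetP [u uS]|vS']; last by rewrite -(collapse_out vA) imset_f.
  rewrite /collapse; case: ifP => [_ va|_ ->] //.
  by rewrite va aA in vA.
exists glued; split.
- move=> u v; rewrite /glued; case: ifP => uA; case: ifP => vA //.
    by have /andP [] := p_w (negbT vA) u.
  by have /andP [_] := p_w (negbT uA) v; rewrite (v_sym vS u v) subr_ge0.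
- move=> u v; rewrite /glued; case: ifP => uA; case: ifP => vA.
  + by rewrite o2_w /= uA vA.
  + by rewrite (v_sym vS v u) addrC subrK.
  + by rewrite subrK.
  + by rewrite o1_w cwt_out ?uA ?vA.
- move=> v vSm; have [vA|vA] := boolP (v \in A).
    have := o2_ms (v := v); rewrite /= in_setI vSm vA => /(_ isT).
    by rewrite net_glued_in // opprD addrCA addrC -addrA.
  by have := o1_ms (v := v); rewrite inS1 // vSm net_glued_out // /= push_out // => /(_ isT).
- move=> v vSm; have [vA|vA] := boolP (v \in A).
    have := o2_ex (v := v); rewrite /= in_setI (negbTE vSm) vA => /(_ isT).
    by rewrite net_glued_in //; lia.
  by have := o1_ex (v := v); rewrite inS1 // vSm net_glued_out // /= push_out // => /(_ isT).
Qed.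

End Contract.

Lemma contract S A : valid S -> demanded S A -> gcut S A <= K + nn (tau S A) ->
  (1 < #|A :&: active S|)%N ->
  (forall S', valid S' -> (msize S' < msize S)%N -> solvable S') -> solvable S.
Proof.
move=> vS dA tight act2 IH.
have /demandedP [[a aS aA] _] := dA.
have [o1 [o10 o1w o1m o1e]] := IH _ (valid_contracted vS aA aS) (msize_contracted vS aA act2).
have [p hp] := cross_ex vS aA o10 o1w.
have p_w v (vA : v \notin A) := (hp v vA).1.
have p_tot v (vA : v \notin A) := (hp v vA).2.
have V2 : valid (localised S A p) by eapply valid_localised; eassumption.
have [|o2 [o20 o2w o2m o2e]] := IH _ V2.
  exact: msize_localised.
exact: (contract_solvable vS dA aA aS tight o10 o1w o1m o1e p_w p_tot o20 o2w o2m o2e).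
Qed.

End States.

(** * Reductions of a state that preserve validity *)

Section Reductions.
Local Open Scope ring_scope.
Variables (V : finType) (k : nat).
Hypothesis k_gt1 : (1 < k)%N.
Local Notation N := ((2 * k)%:Z).
Local Notation K := ((2 * k)%:Z - 2).
Local Notation nn := (cdist k).
Local Notation valid := (@valid V k).
Local Notation solvable := (@solvable V k).
Implicit Types (A B : {set V}) (u v x y : V) (S : state V) (w o : V -> V -> int).

Let k_gt0 : (0 < k)%N. Proof. exact: ltnW. Qed.

Lemma arcC u v (c : int) (a b : V) : arc u v c b a = arc v u c a b.
Proof. by rewrite /arc andbC. Qed.

Lemma arc_ge0 u v (c : int) (a b : V) : 0 <= c -> 0 <= arc u v c a b.
Proof. by rewrite /arc; case: ifP. Qed.

Lemma aaddE o u v c a b : aadd o u v c a b = o a b + arc u v c a b. Proof. by []. Qed.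
Lemma eaddE' o u v c a b : eadd o u v c a b = o a b + arc u v c a b + arc v u c a b.
Proof. by []. Qed.
Lemma arcN u v c a b : arc u v (- c) a b = - arc u v c a b.
Proof. by rewrite /arc; case: ifP; rewrite ?oppr0. Qed.

(** Commits one edge uv to the direction from [u] to [v]. The ghosts are parameters because some
    reductions trade the edge for a ghost. *)
Definition del_arc u v S g i := State (eadd (wt S) u v (-1)) g i (bump (bump (dem S) u (-1)) v 1) (modv S).

Lemma solvable_del u v S g i : solvable (del_arc u v S g i) -> solvable S.
Proof.
move=> [o [o0 ow om oe]]; exists (aadd o u v 1).
have E a : dem S a - net (aadd o u v 1) a = dem (del_arc u v S g i) a - net o a.
  by rewrite net_aadd /= /bump; case: (a == u); case: (a == v); ring.
split.
- by move=> a b; rewrite aaddE addr_ge0 ?o0 ?arc_ge0.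
- move=> a b; rewrite !aaddE (arcC u v 1 a b).
  by have := ow a b; rewrite /= eaddE' !arcN; lra.
- by move=> a aS; rewrite E; exact: om.
- by move=> a aS; have := oe a aS; have := E a; lra.
Qed.

(** The arc from [y] to [y'] that came from splitting off is rerouted through [x], which changes no
    net degree. *)
Lemma split_off_orientation w o x y y' : (forall a b, 0 <= o a b) -> 0 < o y y' ->
  (forall a b, o a b + o b a = w a b - arc x y 1 a b - arc y x 1 a b - arc x y' 1 a b
     - arc y' x 1 a b + arc y y' 1 a b + arc y' y 1 a b) ->
  exists o', [/\ forall a b, 0 <= o' a b, forall a b, o' a b + o' b a = w a b
     & forall a, net o' a = net o a].
Proof.
move=> o0 oy ow; exists (aadd (aadd (aadd o y y' (-1)) y x 1) x y' 1); split.
- move=> a b; rewrite !aaddE; do 2 (apply: addr_ge0; last exact: arc_ge0).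
  rewrite /arc; have := o0 a b; case: (eqVneq a y) => [->|_] /=; last by rewrite addr0.
  by case: (eqVneq b y') => [->|_]; [lia | rewrite addr0].
- move=> a b; rewrite !aaddE (arcC y y' _ a b) (arcC y x _ a b) (arcC x y' _ a b) !arcN.
  have := ow a b; lra.
- by move=> a; rewrite !net_aadd; case: (a == y); case: (a == y'); case: (a == x); ring.
Qed.

Definition split_off x y y' S := State (eadd (eadd (eadd (wt S) x y (-1)) x y' (-1)) y y' 1)
  (gout S) (gin S) (dem S) (modv S).

Lemma solvable_split_off x y y' S : y != y' -> 0 <= wt S y y' -> x != y -> x != y' ->
  solvable (split_off x y y' S) -> solvable S.
Proof.
move=> yy' wy xy xy' [o [o0 ow om oe]].
have ow' a b : o a b + o b a = wt S a b - arc x y 1 a b - arc y x 1 a b - arc x y' 1 a b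
     - arc y' x 1 a b + arc y y' 1 a b + arc y' y 1 a b.
  by rewrite ow /= !eaddE' !arcN; ring.
have [o' [o'0 o'w o'n]] : exists o', [/\ forall a b, 0 <= o' a b, forall a b, o' a b + o' b a = wt S a b
     & forall a, net o' a = net o a].
  have [h|h] := ltP 0 (o y y'); first exact: split_off_orientation o0 h ow'.
  have h' : 0 < o y' y.
    have := ow' y y'; have := yy'; have := xy; have := xy'.
    rewrite /arc !eqxx ![y' == _]eq_sym [y == x]eq_sym => /negbTE -> /negbTE -> /negbTE -> /=; lia.
  apply: split_off_orientation o0 h' _ => a b; rewrite ow'; ring.
exists o'; split=> // [a aS|a aS]; rewrite o'n; [exact: om | exact: oe].
Qed.

Definition del_double x y S := State (eadd (wt S) x y (-2)) (gout S) (gin S) (dem S) (modv S).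

(** The two parallel edges are put back with opposite directions and cancel. *)
Lemma solvable_del_double x y S : solvable (del_double x y S) -> solvable S.
Proof.
move=> [o [o0 ow om oe]]; exists (aadd (aadd o x y 1) y x 1).
have E a : net (aadd (aadd o x y 1) y x 1) a = net o a.
  by rewrite !net_aadd; case: (a == x); case: (a == y); ring.
split.
- by move=> a b; rewrite !aaddE !addr_ge0 ?o0 ?arc_ge0.
- move=> a b; rewrite !aaddE (arcC x y _ a b) (arcC y x _ a b).
  have := ow a b; rewrite /= eaddE' !arcN.
  have E2 u v : arc u v (2 : int) a b = arc u v 1 a b + arc u v 1 a b.
    by rewrite /arc; case: ifP.
  rewrite !E2; lra.
- by move=> a aS; rewrite E; exact: om.
- by move=> a aS; rewrite E; exact: oe.
Qed.

(** Reversal of all arcs, the symmetry that turns statements about out-arcs and out-ghosts into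
    those about in-arcs and in-ghosts. *)
Definition reversed S := State (wt S) (gin S) (gout S) (fun v => - dem S v) (modv S).

Lemma tau_rev S A : tau (reversed S) A = - tau S A.
Proof. by rewrite /tau /= /tot sumrN; ring. Qed.
Lemma gcut_rev S A : gcut (reversed S) A = gcut S A.
Proof. by rewrite /gcut /=; ring. Qed.
Lemma ghosts_rev S : ghosts (reversed S) = ghosts S. Proof. by rewrite /ghosts /= addrC. Qed.
Lemma gnet_rev S : gnet (reversed S) = - gnet S. Proof. by rewrite /gnet /= opprB. Qed.

Lemma valid_rev S : valid S -> valid (reversed S).
Proof.
move=> vS; split; try by [case: vS].
- by move=> x xS /=; have := v_ex vS xS; lra.
- by move=> x xS /=; have := v_maj vS xS; lra.
- by move=> A dA; rewrite tau_rev gcut_rev cdistN //; exact: (v_cut vS).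
- by rewrite ghosts_rev gnet_rev cdistN //; exact: (v_gh vS).
- by rewrite /= /tot sumrN rpredN; exact: (v_sum vS).
- move=> v /=; have -> : - dem S v - dw (wt S) v = (dem S v - dw (wt S) v) - (dem S v) * 2 by ring.
  by apply: rpredB; [exact: (v_par vS) | exact: dvdz_mull].
Qed.

Lemma solvable_rev S : solvable (reversed S) -> solvable S.
Proof.
move=> [o [o0 ow om oe]]; exists (fun a b => o b a).
have E a : net (fun a b => o b a) a = - net o a.
  by rewrite /net -sumrN; apply: eq_bigr => b _; ring.
split=> //.
- by move=> a b; rewrite addrC; exact: ow.
- move=> a aS; rewrite E opprK -rpredN; have := om a aS.
  by rewrite /= -opprD.
- by move=> a aS; rewrite E -oe // opprK.
Qed.

(** When no tight set is left to contract, parity supplies the extra 2. It pays for every local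
    reduction: the loss in the cut and the growth of the distance amount to at most two. *)
Definition slack S := forall A, demanded S A -> (1 < #|A :&: active S|)%N ->
  K + 2 + nn (tau S A) <= gcut S A.

Lemma slack_rev S : slack S -> slack (reversed S).
Proof. by move=> h A dA cA; rewrite tau_rev gcut_rev cdistN //; exact: h. Qed.

Lemma tot_sub (f : V -> int) A B : B \subset A -> (forall v, v \in A -> v \notin B -> f v = 0) ->
  tot f A = tot f B.
Proof.
move=> sub h; rewrite (tot_split _ sub) [X in _ + X]tot0 ?addr0 // => u.
by rewrite in_setD => /andP [uB uA]; exact: h.
Qed.

Lemma inactive S v : valid S -> v \notin active S ->
  [/\ forall u, wt S v u = 0, gout S v = 0, gin S v = 0 & dem S v = 0].
Proof.
move=> vS; rewrite in_setU in_set negb_or -leNgt => /andP [vm d0].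
have d0' : dw (wt S) v = 0 by apply: le_anti; rewrite d0 (dw_ge0 _ vS).
have := v_maj vS vm; have := v_go0 vS v; have := v_gi0 vS v; have := v_ex vS vm.
rewrite d0' => *; split; try lia.
move=> u; apply: le_anti; rewrite (v_w0 vS) andbT -d0' /dw (bigD1 u) //= lerDl.
by apply: sumr_ge0 => *; exact: (v_w0 vS).
Qed.

(** The demanded sets to which [slack] does not apply behave like singletons, so a reduction only
    has to be checked at single vertices of [modv]. *)
Lemma single_active S A : valid S -> demanded S A -> ~~ (1 < #|A :&: active S|)%N ->
  exists2 y, y \in modv S & [/\ gcut S A = gcut S [set y], tau S A = tau S [set y] &
     forall u, u \in active S -> (u \in A) = (u == y)].
Proof.
move=> vS /demandedP [[y yS yA] _]; rewrite -leqNgt => c1; exists y => //.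
have ya : y \in active S by rewrite in_setU yS.
have mem u : u \in active S -> (u \in A) = (u == y).
  move=> ua; apply/idP/eqP => [uA|->//].
  by have /card_le1_eqP h := c1; apply: h; rewrite in_setI ?uA ?yA.
have D u : u \in A -> u \notin [set y] -> u \notin active S.
  by rewrite in_set1 => uA uy; apply: contra uy => /mem <-.
have sub : [set y] \subset A by rewrite sub1set.
split=> //.
  rewrite /gcut !(tot_sub sub) => [||v vA vy]; last first.
    by have [] := inactive vS (D v vA vy).
  - move=> v vA vy; by have [] := inactive vS (D v vA vy).
  congr (_ + _ + _); rewrite -[cutw _ A]/(tot (fun u => \sum_(v | v \notin A) wt S u v) A) (tot_sub sub) /cutw.
    rewrite /tot !big_set1 [RHS](bigID (fun v => v \in A)) /= [X in _ = X + _]big1 ?add0r.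
      by apply: eq_bigl => v; rewrite in_set1; case: eqP => [->|]; rewrite ?yA.
    move=> v /andP [vy vA]; have [h _ _ _] := inactive vS (D v vA vy).
    by rewrite (v_sym vS).
  move=> u uA uy; have [h _ _ _] := inactive vS (D u uA uy).
  by rewrite big1.
by rewrite /tau !(tot_sub sub) // => v vA vy; have [] := inactive vS (D v vA vy).
Qed.

Lemma cdist_step_le t : nn (t - 1) <= nn t + 1 /\ nn (t + 1) <= nn t + 1.
Proof. by split; [have := cdistD_le k_gt0 t (-1) | have := cdistD_le k_gt0 t 1]. Qed.

Lemma w_act S u v : valid S -> 0 < wt S u v -> u \in active S.
Proof.
move=> vS h; apply/negPn/negP => /(inactive vS) [h' _ _ _].
by rewrite h' ltxx in h.
Qed.

Lemma w_neq S u v : valid S -> 0 < wt S u v -> u != v.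
Proof. by move=> vS; apply: contraTneq => ->; rewrite (v_irr vS) ltxx. Qed.

Lemma w_actr S u v : valid S -> 0 < wt S u v -> v \in active S.
Proof. by move=> vS; rewrite (v_sym vS); exact: w_act. Qed.

Lemma tau_del u v S A : tau (del_arc u v S (gout S) (gin S)) A =
  tau S A + (if u \in A then -1 else 0) + (if v \in A then 1 else 0).
Proof. by rewrite /tau /= !tot_bump; ring. Qed.

Lemma gcut_del u v S A : gcut (del_arc u v S (gout S) (gin S)) A =
  gcut S A + (if (u \in A) (+) (v \in A) then -1 else 0).
Proof. by rewrite /gcut /= cutw_eadd; ring. Qed.

Lemma parity_del S u v a : valid S -> (2 %| bump (bump (dem S) u (-1)) v 1 a - dw (eadd (wt S) u v (-1)) a)%Z.
Proof.
move=> vS; rewrite dw_eadd /bump; have := v_par vS a.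
case: (a == u); case: (a == v) => h.
- have -> : dem S a + -1 + 1 - (dw (wt S) a + -1 + -1) = (dem S a - dw (wt S) a) + 2 by ring.
  exact: rpredD.
- by have -> : dem S a + -1 + 0 - (dw (wt S) a + -1 + 0) = (dem S a - dw (wt S) a) by ring.
- have -> : dem S a + 0 + 1 - (dw (wt S) a + 0 + -1) = (dem S a - dw (wt S) a) + 2 by ring.
  exact: rpredD.
- by rewrite !addr0.
Qed.

Section BetweenMod.
Variables (S : state V) (u v : V).
Hypotheses (vS : valid S) (sS : slack S) (uS : u \in modv S) (vSm : v \in modv S).

Let ua : u \in active S. Proof. by rewrite in_setU uS. Qed.
Let va : v \in active S. Proof. by rewrite in_setU vSm. Qed.

Lemma ex_neq x y : x \notin modv S -> y \in modv S -> (x == y) = false.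
Proof. by move=> xS; apply: contraTF => /eqP <-. Qed.

Lemma valid_del : 0 < wt S u v ->
  K + nn (tau S [set u] - 1) <= gcut S [set u] - 1 ->
  K + nn (tau S [set v] + 1) <= gcut S [set v] - 1 ->
  valid (del_arc u v S (gout S) (gin S)).
Proof.
move=> wuv hu hv; have uv := w_neq vS wuv.
split; try by [case: vS].
- exact/eadd_sym/(v_sym vS).
- exact/(eadd_irr _ uv)/(v_irr vS).
- by apply: eadd_ge0 => //; [exact: (v_sym vS) | exact: (v_w0 vS) | lia].
- by move=> x xS /=; rewrite /bump !ex_neq // !addr0 (v_ex vS).
- by move=> x xS /=; rewrite dw_eadd !ex_neq // !addr0 (v_maj vS).
- by move=> x y xS yS; rewrite /= eadd_out ?ex_neq //; exact: (v_ind vS).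
- move=> A dA; rewrite tau_del gcut_del.
  have [h|h] := boolP (1 < #|A :&: active S|)%N.
    have := sS dA h; have [] := cdist_step_le (tau S A).
    by case: (u \in A); case: (v \in A); rewrite /= ?addr0 ?addrK; lra.
  have cy := v_cut vS dA.
  have [y yS [Ed Et mem]] := single_active vS dA h.
  rewrite Ed Et !mem // in cy *.
  case: (eqVneq u y) => [Eu|_]; case: (eqVneq v y) => [Ev|_] //=; rewrite ?addr0.
  + by rewrite Eu Ev eqxx in uv.
  + by rewrite -Eu.
  + by rewrite -Ev.
  + exact: cy.
- by rewrite /= !tot_bump !in_setT -addrA addNr addr0; exact: (v_sum vS).
- by move=> a; exact: parity_del.
Qed.

(* The arc uv is kept as a ghost into v, which leaves tau at v unchanged. *)
Definition ghost_arc := del_arc u v S (gout S) (bump (gin S) v 1).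

Lemma valid_ghost_arc : 0 < wt S u v ->
  K + nn (tau S [set u] - 1) <= gcut S [set u] - 1 ->
  ghosts S + 1 <= K + nn (gnet S - 1) ->
  valid ghost_arc.
Proof.
move=> wuv hu hg; have uv := w_neq vS wuv.
split; try by [case: vS].
- exact/eadd_sym/(v_sym vS).
- exact/(eadd_irr _ uv)/(v_irr vS).
- by apply: eadd_ge0 => //; [exact: (v_sym vS) | exact: (v_w0 vS) | lia].
- move=> a; rewrite /= /bump; have := v_gi0 vS a; case: (a == v); lra.
- by move=> x xS /=; rewrite /bump !ex_neq // !addr0 (v_ex vS).
- by move=> x xS /=; rewrite dw_eadd /bump !ex_neq // !addr0 (v_maj vS).
- by move=> x y xS yS; rewrite /= eadd_out ?ex_neq //; exact: (v_ind vS).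
- move=> A dA.
  have -> : tau ghost_arc A = tau S A + (if u \in A then -1 else 0).
    by rewrite /tau /= !tot_bump; ring.
  have -> : gcut ghost_arc A = gcut S A + (if (u \in A) (+) (v \in A) then -1 else 0) +
      (if v \in A then 1 else 0).
    by rewrite /gcut /= cutw_eadd tot_bump; ring.
  have cy := v_cut vS dA.
  have [h|h] := boolP (1 < #|A :&: active S|)%N.
    have := sS dA h; have [] := cdist_step_le (tau S A).
    by case: (u \in A); case: (v \in A); rewrite /= ?addr0 ?addrK; lra.
  have [y yS [Ed Et mem]] := single_active vS dA h.
  rewrite Ed Et !mem // in cy *.
  case: (eqVneq u y) => [Eu|_]; case: (eqVneq v y) => [Ev|_] //=; rewrite ?addr0 ?subrK //.
  + by rewrite Eu Ev eqxx in uv.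
  + by rewrite -Eu.
- have -> : ghosts ghost_arc = ghosts S + 1 by rewrite /ghosts /= tot_bump in_setT; ring.
  by have -> : gnet ghost_arc = gnet S - 1 by rewrite /gnet /= tot_bump in_setT; ring.
- by rewrite /= !tot_bump !in_setT -addrA addNr addr0; exact: (v_sum vS).
- by move=> a; exact: parity_del.
Qed.

Definition add_ghosts j := State (wt S) (bump (gout S) u j) (gin S) (dem S) (modv S).

Lemma tau_add_ghosts j A : tau (add_ghosts j) A = tau S A + (if u \in A then j else 0).
Proof. by rewrite /tau /= tot_bump; ring. Qed.
Lemma gcut_add_ghosts j A : gcut (add_ghosts j) A = gcut S A + (if u \in A then j else 0).
Proof. by rewrite /gcut /= tot_bump; ring. Qed.
Lemma ghosts_add_ghosts j : ghosts (add_ghosts j) = ghosts S + j.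
Proof. by rewrite /ghosts /= tot_bump in_setT; ring. Qed.
Lemma gnet_add_ghosts j : gnet (add_ghosts j) = gnet S + j.
Proof. by rewrite /gnet /= tot_bump in_setT; ring. Qed.

(** [solvable] speaks of edges and demands only. Ghosts steer the cut conditions of the induction
    and can be changed whenever the state stays valid. *)
Lemma solvable_add_ghosts j : solvable (add_ghosts j) -> solvable S.
Proof. by []. Qed.

Lemma valid_add_ghosts j : 0 <= gout S u + j ->
  (forall A, demanded S A -> u \in A -> K + nn (tau S A + j) <= gcut S A + j) ->
  ghosts S + j <= K + nn (gnet S + j) -> valid (add_ghosts j).
Proof.
move=> j0 hc hg; split; try by [case: vS].
- move=> a; rewrite /= /bump; have := v_go0 vS a; case: (eqVneq a u) => [->|] //; lra.
- by move=> x xS /=; rewrite /bump !ex_neq // !addr0 (v_ex vS).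
- by move=> x xS /=; rewrite /bump !ex_neq // !addr0 (v_maj vS).
- move=> A dA; rewrite tau_add_ghosts gcut_add_ghosts; case: ifP => uA; first exact: hc.
  by rewrite !addr0; exact: (v_cut vS).
- by rewrite ghosts_add_ghosts gnet_add_ghosts.
Qed.

Lemma valid_add_ghosts_pos j : 0 <= j -> ghosts S + j <= K + nn (gnet S + j) -> valid (add_ghosts j).
Proof.
move=> j0; apply: valid_add_ghosts; first by have := v_go0 vS u; lra.
move=> A dA _; have := v_cut vS dA; have := cdistD_le k_gt0 (tau S A) j.
by rewrite ger0_norm //; lra.
Qed.

Lemma slack_add_ghosts j : 0 <= j -> slack (add_ghosts j).
Proof.
move=> j0 A dA hA; rewrite tau_add_ghosts gcut_add_ghosts; have := sS dA hA.
case: ifP => _; rewrite ?addr0 //; have := cdistD_le k_gt0 (tau S A) j.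
by rewrite ger0_norm //; lra.
Qed.

Lemma valid_remove_ghost : 0 < gout S u -> K + nn (tau S [set u] - 1) <= gcut S [set u] - 1 ->
  ghosts S - 1 <= K + nn (gnet S - 1) -> valid (add_ghosts (-1)).
Proof.
move=> g0 hu hg; apply: valid_add_ghosts => //; first by lia.
move=> A dA uA; have [h|h] := boolP (1 < #|A :&: active S|)%N.
  by have := sS dA h; have [] := cdist_step_le (tau S A); lra.
have [y yS [Ed Et mem]] := single_active vS dA h; rewrite Ed Et.
by move: uA; rewrite mem // => /eqP <-.
Qed.

(** The demand at [u] is replaced by the value that balances its ghosts. When the shift is a
    multiple of 2k, a solution with the exact value also solves the congruence. *)
Definition make_exact := State (wt S) (gout S) (gin S)
  (bump (dem S) u (- (dem S u + gout S u - gin S u))) (modv S :\ u).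

Lemma make_exact_mem x : x \notin modv make_exact -> x = u \/ x \notin modv S /\ x != u.
Proof.
rewrite /= in_setD1 negb_and negbK => /orP [/eqP ->|xS]; [by left | right; split=> //].
by rewrite ex_neq.
Qed.

Lemma valid_make_exact : (N %| dem S u + gout S u - gin S u)%Z -> gout S u + gin S u <= dw (wt S) u ->
  (forall x, x \notin modv S -> wt S x u = 0) -> valid make_exact.
Proof.
move=> hN hd h0; split; try by [case: vS].
- move=> x /make_exact_mem /= [->|[xS xu]]; first by rewrite /bump eqxx; lra.
  by rewrite /bump (negbTE xu) addr0 (v_ex vS).
- by move=> x /make_exact_mem /= [->|[xS xu]] //; exact: (v_maj vS).
- move=> x y /make_exact_mem /= [->|[xS xu]] /make_exact_mem /= [->|[yS yu]].
  + exact: (v_irr vS).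
  + by rewrite (v_sym vS) h0.
  + by rewrite h0.
  + exact: (v_ind vS).
- move=> A /demandedP [[y yS yA] [z zS zA]].
  have dA : demanded S A.
    move: yS zS; rewrite /= !in_setD1 => /andP [_ yS] /andP [_ zS].
    by apply/demandedP; split; [exists y | exists z].
  have Et : tau make_exact A = tau S A + (if u \in A then - (dem S u + gout S u - gin S u) else 0).
    by rewrite /tau /= tot_bump; ring.
  rewrite Et (cdist_cong k_gt0 (z' := tau S A)) ?(v_cut vS) //.
  by rewrite addrC addKr; case: ifP => _; rewrite ?dvdz0 // dvdzE abszN.
- by rewrite /= tot_bump in_setT; apply: rpredD; [exact: (v_sum vS) | rewrite rpredN].
- move=> a /=; rewrite /bump; have h := v_par vS a; case: ifP => _; rewrite ?addr0 //.
  rewrite -addrA [- _ - _]addrC addrA; apply: rpredB => //.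
  by apply: dvdz_trans hN; rewrite PoszM dvdz_mulr.
Qed.

Lemma solvable_make_exact : (N %| dem S u + gout S u - gin S u)%Z -> solvable make_exact -> solvable S.
Proof.
move=> hN [o [o0 ow om oe]]; exists o; split=> //.
- move=> a aS; have [au|au] := eqVneq a u.
    have := oe a; rewrite /= in_setD1 au eqxx => /(_ isT) <-; rewrite /bump eqxx.
    by rewrite opprD opprK addrA subrr add0r.
  have := om a; rewrite /= in_setD1 au aS /bump (negbTE au) addr0; exact.
- move=> a aS; have := oe a; rewrite /= in_setD1 (negbTE aS) andbF /bump ex_neq // addr0; exact.
Qed.

End BetweenMod.

Section LiftExact.
Variables (S : state V) (x y : V).
Hypotheses (vS : valid S) (sS : slack S) (xS : x \notin modv S) (wxy : 0 < wt S x y).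

Lemma nbr_ms : y \in modv S.
Proof. by apply: contraTT wxy => yS; rewrite (v_ind vS) // ltxx. Qed.

Let xa : x \in active S. Proof. exact: w_act wxy. Qed.
Let ya : y \in active S. Proof. exact: w_actr wxy. Qed.
Let xy : x != y. Proof. exact: w_neq wxy. Qed.

(** Splits off an edge together with a ghost: the arc from [y] to [x], followed by the ghost out of
    [x], becomes a ghost out of [y]. *)
Definition split_off_ghost := del_arc y x S (bump (bump (gout S) x (-1)) y 1) (gin S).

Lemma valid_split_off_ghost : 0 < gout S x -> valid split_off_ghost.
Proof.
move=> gx; have yS := nbr_ms; have yx : y != x by rewrite eq_sym.
split; try by [case: vS].
- exact/eadd_sym/(v_sym vS).
- exact/(eadd_irr _ yx)/(v_irr vS).
- apply: eadd_ge0 => //; [exact: (v_sym vS) | exact: (v_w0 vS) |].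
  by rewrite (v_sym vS); lia.
- move=> a; rewrite /= /bump; have := v_go0 vS a.
  by case: (eqVneq a x) => [->|_]; case: (eqVneq _ y) => [_|_]; lia.
- move=> a aS /=; rewrite /bump (ex_neq aS yS); have := v_ex vS aS.
  by case: (a == x); lra.
- move=> a aS /=; rewrite dw_eadd /bump (ex_neq aS yS); have := v_maj vS aS.
  by case: (a == x); lra.
- move=> a b aS bS; rewrite /= eadd_out; first exact: (v_ind vS).
    by rewrite (ex_neq aS yS).
  by rewrite (ex_neq bS yS) andbF.
- move=> A dA.
  have -> : tau split_off_ghost A = tau S A.
    by rewrite /tau /= !tot_bump; case: (x \in A); case: (y \in A); ring.
  have -> : gcut split_off_ghost A = gcut S A + (if (y \in A) (+) (x \in A) then -1 else 0)
      + (if x \in A then -1 else 0) + (if y \in A then 1 else 0).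
    by rewrite /gcut /= cutw_eadd !tot_bump; ring.
  have cy := v_cut vS dA.
  have [h|h] := boolP (1 < #|A :&: active S|)%N.
    have := sS dA h.
    by case: (x \in A); case: (y \in A); rewrite /= ?addr0; lra.
  have [z zS [Ed Et mem]] := single_active vS dA h.
  rewrite Ed Et !mem // (ex_neq xS zS) in cy *.
  by case: (y == z); rewrite /= ?addr0 ?subrK.
- have -> : ghosts split_off_ghost = ghosts S by rewrite /ghosts /= !tot_bump !in_setT; ring.
  have -> : gnet split_off_ghost = gnet S by rewrite /gnet /= !tot_bump !in_setT; ring.
  exact: (v_gh vS).
- by rewrite /= !tot_bump !in_setT -addrA addNr addr0; exact: (v_sum vS).
- by move=> a; exact: parity_del.
Qed.

Hypotheses (gox : gout S x = 0) (gix : gin S x = 0).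

Lemma valid_split_off y' : y != y' -> 0 < wt S x y' -> valid (split_off x y y' S).
Proof.
move=> yy' wxy'; have yS := nbr_ms.
have y'S : y' \in modv S by apply: contraTT wxy' => y'S; rewrite (v_ind vS) // ltxx.
have y'a : y' \in active S by exact: w_actr wxy'.
have xy' : x != y' := w_neq vS wxy'.
have s0 := v_sym vS.
have s1 : symw (eadd (wt S) x y (-1)) by exact: eadd_sym.
have s2 : symw (eadd (eadd (wt S) x y (-1)) x y' (-1)) by exact: eadd_sym.
have p1 a b : 0 <= eadd (wt S) x y (-1) a b.
  by apply: eadd_ge0; [exact: xy | | exact: (v_w0 vS) | lia].
have p2 a b : 0 <= eadd (eadd (wt S) x y (-1)) x y' (-1) a b.
  apply: eadd_ge0; [exact: xy' | done | done |].
  rewrite eadd_out; [lia | by rewrite negb_and [y' == y]eq_sym yy' orbT | by rewrite negb_and xy].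
split; try by [case: vS].
- exact: eadd_sym.
- by do 3 apply: eadd_irr => //; exact: (v_irr vS).
- by apply: eadd_ge0 => //; rewrite addr_ge0.
- move=> a aS /=; rewrite !dw_eadd !(ex_neq aS yS) !(ex_neq aS y'S); have := v_maj vS aS.
  case: (eqVneq a x) => [->|_]; last by rewrite !addr0.
  rewrite gox gix !addr0 => _.
  rewrite /dw (bigD1 y) //= (bigD1 y') //= 1?eq_sym //.
  have : 0 <= \sum_(i | (i != y) && (i != y')) wt S x i by apply: sumr_ge0 => *; exact: (v_w0 vS).
  move: (\sum_(i | _) _) => t; lia.
- move=> a b aS bS; rewrite /= !eadd_out ?(ex_neq aS yS) ?(ex_neq aS y'S) ?(ex_neq bS yS) ?(ex_neq bS y'S) ?andbF //; exact: (v_ind vS).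
- move=> A dA.
  have -> : gcut (split_off x y y' S) A = gcut S A + (if (x \in A) (+) (y \in A) then -1 else 0)
      + (if (x \in A) (+) (y' \in A) then -1 else 0) + (if (y \in A) (+) (y' \in A) then 1 else 0).
    by rewrite /gcut /= !cutw_eadd; ring.
  have -> : tau (split_off x y y' S) A = tau S A by [].
  have cy := v_cut vS dA.
  have [h|h] := boolP (1 < #|A :&: active S|)%N.
    have := sS dA h.
    by case: (x \in A); case: (y \in A); case: (y' \in A); rewrite /= ?addr0; lra.
  have [z zS [Ed Et mem]] := single_active vS dA h.
  rewrite Ed Et !mem // (ex_neq xS zS) in cy *.
  case: (eqVneq y z) => [yz|_]; case: (eqVneq y' z) => [y'z|_]; rewrite /= ?addr0 ?subrK //.
  by rewrite yz y'z eqxx in yy'.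
- move=> a; rewrite /= !dw_eadd.
  have -> : dem S a - (dw (wt S) a + (if a == x then -1 else 0) + (if a == y then -1 else 0) +
     (if a == x then -1 else 0) + (if a == y' then -1 else 0) + (if a == y then 1 else 0) +
     (if a == y' then 1 else 0)) = dem S a - dw (wt S) a + (if a == x then 1 else 0) * 2.
    by case: (a == x); case: (a == y); case: (a == y'); ring.
  by apply: rpredD; [exact: (v_par vS) | exact: dvdz_mull].
Qed.

Lemma valid_del_double : (forall y', y' != y -> wt S x y' = 0) -> valid (del_double x y S).
Proof.
move=> only; have yS := nbr_ms.
have dwx : dw (wt S) x = wt S x y.
  by rewrite /dw (bigD1 y) //= big1 ?addr0 // => i; exact: only.
have ev : (2 %| wt S x y)%Z.
  have := v_par vS x; have := v_ex vS xS; rewrite gox gix dwx addr0 subr0 => ->.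
  by rewrite sub0r rpredN.
have w2 : 0 <= wt S x y - 2 by move: ev wxy => /dvdzP [q ->]; lia.
split; try by [case: vS].
- exact/eadd_sym/(v_sym vS).
- exact/(eadd_irr _ xy)/(v_irr vS).
- by apply: eadd_ge0; [exact: xy | exact: (v_sym vS) | exact: (v_w0 vS) | exact: w2].
- move=> a aS /=; rewrite dw_eadd (ex_neq aS yS) addr0; have := v_maj vS aS.
  by case: (eqVneq a x) => [->|_]; rewrite ?addr0 // gox gix dwx addr0.
- move=> a b aS bS; rewrite /= eadd_out ?(ex_neq aS yS) ?(ex_neq bS yS) ?andbF //; exact: (v_ind vS).
- move=> A dA.
  have -> : gcut (del_double x y S) A = gcut S A + (if (x \in A) (+) (y \in A) then -2 else 0).
    by rewrite /gcut /= !cutw_eadd; ring.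
  have -> : tau (del_double x y S) A = tau S A by [].
  have cy := v_cut vS dA; have [xA|xA] := boolP (x \in A); case yA: (y \in A); rewrite /= ?addr0 //.
    have [h|h] := boolP (1 < #|A :&: active S|)%N; first by have := sS dA h; lra.
    have [z zS [Ed Et mem]] := single_active vS dA h.
    by move: xA; rewrite mem // (ex_neq xS zS).
  (* [A] may have a single active vertex, but with [x] added it has two, so [slack] applies there.
     As [y] is the only neighbour of [x] and lies in [A], adding [x] shrinks the cut by the number
     of edges between them. *)
  have dB : demanded S (x |: A).
    have /demandedP [[s sS' sA] [z zS zA]] := dA.
    apply/demandedP; split; [exists s | exists z] => //; rewrite in_setU1 ?sA ?orbT //.
    by rewrite (negbTE zA) orbF eq_sym (ex_neq xS zS).
  have hB : (1 < #|(x |: A) :&: active S|)%N.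
    apply: leq_trans (_ : #|[set x; y]| <= _)%N; first by rewrite cards2 xy.
    apply: subset_leq_card; apply/subsetP => s; rewrite !inE => /orP [] /eqP ->.
      by rewrite eqxx; move: xa; rewrite /active !inE.
    by rewrite yA orbT; move: ya; rewrite /active !inE.
  have := sS dB hB.
  have Etot f : tot f (x |: A) = f x + tot f A by rewrite /tot big_setU1.
  have -> : tau S (x |: A) = tau S A by rewrite /tau !Etot; have := v_ex vS xS; lra.
  rewrite /gcut !Etot gox gix (cutw_setU1 (v_sym vS) (v_irr vS) xA) dwx.
  have : wt S x y <= \sum_(v in A) wt S x v.
    by rewrite (bigD1 y) //= lerDl; apply: sumr_ge0 => *; exact: (v_w0 vS).
  lia.
- move=> a; rewrite /= !dw_eadd.
  have -> : dem S a - (dw (wt S) a + (if a == x then -2 else 0) + (if a == y then -2 else 0))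
     = dem S a - dw (wt S) a + ((if a == x then 1 else 0) + (if a == y then 1 else 0)) * 2.
    by case: (a == x); case: (a == y); ring.
  by apply: rpredD; [exact: (v_par vS) | exact: dvdz_mull].
Qed.

End LiftExact.
End Reductions.

(** * Every valid state is solvable *)

Section Solvability.
Local Open Scope ring_scope.
Variables (V : finType) (k : nat).
Hypothesis k_gt1 : (1 < k)%N.
Local Notation N := ((2 * k)%:Z).
Local Notation K := ((2 * k)%:Z - 2).
Local Notation nn := (cdist k).
Local Notation valid := (@valid V k).
Local Notation solvable := (@solvable V k).
Local Notation slack := (@slack V k).
Implicit Types (A B : {set V}) (u v x y : V) (S : state V) (w o : V -> V -> int).

Let k_gt0 : (0 < k)%N. Proof. exact: ltnW. Qed.

(** Lexicographic in vertices, edges and ghosts. Since [msize] counts [modv] a second time, making a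
    vertex exact is progress too. *)
Definition smaller S' S := (msize S' < msize S)%N \/ ((msize S' <= msize S)%N /\
  (size_w (wt S') < size_w (wt S) \/ (size_w (wt S') <= size_w (wt S) /\ ghosts S' < ghosts S))).

Lemma msize_mono S S' : modv S' = modv S -> (forall v, dw (wt S') v <= dw (wt S) v) ->
  (msize S' <= msize S)%N.
Proof.
move=> Em h; rewrite /msize Em leq_add2r; apply: subset_leq_card; apply/subsetP => v.
rewrite !in_setU Em !in_set => /orP [->//|h']; rewrite (lt_le_trans h' (h v)) orbT //.
Qed.

Lemma dw_eadd_le w u v c a : c <= 0 -> dw (eadd w u v c) a <= dw w a.
Proof. by rewrite dw_eadd; case: (a == u); case: (a == v); lra. Qed.

Lemma smaller_del u v S g i : smaller (del_arc u v S g i) S.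
Proof.
right; split; first by apply: msize_mono => // a; exact: dw_eadd_le.
by left; rewrite /= size_eadd; lra.
Qed.

Lemma smaller_split_off x y y' S : x != y -> x != y' -> y != y' -> smaller (split_off x y y' S) S.
Proof.
move=> xy xy' yy'; right; split; last by left; rewrite /= !size_eadd; lra.
apply: msize_mono => // a; rewrite /= !dw_eadd.
case: (eqVneq a x) => [->|_]; first by rewrite (negbTE xy) (negbTE xy'); lra.
by case: (eqVneq a y) => [->|_]; [rewrite (negbTE yy') | case: (a == y')]; lra.
Qed.

Lemma smaller_del_double x y S : smaller (del_double x y S) S.
Proof.
right; split; first by apply: msize_mono => // a; exact: dw_eadd_le.
by left; rewrite /= size_eadd; lra.
Qed.

Lemma msize_rev S : msize (reversed S) = msize S. Proof. by []. Qed.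

Lemma smaller_rev S S' : smaller S' (reversed S) -> smaller S' S.
Proof. by rewrite /smaller msize_rev ghosts_rev. Qed.

Definition solvable_below S := forall S', valid S' -> smaller S' S -> solvable S'.

Lemma solvable_below_rev S : solvable_below S -> solvable_below (reversed S).
Proof. by move=> ih S' vS' /smaller_rev; exact: ih. Qed.

Lemma act_w S x : valid S -> 0 < dw (wt S) x -> exists y, 0 < wt S x y.
Proof.
move=> vS h; have [/existsP //|] := boolP [exists y, 0 < wt S x y].
rewrite negb_exists => /forallP h'; move: h.
by rewrite /dw big1 ?ltxx // => u _; apply: le_anti; rewrite leNgt h' (v_w0 vS).
Qed.

(** An edge at the exact vertex is paired with a ghost if there is one, otherwise with an edge to
    another neighbour, and otherwise with a parallel edge. *)
Lemma solve_exact S x : valid S -> slack S -> solvable_below S -> x \notin modv S -> 0 < dw (wt S) x -> solvable S.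
Proof.
move=> vS sS ih xS dx; have [y wxy] := act_w vS dx.
have [gx|gx] := ltP 0 (gout S x).
  have := ih _ (valid_split_off_ghost k_gt1 vS sS xS wxy gx) (smaller_del _ _ _ _ _).
  exact: solvable_del.
have [ix|ix] := ltP 0 (gin S x).
  apply: solvable_rev.
  have := solvable_below_rev ih (valid_split_off_ghost k_gt1 (valid_rev k_gt1 vS) (slack_rev k_gt1 sS) xS wxy ix) (smaller_del _ _ _ _ _).
  exact: solvable_del.
have gx0 : gout S x = 0 by apply: le_anti; rewrite gx (v_go0 vS).
have ix0 : gin S x = 0 by apply: le_anti; rewrite ix (v_gi0 vS).
have xy := w_neq vS wxy.
have [/existsP [y' /andP [y'y wxy']]|h] := boolP [exists y', (y' != y) && (0 < wt S x y')].
  have yy' : y != y' by rewrite eq_sym.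
  have xy' := w_neq vS wxy'.
  have := ih _ (valid_split_off k_gt1 vS sS xS wxy gx0 ix0 yy' wxy') (smaller_split_off _ xy xy' yy').
  by apply: solvable_split_off => //; exact: (v_w0 vS).
have only y' : y' != y -> wt S x y' = 0.
  move=> y'y; apply: le_anti; rewrite (v_w0 vS) andbT leNgt.
  by apply: contra h => w'; apply/existsP; exists y'; rewrite y'y.
have := ih _ (valid_del_double k_gt1 vS sS xS wxy gx0 ix0 only) (smaller_del_double _ _ _).
exact: solvable_del_double.
Qed.

Lemma not_mod_inactive S x : valid S -> (forall x, x \notin modv S -> dw (wt S) x <= 0) -> x \notin modv S ->
  [/\ forall u, wt S x u = 0, gout S x = 0, gin S x = 0 & dem S x = 0].
Proof.
move=> vS nx xS; apply: (inactive k_gt1 vS).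
by rewrite in_setU (negbTE xS) in_set -leNgt nx.
Qed.

Lemma tot_ms S (f : V -> int) : (forall x, x \notin modv S -> f x = 0) -> tot f setT = tot f (modv S).
Proof. by move=> h; apply: tot_sub; [exact: subsetT | move=> v _; exact: h]. Qed.

Lemma solve_edgeless S : valid S -> (forall x, x \notin modv S -> dw (wt S) x <= 0) ->
  (forall u v, wt S u v = 0) -> (#|modv S| <= 1)%N -> solvable S.
Proof.
move=> vS nx w0 c1; exists (fun _ _ => 0).
have n0 v : net (fun _ _ : V => 0 : int) v = 0 by rewrite /net big1.
split=> // [v vm|v vm]; rewrite n0; last by have [_ _ _ ->] := not_mod_inactive vS nx vm.
have Em : modv S = [set v].
  by apply/eqP; rewrite eq_sym eqEcard sub1set vm cards1.
have := v_sum vS; rewrite (tot_ms (S := S)); last first.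
  by move=> x xS; have [_ _ _ ->] := not_mod_inactive vS nx xS.
by rewrite Em tot1 subr0.
Qed.

Lemma solve_two S x y : valid S -> (forall x, x \notin modv S -> dw (wt S) x <= 0) ->
  x != y -> modv S = [set x; y] -> solvable S.
Proof.
move=> vS nx xy Em.
have xS : x \in modv S by rewrite Em !inE eqxx.
have yS : y \in modv S by rewrite Em !inE eqxx orbT.
have D := not_mod_inactive vS nx.
have w0 u v : u \notin modv S -> wt S u v = 0 by move=> uS; have [-> _ _ _] := D u uS.
have w0' u v : v \notin modv S -> wt S u v = 0 by rewrite (v_sym vS); exact: w0.
have dwx : dw (wt S) x = wt S x y.
  rewrite /dw (bigD1 x) //= (bigD1 y) 1?eq_sym //= (v_irr vS) add0r big1 ?addr0 // => i /andP [ix iy].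
  by apply: w0'; rewrite Em !inE negb_or ix.
have dwy : dw (wt S) y = wt S x y.
  rewrite /dw (bigD1 y) //= (bigD1 x) //= (v_irr vS) add0r big1 ?addr0 ?(v_sym vS y) // => i /andP [ix iy].
  by apply: w0'; rewrite Em !inE negb_or ix iy.
have T (f : V -> int) : (forall x, x \notin modv S -> f x = 0) -> tot f setT = f x + f y.
  by move=> h; rewrite (tot_ms h) Em /tot big_setU1 ?inE //= big_set1.
have Tg : tot (gout S) setT = gout S x + gout S y by apply: T => z /D [].
have Ti : tot (gin S) setT = gin S x + gin S y by apply: T => z /D [].
have Td : tot (dem S) setT = dem S x + dem S y by apply: T => z /D [].
have dx : demanded S [set x].
  by apply/demandedP; split; [exists x | exists y]; rewrite ?inE // eq_sym.
have dy : demanded S [set y].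
  by apply/demandedP; split; [exists y | exists x]; rewrite ?inE.
(* Adding the cut conditions of the two singletons and comparing with the bound on the ghosts gives
   2k - 2 <= 2w, where w is the number of edges between [x] and [y]. With k - 1 edges every residue
   modulo k occurs as a number of arcs from [x] to [y]. *)
have wge : k%:Z - 1 <= wt S x y.
  have cx := v_cut vS dx; have cy := v_cut vS dy; have g := v_gh vS; have sm := v_sum vS.
  have tri := cdistD k_gt0 (tau S [set x]) (tau S [set y]).
  move: cx cy g tri; rewrite /gcut !cutw1 ?(v_irr vS) //; try exact: (v_irr vS).
  rewrite dwx dwy.
  have -> : nn (tau S [set x] + tau S [set y]) = nn (gnet S).
    apply: (cdist_cong k_gt0).
    have -> : tau S [set x] + tau S [set y] - gnet S = tot (dem S) setT.
      rewrite /tau /gnet Tg Ti Td !tot1; ring.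
    exact: sm.
  rewrite /ghosts /gnet Tg Ti !tot1; lra.
have := v_par vS x; rewrite dwx => /dvdzP [q Eq].
have kz : k%:Z != 0 by lia.
(* With w edges between [x] and [y] and demand 2q + w at [x], sending [j] of them out of [x] gives
   the net degree 2j - w. This is right modulo 2k exactly if [j] is congruent to q + w modulo k. *)
set j := ((q + wt S x y) %% k%:Z)%Z.
have j0 : 0 <= j by exact: modz_ge0.
have j1 : j < k%:Z by apply: ltz_pmod; lia.
have Ej := divz_eq (q + wt S x y) k%:Z; rewrite -/j in Ej.
pose o := aadd (aadd (fun _ _ => 0) x y j) y x (wt S x y - j).
have n0 a : net o a = (if a == x then 2 * j - wt S x y else 0) + (if a == y then wt S x y - 2 * j else 0).
  rewrite /o !net_aadd {1}/net big1 //.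
  by case: (a == x); case: (a == y); ring.
exists o; split.
- move=> a b; rewrite /o !aaddE !addr_ge0 ?arc_ge0 //; lia.
- move=> a b; rewrite /o !aaddE (arcC x y _ a b) (arcC y x _ a b).
  rewrite /arc; have [->|ax] := eqVneq a x; have [->|by'] := eqVneq b y => /=; rewrite ?eqxx ?(negbTE xy) ?andbF /=.
  + by rewrite addrC; ring.
  + have [->|bx] := eqVneq b x; first by rewrite (v_irr vS) !add0r.
    by rewrite w0' ?Em ?inE ?negb_or ?bx ?by' // !addr0.
  + have [->|ay] := eqVneq a y; first by rewrite eq_sym (negbTE xy) (v_irr vS) !addr0.
    by rewrite /= !addr0 w0 // Em !inE negb_or ax ay.
  + have [->|ay] := eqVneq a y; last by rewrite /= !addr0 w0 // Em !inE negb_or ax ay.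
    have [->|bx] := eqVneq b x; last by rewrite /= !addr0 w0' // Em !inE negb_or bx by'.
    by rewrite (v_sym vS y x) /=; ring.
- have hx : (N %| dem S x - (2 * j - wt S x y))%Z.
    apply/dvdzP; exists ((q + wt S x y) %/ k%:Z)%Z.
    have -> : dem S x = q * 2 + wt S x y by lra.
    have -> : N = 2 * k%:Z by rewrite PoszM.
    have -> : j = (q + wt S x y) - ((q + wt S x y) %/ k%:Z)%Z * k%:Z by rewrite {1}Ej; ring.
    ring.
  move=> v; rewrite Em !inE => /orP [] /eqP ->; rewrite n0 eqxx ?(negbTE xy) ?addr0 //.
  rewrite eq_sym (negbTE xy) add0r.
  have -> : dem S y - (wt S x y - 2 * j) = tot (dem S) setT - (dem S x - (2 * j - wt S x y)).
    by rewrite Td; ring.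
  by apply: rpredB => //; exact: (v_sum vS).
- move=> v vS'; have [_ _ _ ->] := D v vS'; rewrite n0.
  by rewrite !ifF ?addr0 //; apply: contraNF vS' => /eqP ->.
Qed.

Lemma demanded1 S y : (1 < #|modv S|)%N -> y \in modv S -> demanded S [set y].
Proof.
move=> c yS; apply/demandedP; split; first by exists y; rewrite ?inE.
have : (0 < #|modv S :\ y|)%N by move: c; rewrite (cardsD1 y) yS.
by case/card_gt0P => z; rewrite !inE => /andP [zy zS]; exists z; rewrite ?inE.
Qed.

Section Saturated.
Variable S : state V.
Hypotheses (vS : valid S) (sS : slack S) (ih : solvable_below S).
Hypothesis nx : forall x, x \notin modv S -> dw (wt S) x <= 0.
Hypothesis c3 : (2 < #|modv S|)%N.

Let T1 y (yS : y \in modv S) : demanded S [set y].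
Proof. by apply: demanded1 => //; exact: ltnW. Qed.

Lemma gcut1 y : gcut S [set y] = dw (wt S) y + gout S y + gin S y.
Proof. by rewrite /gcut cutw1 ?tot1 //; exact: (v_irr vS). Qed.

(** This is [slack] for the complement of [y], which contains at least two vertices of [modv]. Its
    [tau] is congruent to [gnet] minus that of [y]. *)
Lemma compl_cut y : y \in modv S ->
  K + 2 + nn (gnet S - tau S [set y]) <= ghosts S - gout S y - gin S y + dw (wt S) y.
Proof.
move=> yS.
have dA : demanded S (~: [set y]).
  have : (0 < #|modv S :\ y|)%N by move: c3; rewrite (cardsD1 y) yS; case: #|_|.
  case/card_gt0P => z; rewrite !inE => /andP [zy zS].
  by apply/demandedP; split; [exists z | exists y]; rewrite ?inE ?eqxx.
have cA : (1 < #|~: [set y] :&: active S|)%N.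
  apply: leq_trans (_ : #|modv S :\ y| <= _)%N; first by move: c3; rewrite (cardsD1 y) yS.
  apply: subset_leq_card; apply/subsetP => z; rewrite /active !inE => /andP [-> ->] //.
have := sS dA cA; rewrite /gcut cutwC; last exact: (v_sym vS).
have G := totC (gout S) [set y]; have I := totC (gin S) [set y]; have D := totC (dem S) [set y].
rewrite cutw1; last exact: (v_irr vS).
rewrite (cdist_cong k_gt0 (z := tau S _) (z' := gnet S - tau S [set y])).
  move: G I; rewrite /ghosts !tot1; lra.
have -> : tau S (~: [set y]) - (gnet S - tau S [set y]) = tot (dem S) setT.
  by move: G I D; rewrite /tau /gnet; lra.
exact: (v_sum vS).
Qed.

Lemma has_nbr y : y \in modv S -> exists z, 0 < wt S y z.
Proof.
move=> yS; apply: (act_w vS).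
have h := compl_cut yS; have h1 := v_cut vS (T1 yS); have g := v_gh vS.
have := cdistD k_gt0 (gnet S - tau S [set y]) (tau S [set y]); rewrite subrK.
move: h1; rewrite gcut1.
have : 2 <= K by lia.
lra.
Qed.

(** At such a vertex no arc can be deleted in either direction. Its residue is 0, however, so it can
    be made exact, and [compl_cut] shows that its ghosts do not outnumber its edges. *)
Lemma solve_zero y : y \in modv S -> nn (tau S [set y]) = 0 -> gcut S [set y] < K + 2 -> solvable S.
Proof.
move=> yS t0 tight.
have hN : (N %| dem S y + gout S y - gin S y)%Z.
  by have := cdist0_dvd k_gt0 t0; rewrite /tau !tot1.
apply: (solvable_make_exact yS hN); apply: ih.
  apply: valid_make_exact => //.
    have h := compl_cut yS; have g := v_gh vS; move: tight; rewrite gcut1.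
    rewrite (cdist_cong k_gt0 (z := gnet S - _) (z' := gnet S)) in h.
      lra.
    by rewrite addrC addKr rpredN; exact: cdist0_dvd.
  by move=> x xS; have [-> _ _ _] := not_mod_inactive vS nx xS.
left; rewrite /msize -addnS; apply: leq_add; last first.
  by rewrite (cardsD1 y (modv S)) yS.
apply: subset_leq_card; apply/subsetP => v; rewrite /active /= !inE.
by case/orP => [/andP [_ ->] //|->]; rewrite orbT.
Qed.

(** The singleton [u] can afford the deletion of an arc that leaves [u]. *)
Definition outok u := K + nn (tau S [set u] - 1) <= gcut S [set u] - 1.
Definition inok u := K + nn (tau S [set u] + 1) <= gcut S [set u] - 1.

Lemma solve_del u v : u \in modv S -> v \in modv S -> 0 < wt S u v -> outok u -> inok v -> solvable S.
Proof.
move=> uS vSm wuv ou iv.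
have := ih (valid_del k_gt1 vS sS uS vSm wuv ou iv) (smaller_del _ _ _ _ _).
exact: solvable_del.
Qed.

Lemma w_ms u v : 0 < wt S u v -> (u \in modv S) * (v \in modv S).
Proof.
move=> w; split; apply: contraTT w => xS.
  by have [-> _ _ _] := not_mod_inactive vS nx xS; rewrite ltxx.
by rewrite (v_sym vS); have [-> _ _ _] := not_mod_inactive vS nx xS; rewrite ltxx.
Qed.

Hypothesis nz : forall y, y \in modv S -> ~ (nn (tau S [set y]) = 0 /\ gcut S [set y] < K + 2).

Lemma some_ok y : y \in modv S -> outok y \/ inok y.
Proof.
move=> yS; have [t0|t0] := eqVneq (nn (tau S [set y])) 0.
  left; have := nz yS; rewrite t0 /outok => h; have [] := cdist_step_le k_gt1 (tau S [set y]); lra.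
have c := v_cut vS (T1 yS); rewrite /outok /inok.
by have [->|->] := cdist_stepE k_gt0 t0; [left | right]; lra.
Qed.

Lemma out_only y : y \in modv S -> outok y -> ~~ inok y ->
  [/\ nn (tau S [set y] - 1) = nn (tau S [set y]) - 1, nn (tau S [set y]) < k%:Z &
   gcut S [set y] < K + 2 + nn (tau S [set y])].
Proof.
move=> yS o; rewrite -ltNge => i.
have [h1 h2] := cdist_step_le k_gt1 (tau S [set y]).
have lk := cdist_lek k_gt0 (tau S [set y]).
have E : nn (tau S [set y] - 1) = nn (tau S [set y]) - 1.
  have [//|E] := cdist_step k_gt0 (tau S [set y]).
  by move: o; rewrite /outok E; lra.
split=> //; last lra.
rewrite lt_neqAle lk andbT; apply/eqP => ek.
have [_ e2] := cdist_k k_gt0 ek.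
have c := v_cut vS (T1 yS); lra.
Qed.

Hypothesis nodel : forall u v, u \in modv S -> v \in modv S -> 0 < wt S u v -> outok u -> ~~ inok v.

Lemma not_both y : y \in modv S -> outok y -> ~~ inok y.
Proof.
move=> yS oy; have [z wyz] := has_nbr yS; have [_ zS] := w_ms wyz.
apply/negP => iy; have [oz|iz] := some_ok zS.
  by have := nodel zS yS; rewrite (v_sym vS) wyz oz iy => /(_ isT isT).
by have := nodel yS zS wyz oy; rewrite iz.
Qed.

(** An edge from a vertex that can lose an out-arc to one that can lose an in-arc would be
    deletable. So no edge joins the two kinds, and if both occurred, the cut conditions of the two
    sides would exceed the bound on the ghosts. *)
Lemma uniform_ok : (forall y, y \in modv S -> outok y) \/ (forall y, y \in modv S -> inok y).
Proof.
pose P := [set y in modv S | outok y].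
have [/eqP P0|[p]] := set_0Vmem P.
  right=> y yS; have [o|//] := some_ok yS.
  by move/eqP/setP/(_ y): P0; rewrite !inE yS o.
rewrite inE => /andP [pS op].
have [|/subsetPn [q qS qP]] := boolP (modv S \subset P).
  by move=> /subsetP sub; left=> y /sub; rewrite inE => /andP [].
have dP : demanded S P by apply/demandedP; split; [exists p | exists q]; rewrite // inE pS op.
have dQ : demanded S (~: P).
  by apply/demandedP; split; [exists q | exists p]; rewrite // in_setC ?qP // negbK inE pS op.
have cut0 : cutw (wt S) P = 0.
  rewrite /cutw big1 // => u; rewrite inE => /andP [uS ou]; rewrite big1 // => v vP.
  apply: le_anti; rewrite (v_w0 vS) andbT leNgt; apply/negP => wuv.
  have [_ vm] := w_ms wuv.
  have := nodel uS vm wuv ou; case: (some_ok vm) => [ov|->] //.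
  by move: vP; rewrite inE vm ov.
have h1 := v_cut vS dP; have h2 := v_cut vS dQ; have g := v_gh vS; have sm := v_sum vS.
have tri := cdistD k_gt0 (tau S P) (tau S (~: P)).
rewrite (cdist_cong k_gt0 (z := _ + _) (z' := gnet S)) in tri; last first.
  have -> : tau S P + tau S (~: P) - gnet S = tot (dem S) setT.
    by rewrite /tau /gnet !(totC _ P); ring.
  exact: sm.
move: h1 h2 g; rewrite /gcut cutwC ?cut0; last exact: (v_sym vS).
rewrite /ghosts !(totC _ P).
have : 2 <= K by lia.
lra.
Qed.

Hypothesis allP : forall y, y \in modv S -> outok y.

(** No vertex can lose an in-arc here, so ghosts have to help. If there is room for one more, an
    edge is kept as a ghost at its second end; if not, an out-ghost is dropped. When neither is
    possible, all ghosts point inwards and their number is determined. *)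
Lemma solve_all_out : solvable S.
Proof.
have [p pS] : exists p, p \in modv S by apply/card_gt0P; apply: leq_trans c3.
have [q wpq] := has_nbr pS; have [_ qS] := w_ms wpq.
have pq := w_neq vS wpq.
have [E1 lk tight] := out_only pS (allP pS) (not_both pS (allP pS)).
have gpar : (2 %| ghosts S - nn (gnet S))%Z.
  have h := cdist_par k_gt0 (gnet S).
  have -> : ghosts S - nn (gnet S) = gnet S - nn (gnet S) + tot (gin S) setT * 2 by rewrite /ghosts /gnet; ring.
  by apply: rpredD => //; exact: dvdz_mull.
have [hg|hg] := leP (ghosts S + 1) (K + nn (gnet S - 1)).
  have := ih (valid_ghost_arc k_gt1 vS sS pS qS wpq (allP pS) hg) (smaller_del _ _ _ _ _).
  exact: solvable_del.
have g := v_gh vS.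
have [n1 _] := cdist_step_le k_gt1 (gnet S).
have En : nn (gnet S - 1) = nn (gnet S) - 1.
  have [//|E] := cdist_step k_gt0 (gnet S); move: hg gpar => /[swap] /dvdzP [r Er].
  rewrite E => hg; move: (ghosts S) (nn (gnet S)) Er g hg => a b; lia.
have Eg : ghosts S = K + nn (gnet S).
  move: gpar => /dvdzP [r Er]; move: hg; rewrite En; move: (ghosts S) (nn (gnet S)) Er g => a b; lia.
have [/existsP [u /andP [uS gu]]|nog] := boolP [exists u, (u \in modv S) && (0 < gout S u)].
  apply: (@solvable_add_ghosts V k S u (-1)); apply: ih.
    apply: (valid_remove_ghost k_gt1 vS sS uS uS gu (allP uS)); rewrite Eg En; lra.
  right; split; first exact: msize_mono.
  by right; split; rewrite ?ghosts_add_ghosts //=; lra.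
have go0 x : gout S x = 0.
  have [xS|xS] := boolP (x \in modv S); last by have [_ -> _ _] := not_mod_inactive vS nx xS.
  apply: le_anti; rewrite (v_go0 vS) andbT leNgt; apply: contra nog => h.
  by apply/existsP; exists x; rewrite xS.
have tg : tot (gout S) setT = 0 by apply: tot0 => x _; exact: go0.
have Eng : gnet S = - ghosts S by rewrite /gnet /ghosts tg; ring.
have gp := cdist_pos k_gt0 En.
(* All 2k - 2 + r ghosts point inwards, where r is the distance of [gnet], and [gnet] is congruent
   to r modulo 2k. So r is 1 modulo k, and 1 <= r <= k leaves r = 1. *)
have r1 : nn (gnet S) = 1.
  have lr := cdist_lek k_gt0 (gnet S); have r0 := cdist_ge0 k_gt0 (gnet S - 1); rewrite En in r0.
  move: gp; rewrite {1}Eng Eg => /dvdzP [t]; move: (nn (gnet S)) lr r0 => r lr r0 Et.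
  have {Et} : 2 * (r - 1) = (- t - 1) * (2 * k%:Z) by rewrite PoszM in Et; lra.
  have [t0|[t0|t0]] : - t - 1 = 0 \/ 1 <= - t - 1 \/ - t - 1 <= -1 by lia.
  + by rewrite t0; lra.
  + nia.
  + nia.
(* Now gnet is 1 modulo 2k, so there is room for j more ghosts out of p; they
   bring tau at p to k, where the arc qp can be deleted. *)
pose t := nn (tau S [set p]).
have tp := cdist_pos k_gt0 E1; rewrite -/t in tp.
have t1 : 1 <= t by have := cdist_ge0 k_gt0 (tau S [set p] - 1); rewrite E1 -/t; lra.
pose j := k%:Z - t.
have j0 : 0 <= j by rewrite /j /t; lra.
have hj : ghosts S + j <= K + nn (gnet S + j).
  have lj : nn (gnet S) + j <= k%:Z by rewrite r1 /j; lra.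
  by rewrite (cdist_add k_gt0 gp j0 lj) Eg; lra.
have vJ := valid_add_ghosts_pos k_gt1 vS pS j0 hj.
have sJ := slack_add_ghosts (u := p) k_gt1 sS j0.
apply: (@solvable_add_ghosts V k S p j).
have cp := v_cut vS (T1 pS).
have cq := allP qS.
apply: (@solvable_del V k q p _ (gout (add_ghosts S p j)) (gin (add_ghosts S p j))); apply: ih; last exact: (smaller_del q p S).
apply: (valid_del k_gt1 vJ sJ) => //.
- by rewrite /= (v_sym vS).
- by rewrite tau_add_ghosts gcut_add_ghosts inE (negbTE pq) !addr0.
- rewrite tau_add_ghosts gcut_add_ghosts inE eqxx.
  have Ek : nn (tau S [set p] + j) = k%:Z.
    by rewrite (cdist_add k_gt0 tp j0); rewrite -/t /j; lra.
  have [_ ->] := cdist_k k_gt0 Ek; rewrite -/t in cp; rewrite /j; lra.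
Qed.

End Saturated.

Lemma outok_rev S u : outok (reversed S) u = inok S u.
Proof. by rewrite /outok /inok tau_rev gcut_rev -opprD cdistN // k_gt0. Qed.
Lemma inok_rev S u : inok (reversed S) u = outok S u.
Proof. rewrite /outok /inok tau_rev gcut_rev.
have -> : - tau S [set u] + 1 = - (tau S [set u] - 1) by ring.
by rewrite cdistN. Qed.

Lemma solvable_step S : valid S -> solvable_below S -> solvable S.
Proof.
move=> vS ih.
have [/existsP [A /and3P [dA cA tA]]|notight] := boolP [exists A : {set V},
   [&& demanded S A, (1 < #|A :&: active S|)%N & gcut S A <= K + nn (tau S A)]].
  by apply: (contract k_gt1 vS dA tA cA) => S' vS' lS'; apply: ih => //; left.
have sS : slack S.
  move=> A dA cA; have := gcut_parity k_gt1 A vS.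
  have : ~~ (gcut S A <= K + nn (tau S A)).
    by apply: contra notight => h; apply/existsP; exists A; rewrite dA cA.
  rewrite -ltNge; move: (gcut S A) (nn (tau S A)) => a b h /dvdzP [r Er]; lia.
have [/existsP [x /andP [xS dx]]|noex] := boolP [exists x, (x \notin modv S) && (0 < dw (wt S) x)].
  exact: solve_exact dx.
have nx x : x \notin modv S -> dw (wt S) x <= 0.
  by move=> xS; rewrite leNgt; apply: contra noex => h; apply/existsP; exists x; rewrite xS.
have W := w_ms vS nx.
have [c1|c1] := leqP #|modv S| 1.
  apply: solve_edgeless => // u v; apply: le_anti; rewrite (v_w0 vS) andbT leNgt.
  apply/negP => wuv; have [uS vm] := W _ _ wuv; have := w_neq vS wuv.
  by have /card_le1_eqP h := c1; rewrite (h u v) ?eqxx.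
have [c2|c3] := leqP #|modv S| 2.
  have /cards2P [x [y [xy Em]]] : #|modv S| == 2 by rewrite eqn_leq c1 c2.
  exact: (solve_two vS nx xy Em).
have [/existsP [y /and3P [yS /eqP t0 tight]]|nz] :=
  boolP [exists y, [&& y \in modv S, nn (tau S [set y]) == 0 & gcut S [set y] < K + 2]].
  exact: solve_zero t0 tight.
have nz' y : y \in modv S -> ~ (nn (tau S [set y]) = 0 /\ gcut S [set y] < K + 2).
  by move=> yS [t0 t1]; case/negP: nz; apply/existsP; exists y; rewrite yS t0 t1 eqxx.
have [/existsP [u /existsP [v /and5P [uS vm wuv ou iv]]]|nodel] := boolP [exists u, [exists v,
    [&& u \in modv S, v \in modv S, 0 < wt S u v, outok S u & inok S v]]].
  exact: solve_del ou iv.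
have nd u v : u \in modv S -> v \in modv S -> 0 < wt S u v -> outok S u -> ~~ inok S v.
  move=> uS vm wuv ou; apply: contra nodel => iv.
  by apply/existsP; exists u; apply/existsP; exists v; rewrite uS vm wuv ou.
have [aP|aP] := uniform_ok vS nx c3 nz' nd; first exact: solve_all_out aP.
apply: solvable_rev; apply: solve_all_out => //.
- exact: valid_rev.
- exact: slack_rev.
- exact: solvable_below_rev.
- by move=> y yS; rewrite tau_rev gcut_rev cdistN //; exact: nz'.
- move=> u v uS vm wuv; rewrite outok_rev inok_rev => iu; apply/negP => ov.
  by have := nd v u vm uS; rewrite (v_sym vS) => /(_ wuv ov); rewrite iu.
- by move=> y yS; rewrite outok_rev; exact: aP.
Qed.

Theorem valid_solvable S : valid S -> solvable S.
Proof.
have [n] := ubnP (msize S); elim: n => // n IHn in S *; rewrite ltnS => hn.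
have [e] := ubnP `|size_w (wt S)|%N; elim: e => // e IHe in S hn *; rewrite ltnS => he.
have [g] := ubnP `|ghosts S|%N; elim: g => // g IHg in S hn he *; rewrite ltnS => hg vS.
apply: solvable_step => // S' vS' [l1|[l1 [l2|[l2 l3]]]].
- by apply: IHn => //; apply: leq_trans hn.
- apply: IHe => //; first exact: leq_trans l1 hn.
  have : 0 <= size_w (wt S') by apply: sumr_ge0 => v _; exact: (dw_ge0 _ vS').
  by move: l2 he; move: (size_w _) (size_w _) => a b; lia.
- apply: IHg => //; first exact: leq_trans l1 hn.
    have : 0 <= size_w (wt S') by apply: sumr_ge0 => v _; exact: (dw_ge0 _ vS').
    by move: l2 he; move: (size_w _) (size_w _) => a b; lia.
  have : 0 <= ghosts S' by rewrite /ghosts addr_ge0 ?tot_ge0 //; [exact: (v_go0 vS') | exact: (v_gi0 vS')].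
  by move: l3 hg; move: (ghosts _) (ghosts _) => a b; lia.
Qed.

End Solvability.

(** * Modulo orientations of bipartite edge sets *)

Section Pairs.
Variable V : finType.
Implicit Types (R F : {set V * V}) (A : {set V}) (v : V).

Local Open Scope ring_scope.

(* F collects the edges oriented from their first to their second end, so that
   deg1 F v + deg2 (R :\: F) v is the out-degree of v. *)
Theorem mod_orientation (k : nat) (c : pred V) R (Y : {set V}) (al : V -> nat) :
  (1 < k)%N -> sided c R ->
  (forall A, ~~ [disjoint Y & A] -> ~~ (Y \subset A) -> (3 * k - 2 <= edge_cut R A)%N) ->
  (forall v, v \notin Y -> c v) ->
  (forall v, v \notin Y -> ~~ odd (deg1 R v)) ->
  ((k%:Z) %| (\sum_v (if v \in Y then al v else (deg1 R v)./2))%:Z - (#|R|)%:Z)%Z ->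
  exists2 F : {set V * V}, F \subset R &
    (forall v, v \in Y -> ((k%:Z) %| (deg1 F v + deg2 (R :\: F) v)%:Z - (al v)%:Z)%Z) /\
    (forall v, v \notin Y -> deg1 F v = (deg1 R v)./2).
Proof.
move=> k1 sR hcut hX hev hsum.
pose w u v : int := (((u, v) \in R) + ((v, u) \in R))%N.
(* Out-degree s at a vertex of degree d means net degree 2s - d, so a congruence modulo [k] for
   out-degrees is one modulo 2k for net degrees. An exactly bisected vertex has net degree 0. *)
pose dm v : int := if v \in Y then (2 * al v)%N%:Z - (deg1 R v + deg2 R v)%N%:Z else 0.
pose S := State w (fun=> 0) (fun=> 0) dm Y.
have t0 A : tot (fun _ : V => 0 : int) A = 0 by rewrite /tot big1.
have Edw v : dw w v = (deg1 R v + deg2 R v)%N.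
  rewrite /dw /w deg1E deg2E -big_split /= -(big_morph _ PoszD (erefl 0%Z)) //.
have Ecut A : cutw w A = edge_cut R A.
  have -> : edge_cut R A = (\sum_(u in A) \sum_(v | v \notin A) (((u, v) \in R) + ((v, u) \in R)))%N.
    rewrite /edge_cut cntE (pair_sum R (fun u v => ((u \in A) (+) (v \in A)) : nat)).
    rewrite (bigID (mem A)) /=.
    have -> : (\sum_(i | i \notin A) \sum_v ((i, v) \in R) * ((i \in A) (+) (v \in A)) =
       \sum_(v in A) \sum_(i | i \notin A) ((i, v) \in R))%N.
      rewrite [RHS]exchange_big /=; apply: eq_bigr => i /negbTE ->.
      rewrite [RHS]big_mkcond /=; apply: eq_bigr => v _.
      by case: (v \in A); rewrite ?muln1 ?muln0.
    rewrite -big_split /=; apply: eq_bigr => u ->.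
    rewrite big_split /=; congr addn; rewrite [RHS]big_mkcond /=; apply: eq_bigr => v _.
    by case: (v \in A); rewrite ?muln1 ?muln0.
  rewrite /cutw (big_morph _ PoszD (erefl 0%Z)); apply: eq_bigr => u _.
  by rewrite (big_morph _ PoszD (erefl 0%Z)).
have nR u v : c u = c v -> (u, v) \notin R.
  by move=> e; apply/negP => /sR /=; rewrite e; case: (c v).
have vS : valid k S.
  split=> //=.
  - by move=> u v; rewrite /w addnC.
  - by move=> u; rewrite /w (negbTE (nR u u _)).
  - by move=> x xY; rewrite /dm (negbTE xY).
  - by move=> x _; rewrite Edw.
  - by move=> x y /hX cx /hX cy; rewrite /w !(negbTE (nR _ _ _)) ?cx ?cy.
  (* The bound 3k - 2 is the surplus 2k - 2 plus the largest value [k] of [cdist]. *)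
  - move=> A /andP [h1 h2]; rewrite /gcut /= Ecut !t0 !addr0.
    have := hcut A h1 h2; have := cdist_lek (ltnW k1) (tau S A); lia.
  - by have := cdist_ge0 (ltnW k1) (gnet S); rewrite /ghosts /= !t0; lia.
  - move: hsum => /dvdzP [q Eq]; apply/dvdzP; exists q.
    rewrite PoszM mulrCA -Eq.
    have -> : tot dm setT = \sum_v (2 * (if v \in Y then al v else (deg1 R v)./2)%:Z - (deg1 R v + deg2 R v)%N%:Z).
      rewrite /tot; apply: eq_big => [v|v _]; first by rewrite inE.
      rewrite /dm; case: ifP => // vY; have := hev v (negbT vY).
      rewrite (deg2_side sR (hX v (negbT vY))); lia.
    rewrite sumrB -mulr_sumr -!(big_morph _ PoszD (erefl 0%Z)) big_split /= sum_deg1 sum_deg2.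
    move: (\sum_v _)%N #|R| => a b; lia.
  - move=> v; rewrite Edw /dm; case: ifP => vY.
      apply/dvdzP; exists ((al v)%:Z - (deg1 R v + deg2 R v)%N%:Z); lia.
    have := hev v (negbT vY); rewrite (deg2_side sR (hX v (negbT vY))) addn0 => e.
    by apply/dvdzP; exists (- ((deg1 R v)./2)%:Z); lia.
have [o [o0 ow om oe]] := valid_solvable k1 vS.
pose F := [set p in R | o p.1 p.2 == 1].
have sF : sided c F by move=> p; rewrite inE => /andP [/sR].
exists F; first by apply/subsetP => p; rewrite inE => /andP [].
have oF u v : o u v - o v u = (((u, v) \in F) + ((v, u) \in R))%N%:Z
    - (((u, v) \in R :\: F) + ((v, u) \in F))%N%:Z - (((v, u) \in F))%N%:Z .
  have := ow u v; rewrite /= /w !inE /=; have := o0 u v; have := o0 v u.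
  have := @nR u v; have := @nR v u.
  case Ruv: ((u, v) \in R); case Rvu: ((v, u) \in R) => /=.
  - by have := sR _ Ruv; have := sR _ Rvu; rewrite /=; case: (c u); case: (c v).
  - by move=> _ _; case: eqP; lia.
  - by move=> _ _; case: eqP; lia.
  - lia.
have En v : net o v = (deg1 F v + deg2 R v)%N%:Z - (deg1 (R :\: F) v + deg2 F v + deg2 F v)%N%:Z.
  rewrite /net (eq_bigr _ (fun u _ => oF v u)) !sumrB -!(big_morph _ PoszD (erefl 0%Z)) !big_split /=.
  by rewrite -!deg1E -!deg2E; lia.
have FR : F \subset R by apply/subsetP => p; rewrite inE => /andP [].
have D1 v : deg1 R v = (deg1 F v + deg1 (R :\: F) v)%N := cntD _ FR.
have D2 v : deg2 R v = (deg2 F v + deg2 (R :\: F) v)%N := cntD _ FR.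
split=> v vY.
  have := om v vY; rewrite En /= /dm vY => /dvdzP [q Eq].
  apply/dvdzP; exists (- q); move: Eq; rewrite D1 D2 PoszM; lia.
have := oe v vY; rewrite En /= /dm (negbTE vY).
have := hX v vY => cv; rewrite !(deg2_side _ cv) //; have := hev v vY; rewrite D1; lia.
Qed.

End Pairs.

(** * Bistar decompositions *)

Section Bistars.
Variables (V : finType) (e : rel V) (k l : nat).
Hypothesis esym : symmetric e.
Implicit Types (E F C L A B : {set V * V}) (c : pred V).

Definition ends (p : V * V) : {set V} := [set p.1; p.2].
Definition und E : {set {set V}} := [set ends p | p in E].
Definition decomposable E := exists P : {set {set {set V}}},
  partition P (und E) /\ forall H, H \in P -> is_bistar k l e H.

(** The colouring tells the two ends of an edge apart, so the ordered pair can be recovered from the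
    unordered one. *)
Lemma ends_inj c E : sided c E -> {in E &, injective ends}.
Proof.
move=> s p q pE qE /setP h.
have /andP [p1 p2] := s p pE; have /andP [q1 q2] := s q qE.
have := h p.1; have := h p.2; rewrite !inE !eqxx orbT /=.
have n1 : p.2 == q.1 = false by apply: contraNF p2 => /eqP ->.
have n2 : p.1 == q.2 = false by apply: contraTF p1 => /eqP ->.
rewrite n1 n2 orbF /= => /(@Logic.eq_sym _ _ _) /eqP e2 /(@Logic.eq_sym _ _ _) /eqP e1.
by case: p q e1 e2 {h p1 p2 q1 q2 n1 n2 pE qE} => [a b] [a' b'] /= -> ->.
Qed.

Lemma undU A B : und (A :|: B) = und A :|: und B.
Proof. exact: imsetU. Qed.

Lemma und_disjoint c A B : sided c (A :|: B) -> [disjoint A & B] -> [disjoint und A & und B].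
Proof.
move=> s d; rewrite -setI_eq0; apply/eqP/setP => x; rewrite !inE; apply/negP.
move=> /andP [/imsetP [p pA ->] /imsetP [q qB ee]].
have pq : p = q by apply: (ends_inj s); rewrite ?inE ?pA ?qB ?orbT.
by move/disjP: d => /(_ p pA); rewrite pq qB.
Qed.

Lemma decomposable0 : decomposable set0.
Proof.
exists set0; split=> [|H]; last by rewrite inE.
rewrite /und imset0; apply/and3P; split; rewrite ?inE //.
  by rewrite /cover big_set0.
by apply/trivIsetP => A B; rewrite inE.
Qed.

Lemma decomposableU c A B : sided c (A :|: B) -> [disjoint A & B] ->
  decomposable A -> decomposable B -> decomposable (A :|: B).
Proof.
move=> s d [P [pP bP]] [Q [pQ bQ]]; exists (P :|: Q); split; last first.
  by move=> H; rewrite inE => /orP [/bP|/bQ].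
have dU := und_disjoint s d.
case/and3P: pP => /eqP cP tP nP; case/and3P: pQ => /eqP cQ tQ nQ.
apply/and3P; split.
- by rewrite undU -cP -cQ /cover bigcup_setU.
- by apply: trivIsetU; rewrite // cP cQ.
- by rewrite inE negb_or nP.
Qed.

Lemma bistar_sym H : is_bistar k l e H -> is_bistar l k e H.
Proof.
case=> u [v [A [B [[uv euv uA vA dAB] [cA cB hA hB ->]]]]].
exists v, u, B, A; split; split; rewrite // 1?eq_sym 1?esym // 1?[B :|: A]setUC 1?disjoint_sym //.
by rewrite [[set v; u]]setUC setUAC.
Qed.

End Bistars.

Section Gluing.
Variables (V : finType) (e : rel V).
Hypothesis esym : symmetric e.
Implicit Types (E F C L A B : {set V * V}) (c : pred V).

Lemma decomposable_sym k l E : decomposable e k l E -> decomposable e l k E.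
Proof. by case=> P [pP h]; exists P; split=> // H /h; exact: bistar_sym. Qed.

Lemma bistar_und c p q (z : V * V) A B : sided c (z |: A :|: B) ->
  (forall a, a \in z |: A :|: B -> e a.1 a.2) ->
  (forall a, a \in A -> a.1 = z.1) -> (forall b, b \in B -> b.2 = z.2) ->
  z \notin A -> z \notin B -> #|A| = p -> #|B| = q ->
  is_bistar p.+1 q.+1 e (und (z |: A :|: B)).
Proof.
move=> s he hA hB zA zB cA cB.
have sz : c z.1 && ~~ c z.2 by apply: s; rewrite !inE eqxx.
have sA a : a \in A -> c a.1 && ~~ c a.2 by move=> aA; apply: s; rewrite !inE aA orbT.
have sB a : a \in B -> c a.1 && ~~ c a.2 by move=> aA; apply: s; rewrite !inE aA !orbT.
case/andP: sz => sz1 sz2.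
exists z.1, z.2, [set a.2 | a in A], [set b.1 | b in B]; split; split.
- by apply: contraNneq sz2 => <-.
- by apply: he; rewrite !inE eqxx.
- rewrite inE negb_or; apply/andP; split; apply/imsetP => -[a aA ea].
    by have := sA a aA; rewrite -ea sz1 andbF.
  by case/negP: zB; rewrite (_ : z = a) //; rewrite [z]surjective_pairing [a]surjective_pairing ea (hB a aA).
- rewrite inE negb_or; apply/andP; split; apply/imsetP => -[a aA ea].
    by case/negP: zA; rewrite (_ : z = a) //; rewrite [z]surjective_pairing [a]surjective_pairing ea (hA a aA).
  by have := sB a aA; rewrite -ea (negbTE sz2).
- rewrite -setI_eq0; apply/eqP/setP => x; rewrite !inE; apply/negP => /andP [].
  move=> /imsetP [a /sA /andP [_ a2] ->] /imsetP [b /sB /andP [b1 _] eb].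
  by rewrite eb b1 in a2.
- rewrite /= -cA card_in_imset // => a b aA bA ab.
  by rewrite [a]surjective_pairing [b]surjective_pairing ab !hA.
- rewrite /= -cB card_in_imset // => a b aA bA ab.
  by rewrite [a]surjective_pairing [b]surjective_pairing ab !hB.
- by move=> x /imsetP [a aA ->]; rewrite -(hA a aA) he // !inE aA orbT.
- by move=> x /imsetP [a aA ->]; rewrite esym -(hB a aA) he // !inE aA !orbT.
- rewrite !undU; congr (_ :|: _ :|: _).
  + by rewrite /und imset_set1.
  + rewrite -imset_comp; apply: eq_in_imset => a aA /=; by rewrite /ends hA.
  + rewrite -imset_comp; apply: eq_in_imset => a aA /=; by rewrite /ends hB // setUC.
Qed.

Lemma bistar_decomposable k l E : E != set0 -> is_bistar k l e (und E) -> decomposable e k l E.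
Proof.
move=> /set0Pn [p pE] h; exists [set und E]; split; last by move=> H; rewrite inE => /eqP ->.
apply/and3P; split; rewrite ?cover1 ?trivIset1 // inE; apply/eqP => /setP /(_ (ends p)).
by rewrite inE imset_f.
Qed.

(* The edges of C become the central edges of the bistars. *)
Lemma glue_bistars c p q C A B : sided c (C :|: A :|: B) ->
  (forall a, a \in C :|: A :|: B -> e a.1 a.2) ->
  [disjoint C & A] -> [disjoint C :|: A & B] ->
  (forall v, deg1 A v = p * deg1 C v) -> (forall v, deg2 B v = q * deg2 C v) ->
  decomposable e p.+1 q.+1 (C :|: A :|: B).
Proof.
have [n] := ubnP #|C|; elim: n C A B => // n IH C A B cC s he dCA dB hA hB.
have [C0|[z zC]] := set_0Vmem C.
  have A0 : A = set0.
    apply/eqP; rewrite -cards_eq0 -sum_deg1; apply/eqP; apply: big1 => v _.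
    by rewrite hA C0 /deg1 cnt0 ?muln0 // => a; rewrite inE.
  have B0 : B = set0.
    apply/eqP; rewrite -cards_eq0 -sum_deg2; apply/eqP; apply: big1 => v _.
    by rewrite hB C0 /deg2 cnt0 ?muln0 // => a; rewrite inE.
  rewrite C0 A0 B0 !setU0; exact: decomposable0.
have gt1 : 0 < deg1 C z.1 by apply/card_gt0P; exists z; rewrite inE zC eqxx.
have gt2 : 0 < deg2 C z.2 by apply/card_gt0P; exists z; rewrite inE zC eqxx.
have [A0 sA0 cA0] : exists2 X : {set V * V}, X \subset [set a in A | a.1 == z.1] & #|X| = p.
  by apply: subset_card; rewrite -/(cnt _ _) -/(deg1 _ _) hA leq_pmulr.
have [B0 sB0 cB0] : exists2 X : {set V * V}, X \subset [set a in B | a.2 == z.2] & #|X| = q.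
  by apply: subset_card; rewrite -/(cnt _ _) -/(deg2 _ _) hB leq_pmulr.
have A0A : A0 \subset A by apply: subset_trans sA0 _; apply/subsetP => a; rewrite inE => /andP [].
have B0B : B0 \subset B by apply: subset_trans sB0 _; apply/subsetP => a; rewrite inE => /andP [].
have A01 a : a \in A0 -> a.1 = z.1 by move/(subsetP sA0); rewrite inE => /andP [_ /eqP].
have B02 a : a \in B0 -> a.2 = z.2 by move/(subsetP sB0); rewrite inE => /andP [_ /eqP].
have zA : z \notin A by move/disjP: dCA => /(_ z zC) ->.
have zB : z \notin B by move/disjP: dB => /(_ z); rewrite inE zC => /(_ isT) ->.
have CA a : a \in C -> (a \in A) = false by move=> aC; move/disjP: dCA => /(_ a aC) /negbTE.
have CB a : a \in C -> (a \in B) = false.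
  by move=> aC; move/disjP: dB => /(_ a); rewrite inE aC => /(_ isT) /negbTE.
have AB a : a \in A -> (a \in B) = false.
  by move=> aA; move/disjP: dB => /(_ a); rewrite inE aA orbT => /(_ isT) /negbTE.
have split : C :|: A :|: B = (z |: A0 :|: B0) :|: ((C :\ z) :|: (A :\: A0) :|: (B :\: B0)).
  apply/setP => a; rewrite !inE; case: (eqVneq a z) => [->|_] /=; first by rewrite zC.
  case aA0: (a \in A0); first by rewrite (subsetP A0A _ aA0) !orbT.
  case aB0: (a \in B0); first by rewrite (subsetP B0B _ aB0) !orbT.
  by [].
rewrite split; apply: (@decomposableU _ _ _ _ c); rewrite -?split //.
- rewrite -setI_eq0; apply/eqP/setP => a; rewrite !inE; apply/negP => /andP [].
  case/orP => [/orP [/eqP ->|aA]|aB].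
  + by rewrite eqxx (negbTE zA) (negbTE zB) !andbF.
  + have aA' := subsetP A0A _ aA; rewrite aA (AB _ aA') !andbF !orbF => /andP [_ /CA].
    by rewrite aA'.
  + have aB' := subsetP B0B _ aB; rewrite aB /= orbF => /orP [/andP [_ /CB]|/andP [_ /AB]];
    by rewrite aB'.
- have sub a : a \in z |: A0 :|: B0 -> a \in C :|: A :|: B by rewrite split => h; rewrite inE h.
  apply: bistar_decomposable; first by apply/set0Pn; exists z; rewrite !inE eqxx.
  apply: (@bistar_und c) => //.
  + by move=> a /sub; exact: s.
  + by move=> a /sub; exact: he.
  + by apply: contra zA; exact: (subsetP A0A).
  + by apply: contra zB; exact: (subsetP B0B).
have sub a : a \in (C :\ z) :|: (A :\: A0) :|: (B :\: B0) -> a \in C :|: A :|: B.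
  by rewrite split => h; rewrite [a \in _ :|: _]inE h orbT.
apply: IH.
- by move: cC; rewrite (cardsD1 z C) zC.
- by move=> a /sub; exact: s.
- by move=> a /sub; exact: he.
- apply/disjP => a; rewrite !inE => /andP [_ /CA ->]; by rewrite andbF.
- apply/disjP => a; rewrite !inE => /orP [/andP [_ /CB ->]|/andP [_ /AB ->]]; by rewrite andbF.
- move=> v; have := hA v; rewrite /deg1 (cntD _ A0A) (@cntD _ _ [set z] C) ?sub1set //.
  have [->|nv] := eqVneq v z.1.
    rewrite cnt_all => [|a aA]; last by rewrite A01.
    by rewrite cnt_set1 eqxx cA0 mulnDr muln1 => /addnI.
  rewrite cnt0 => [|a aA]; last by rewrite A01 // eq_sym.
  by rewrite cnt_set1 [z.1 == v]eq_sym (negbTE nv).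
- move=> v; have := hB v; rewrite /deg2 (cntD _ B0B) (@cntD _ _ [set z] C) ?sub1set //.
  have [->|nv] := eqVneq v z.2.
    rewrite cnt_all => [|a aA]; last by rewrite B02.
    by rewrite cnt_set1 eqxx cB0 mulnDr muln1 => /addnI.
  rewrite cnt0 => [|a aA]; last by rewrite B02 // eq_sym.
  by rewrite cnt_set1 [z.2 == v]eq_sym (negbTE nv).
Qed.

End Gluing.

(** * From factors with proportional degrees to bistars *)

Section Assembly.
Variables (V : finType) (e : rel V).
Hypothesis esym : symmetric e.
Implicit Types (E F G R S C L A B W X : {set V * V}) (c : pred V).

Definition inside E := forall a, a \in E -> e a.1 a.2.

Lemma sided_sub c E F : F \subset E -> sided c E -> sided c F.
Proof. by move=> /subsetP s h a /s; exact: h. Qed.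
Lemma inside_sub E F : F \subset E -> inside E -> inside F.
Proof. by move=> /subsetP s h a /s; exact: h. Qed.

(** The interface between the two halves of the argument: the construction of [F] depends on the
    bistar only through [U] and [f]. *)
Definition factor_suffices k l U f := forall c G F, sided c G -> inside G -> F \subset G ->
  (forall v, U %| deg1 G v) -> (forall v, U * deg1 F v = f * deg1 G v) -> (forall v, f %| deg2 F v) ->
  decomposable e k l G.

Lemma disjD A B : [disjoint B & A :\: B].
Proof. by apply/disjP => x xB; rewrite inE xB. Qed.

Lemma setD_union A B : B \subset A -> B :|: (A :\: B) = A.
Proof. by move=> s; rewrite -{2}(setID A B) (setIidPr s). Qed.

Lemma disj_sub A A' B B' : A \subset A' -> B \subset B' -> [disjoint A' & B'] -> [disjoint A & B].
Proof.
move=> /subsetP sA /subsetP sB /disjP d; apply/disjP => x /sA /d; apply: contra; exact: sB.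
Qed.

Lemma pair_factor E f t : t <= f -> (forall v, f %| deg1 E v) -> (forall v, f %| deg2 E v) ->
  exists2 F : {set V * V}, F \subset E &
    (forall v, f * deg1 F v = t * deg1 E v) /\ (forall v, f * deg2 F v = t * deg2 E v).
Proof. exact: partial_factor. Qed.

Lemma choose_deg1 L (h : V -> nat) : (forall v, h v <= deg1 L v) ->
  exists2 L' : {set V * V}, L' \subset L & forall v, deg1 L' v = h v.
Proof. exact: choose_fibres. Qed.

(** A vertex of degree (2k - 1)a on the first side has degree ka in [F]. The part [M] of [F] with
    one k-th of all degrees supplies the centres, [G] outside [F] the leaf edges at first ends, and
    [F] outside [M] those at second ends. *)
Lemma factor_suffices_diag k : 0 < k -> factor_suffices k k (2 * k - 1) k.
Proof.
move=> k0 c G F sG iG FG UG FGd F2.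
have U0 : 0 < 2 * k - 1 by lia.
have a v : exists a, deg1 G v = (2 * k - 1) * a /\ deg1 F v = k * a.
  have /dvdnP [a ea] := UG v; exists a; split; first by rewrite ea mulnC.
  have := FGd v; rewrite ea [LHS]mulnC [RHS]mulnA => /eqP.
  by rewrite eqn_pmul2r // => /eqP.
have [||M MF [M1 M2]] := @pair_factor F k 1 k0.
- by move=> v; have [b [_ h]] := a v; rewrite h dvdn_mulr.
- exact: F2.
have D1 v : deg1 G v = deg1 F v + deg1 (G :\: F) v := cntD _ FG.
have D2 v : deg2 F v = deg2 M v + deg2 (F :\: M) v := cntD _ MF.
have -> : G = M :|: (G :\: F) :|: (F :\: M).
  by rewrite setUAC setD_union // setD_union.
have -> : k = k.-1.+1 by rewrite prednK.
apply: (glue_bistars esym (c := c)).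
- by rewrite setUAC !setD_union.
- by rewrite setUAC !setD_union.
- exact: disj_sub MF (subxx _) (disjD _ _).
- apply/disjP => x; rewrite !inE => /orP [->//|/andP [/negbTE -> _]]; by rewrite andbF.
- move=> v; have [b [hG hF]] := a v; have := D1 v; have := M1 v.
  rewrite mul1n hF hG => /eqP; rewrite eqn_pmul2l // => /eqP ->.
  rewrite mulnBl -mulnA mul2n -addnn mul1n -subn1 mulnBl mul1n; clear -k0; nia.
- move=> v; have := D2 v; have := M2 v; rewrite mul1n => <-.
  rewrite -subn1 mulnBl mul1n; clear -k0; nia.
Qed.

(** A vertex of degree 2ma on the first side becomes the end of degree l in a bistars and the end of
    degree k in another a. The first kind takes its centres and second-end leaf edges from [F1],
    with k/(k + l) of the degrees of [F], and the second kind from the rest of [F]. The (l - 1)a +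
    (k - 1)a edges outside [F] are the leaf edges at first ends. *)
Lemma factor_suffices_off k l : 0 < k -> 0 < l -> factor_suffices k l (2 * (k + l - 1)) (k + l).
Proof.
move=> k0 l0 c G F sG iG FG UG FGd F2.
set m := k + l - 1 in UG FGd *; have Em : k + l = m.+1 by lia.
have m0 : 0 < 2 * m by lia.
have a v : exists a, deg1 G v = 2 * m * a /\ deg1 F v = (k + l) * a.
  have /dvdnP [a ea] := UG v; exists a; split; first by rewrite ea mulnC.
  have := FGd v; rewrite ea [LHS]mulnC [RHS]mulnA => /eqP.
  by rewrite eqn_pmul2r // => /eqP.
have [|||F1 F1F [F11 F12]] := @pair_factor F (k + l) k.
- exact: leq_addr.
- by move=> v; have [b [_ h]] := a v; rewrite h dvdn_mulr.
- exact: F2.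
have kl0 : 0 < k + l by rewrite addn_gt0 k0.
have F11' v b : deg1 F v = (k + l) * b -> deg1 F1 v = k * b.
  move=> h; have := F11 v; rewrite h mulnCA => /eqP.
  by rewrite eqn_pmul2l // => /eqP.
have F12' v b : deg2 F v = (k + l) * b -> deg2 F1 v = k * b.
  move=> h; have := F12 v; rewrite h mulnCA => /eqP.
  by rewrite eqn_pmul2l // => /eqP.
have b v : exists b, deg2 F v = (k + l) * b.
  by have /dvdnP [b eb] := F2 v; exists b; rewrite eb mulnC.
have DG v : deg1 G v = deg1 F v + deg1 (G :\: F) v := cntD _ FG.
have DF1 v : deg1 F v = deg1 F1 v + deg1 (F :\: F1) v := cntD _ F1F.
have DF2 v : deg2 F v = deg2 F1 v + deg2 (F :\: F1) v := cntD _ F1F.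
have [||M1 M1F [M11 M12]] := @pair_factor F1 k 1 k0.
- by move=> v; have [x [_ h]] := a v; rewrite (F11' _ _ h) dvdn_mulr.
- by move=> v; have [x h] := b v; rewrite (F12' _ _ h) dvdn_mulr.
have [||M2 M2F [M21 M22]] := @pair_factor (F :\: F1) l 1 l0.
- move=> v; have [x [_ h]] := a v; have := DF1 v; rewrite h (F11' _ _ h) mulnDl => /addnI.
  by move=> <-; rewrite dvdn_mulr.
- move=> v; have [x h] := b v; have := DF2 v; rewrite h (F12' _ _ h) mulnDl => /addnI.
  by move=> <-; rewrite dvdn_mulr.
have [|L1 L1L hL1] := @choose_deg1 (G :\: F) (fun v => (l - 1) * deg1 M1 v).
  move=> v; have [x [hG hF]] := a v.
  have := M11 v; rewrite mul1n (F11' _ _ hF) => /eqP; rewrite eqn_pmul2l // => /eqP ->.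
  by have := DG v; rewrite hG hF /m; clear -k0 l0; nia.
have DL v : deg1 (G :\: F) v = deg1 L1 v + deg1 ((G :\: F) :\: L1) v := cntD _ L1L.
have DM1 v : deg2 F1 v = deg2 M1 v + deg2 (F1 :\: M1) v := cntD _ M1F.
have DM2 v : deg2 (F :\: F1) v = deg2 M2 v + deg2 ((F :\: F1) :\: M2) v := cntD _ M2F.
have S1 : (M1 :|: L1) :|: (F1 :\: M1) = F1 :|: L1 by rewrite setUAC setD_union.
have S2 : (M2 :|: ((G :\: F) :\: L1)) :|: ((F :\: F1) :\: M2) = (F :\: F1) :|: ((G :\: F) :\: L1).
  by rewrite setUAC setD_union.
have EG : (F1 :|: L1) :|: ((F :\: F1) :|: ((G :\: F) :\: L1)) = G.
  by rewrite setUACA setD_union // setD_union // setD_union.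
have sub1 : F1 :|: L1 \subset G by rewrite subUset (subset_trans F1F FG) (subset_trans L1L (subsetDl _ _)).
have sub2 : (F :\: F1) :|: ((G :\: F) :\: L1) \subset G by rewrite subUset !(subset_trans (subsetDl _ _)) ?subsetDl.
have dFL : [disjoint F & G :\: F] := disjD _ _.
have dA : [disjoint F1 :|: L1 & (F :\: F1) :|: ((G :\: F) :\: L1)].
  apply/disjP => x; rewrite !inE => /orP [xF1|xL1].
    by rewrite xF1 (subsetP F1F _ xF1) /= andbF.
  by have := subsetP L1L x xL1; rewrite !inE xL1 => /andP [/negbTE -> _]; rewrite andbF.
rewrite -EG; apply: (@decomposableU _ _ _ _ c) => //; first by rewrite EG.
  apply: decomposable_sym => //; rewrite -S1.
  have -> : l = l.-1.+1 by rewrite prednK.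
  have -> : k = k.-1.+1 by rewrite prednK.
  apply: (glue_bistars esym (c := c)).
  - by rewrite S1; exact: sided_sub sG.
  - by rewrite S1; exact: inside_sub iG.
  - exact: disj_sub (subset_trans M1F F1F) L1L dFL.
  - apply/disjP => x; rewrite !inE => /orP [->//|xL1].
    have := subsetP L1L x xL1; rewrite inE => /andP [xF _].
    by apply: contra xF => /andP [_]; exact: (subsetP F1F).
  - by move=> v; rewrite -subn1; exact: hL1.
  - move=> v; have := DM1 v; have := M12 v; rewrite mul1n => <-.
    rewrite -subn1 mulnBl mul1n; clear -k0; nia.
rewrite -S2.
have -> : l = l.-1.+1 by rewrite prednK.
have -> : k = k.-1.+1 by rewrite prednK.
have sD : F :\: F1 \subset F := subsetDl _ _.
apply: (glue_bistars esym (c := c)).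
- by rewrite S2; exact: sided_sub sG.
- by rewrite S2; exact: inside_sub iG.
- exact: disj_sub (subset_trans M2F sD) (subsetDl _ _) dFL.
- apply/disjP => x; rewrite !inE => /orP [->//|/and3P [_ /negbTE -> _]]; by rewrite !andbF.
- move=> v; have [x [hG hF]] := a v.
  have e1 := F11' _ _ hF; have e2 := DF1 v; have e3 := DG v; have e4 := DL v.
  have := M11 v; rewrite mul1n e1 => /eqP; rewrite eqn_pmul2l // => /eqP e5.
  have := M21 v; rewrite mul1n.
  have -> : deg1 (F :\: F1) v = l * x by move: e2; rewrite hF e1 mulnDl => /addnI.
  move=> /eqP; rewrite eqn_pmul2l // => /eqP ->.
  have := hL1 v; rewrite e5 => e6.
  move: e3 e4; rewrite e6 hG hF /m -subn1; clear -k0 l0; nia.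
- move=> v; have := DM2 v; have := M22 v; rewrite mul1n => <-.
  rewrite -subn1 mulnBl mul1n; clear -l0; nia.
Qed.

Lemma edge_cutC R (A : {set V}) : edge_cut R (~: A) = edge_cut R A.
Proof. by apply: eq_cnt => p _; rewrite !inE; case: (p.1 \in A); case: (p.2 \in A). Qed.

(** The cut form of n-edge-connectivity for the spanning graph with edge set [R]. *)
Definition spread n R := forall A : {set V}, A != set0 -> A != setT -> n <= edge_cut R A.

(* F consists of Q and the edges of R that are oriented away from their second end,
   where the orientation of R modulo f corrects the degrees of Q on that side. *)
Lemma half_factor c U f G R : 1 < f -> f <= U -> U <= 2 * f -> sided c G -> R \subset G ->
  (forall v, U %| deg1 G v) -> (forall v, ~~ odd (deg1 R v)) -> spread (3 * f - 2) R ->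
  (forall v, U * deg1 R v <= 2 * (U - f) * deg1 G v) ->
  exists F, [/\ F \subset G, forall v, U * deg1 F v = f * deg1 G v & forall v, f %| deg2 F v].
Proof.
move=> f1 fU Uf sG RG UG ev cutR hd.
have f0 : 0 < f by exact: ltnW.
have U0 : 0 < U by exact: leq_trans fU.
pose a v := deg1 G v %/ U.
have Ga v : deg1 G v = U * a v by rewrite mulnC divnK.
pose h v := (deg1 R v)./2.
have Rh v : deg1 R v = (h v).*2 by have := odd_double_half (deg1 R v); rewrite (negbTE (ev v)).
(* With degree 2h in [R] there remain Ua - 2h edges outside [R], and fa - h of them are needed for
   [Q]; this inequality is what is required. *)
have hle v : h v <= (U - f) * a v.
  have := hd v; rewrite Ga Rh -mul2n; rewrite mulnCA -mulnA leq_pmul2l // mulnCA leq_pmul2l //.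
have D1 v : deg1 G v = deg1 R v + deg1 (G :\: R) v := cntD _ RG.
have [|Q QG hQ] := @choose_deg1 (G :\: R) (fun v => f * a v - h v).
  move=> v; have := D1 v; rewrite Ga Rh.
  have := hle v; rewrite mulnBl; have : f * a v <= U * a v by rewrite leq_mul2r fU orbT.
  by rewrite -addnn; clear; lia.
have hfa v : h v <= f * a v.
  apply: leq_trans (hle v) _; rewrite leq_mul2r; apply/orP; right; lia.
have Q1 v : deg1 Q v + h v = f * a v by rewrite hQ subnK.
pose Y := [set v | ~~ c v].
have sR := sided_sub RG sG.
have sQ : sided c Q by apply: sided_sub sG; apply: subset_trans QG (subsetDl _ _).
(* The factor [f.-1] stands for -1 modulo [f]: the edges of [R] directed out of a second end have to
   complete the degree of [Q] there to a multiple of [f]. *)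
have [||||F FR [F1 F2]] := @mod_orientation V f c R Y (fun v => deg2 Q v * f.-1) f1 sR.
- move=> A dA sA; apply: cutR; first by apply: contraNneq dA => ->; rewrite -setI_eq0 setI0.
  by apply: contraNneq sA => ->; rewrite subsetT.
- by move=> v; rewrite inE negbK.
- by move=> v _; exact: ev.
- have E1 : \sum_v (if v \in Y then deg2 Q v * f.-1 else (deg1 R v)./2) = \sum_v (deg2 Q v * f.-1 + h v).
    apply: eq_bigr => v _; rewrite inE; case: (boolP (c v)) => cv /=.
      by rewrite (deg2_side sQ cv) mul0n.
    by rewrite /h (deg1_side sR cv) addn0.
  have E2 : \sum_v deg1 Q v + \sum_v h v = f * \sum_v a v.
    by rewrite -big_split big_distrr; apply: eq_bigr => v _; exact: Q1.
  have E3 : #|R| = (\sum_v h v).*2.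
    by rewrite -sum_deg1 -mul2n big_distrr; apply: eq_bigr => v _; rewrite Rh -mul2n.
  rewrite E1 big_split -big_distrl /= sum_deg2 E3; move: E2; rewrite sum_deg1.
  move: (#|Q|) (\sum_v h v) (\sum_v a v) => q s t E2.
  have -> : (Posz (q * f.-1 + s) - Posz s.*2 = Posz f * (Posz (f.-1 * t) - Posz s))%R.
    rewrite -[f in RHS]prednK //; move: E2; rewrite -{1}[f]prednK //; move: f.-1 => g E2.
    by rewrite /=; move: E2; clear; nia.
  exact: dvdz_mulr.
- exists (Q :|: (R :\: F)); have dQ : [disjoint Q & R :\: F].
    apply/disjP => x /(subsetP QG); rewrite !inE => /andP [/negbTE -> _]; by rewrite andbF.
  have DR v : deg1 R v = deg1 F v + deg1 (R :\: F) v := cntD _ FR.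
  split.
  + rewrite subUset (subset_trans QG) ?subsetDl //=; apply: subset_trans RG; exact: subsetDl.
  + move=> v; rewrite /deg1 cntU // -!/(deg1 _ v) Ga mulnCA; congr (_ * _).
    rewrite -(Q1 v); congr (_ + _); have := DR v; have := boolP (c v) => -[cv|cv].
      by rewrite F2 ?inE ?cv // -/(h v) Rh -addnn => /addnI.
    by rewrite !(deg1_side _ cv) // /h ?(deg1_side _ cv) //; apply: sided_sub sR; rewrite ?subsetDl.
  + move=> v; rewrite /deg2 cntU // -!/(deg2 _ v); have [cv|cv] := boolP (c v).
      rewrite !(deg2_side _ cv) //; apply: sided_sub sR; exact: subsetDl.
    have := F1 v; rewrite inE cv (deg1_side (sided_sub FR sR) cv) add0n => /(_ isT) d.
    have : (Posz f %| Posz (deg2 Q v + deg2 (R :\: F) v))%Z.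
      have -> : (Posz (deg2 Q v + deg2 (R :\: F) v) = (Posz (deg2 (R :\: F) v) - Posz (deg2 Q v * f.-1)) + Posz (deg2 Q v * f))%R.
        by rewrite -[f in RHS]prednK // mulnS; lia.
      by apply: rpredD => //; rewrite PoszM dvdz_mull.
    by [].
Qed.

Lemma spreadU n R X : spread n R -> spread n (R :|: X).
Proof. by move=> h A A0 A1; apply: leq_trans (h A A0 A1) (cnt_mono _ _); exact: subsetUl. Qed.

(** Exact bisection needs even degrees in [R] on the first side, so one edge of [S] is moved to [R]
    at each odd vertex. This edge accounts for the successor in the last hypothesis. *)
Lemma side_decomposable k l U f c R S W : factor_suffices k l U f -> 1 < f -> f <= U -> U <= 2 * f ->
  sided c (R :|: S :|: W) -> inside (R :|: S :|: W) -> [disjoint R & S] -> [disjoint R :|: S & W] ->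
  (forall v, U %| deg1 (R :|: S :|: W) v) -> spread (3 * f - 2) R ->
  (forall v, c v -> 0 < deg1 S v) ->
  (forall v, c v -> U * (deg1 R v).+1 <= 2 * (U - f) * (deg1 R v + deg1 S v)) ->
  decomposable e k l (R :|: S :|: W).
Proof.
move=> gad f1 fU Uf s i dRS dW UG cR S0 hd.
have sR : sided c R by apply: sided_sub s; rewrite -setUA subsetUl.
have [X XS hX] : exists2 X : {set V * V}, X \subset S & forall v, deg1 X v = odd (deg1 R v).
  apply: choose_deg1 => v; have [cv|cv] := boolP (c v).
    by apply: leq_trans (leq_b1 _) (S0 v cv).
  by rewrite (deg1_side sR cv).
have dRX : [disjoint R & X] by exact: disj_sub dRS.
have ER v : deg1 (R :|: X) v = deg1 R v + odd (deg1 R v) by rewrite -hX; exact: cntU.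
have [|||||F [FG FU F2]] := @half_factor c U f (R :|: S :|: W) (R :|: X) f1 fU Uf s.
- by apply: subset_trans (subsetUl _ _); apply: setUS.
- exact: UG.
- by move=> v; rewrite ER oddD oddb addbb.
- exact: spreadU.
- move=> v; rewrite ER; have [cv|cv] := boolP (c v); last by rewrite (deg1_side sR cv) muln0.
  apply: leq_trans (_ : U * (deg1 R v).+1 <= _).
    by rewrite leq_mul2l -addn1 leq_add2l leq_b1 orbT.
  apply: leq_trans (hd v cv) _; rewrite leq_mul2l; apply/orP; right.
  by rewrite /deg1 -(cntU _ dRS); apply: cnt_mono; exact: subsetUl.
by apply: (gad c _ F).
Qed.

Definition pair_swap (p : V * V) := (p.2, p.1).
(** In the second part of the graph the heads lie on the other side; exchanging the sides reduces it
    to the first part. *)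
Definition swap E := [set p | pair_swap p \in E].

Lemma pair_swapK : involutive pair_swap. Proof. by case. Qed.

Lemma swapE E : swap E = pair_swap @: E.
Proof.
apply/setP => p; rewrite inE; apply/idP/imsetP => [h|[q qE ->]]; last by rewrite pair_swapK.
by exists (pair_swap p); rewrite ?pair_swapK.
Qed.

Lemma cnt_swap (P : pred (V * V)) E : cnt P (swap E) = cnt (fun p => P (pair_swap p)) E.
Proof.
by rewrite !cntE swapE big_imset //= => p q _ _; apply: (inv_inj pair_swapK).
Qed.

Lemma deg1_swap E v : deg1 (swap E) v = deg2 E v. Proof. exact: cnt_swap. Qed.

Lemma spread_swap n E : spread n E -> spread n (swap E).
Proof.
move=> h A A0 A1; rewrite /edge_cut cnt_swap; apply: leq_trans (h A A0 A1) _.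
by rewrite /edge_cut (@eq_cnt _ _ (fun p => (p.2 \in A) (+) (p.1 \in A))) // => p _; rewrite addbC.
Qed.

Lemma swapU A B : swap (A :|: B) = swap A :|: swap B.
Proof. by apply/setP => p; rewrite !inE. Qed.

Lemma disj_swap A B : [disjoint A & B] -> [disjoint swap A & swap B].
Proof. by move=> /disjP d; apply/disjP => p; rewrite !inE; exact: d. Qed.

Lemma und_swap E : und (swap E) = und E.
Proof. by rewrite /und swapE -imset_comp; apply: eq_imset => p; rewrite /= /ends setUC. Qed.

Lemma decomposable_swap k l E : decomposable e k l (swap E) -> decomposable e k l E.
Proof. by case=> P [pP bP]; exists P; rewrite -und_swap. Qed.

Lemma sided_swap c E : sided c E -> sided (predC c) (swap E).
Proof. by move=> s p; rewrite inE => /s /= /andP [-> ->]. Qed.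

Lemma inside_swap E : inside E -> inside (swap E).
Proof. by move=> s p; rewrite inE esym => /s. Qed.

End Assembly.

(** * Splitting the graph into two parts *)

Section Combination.
Variables (V : finType) (e : rel V).
Hypothesis esym : symmetric e.
Implicit Types (E F G R S C L B W X : {set V * V}) (c : pred V) (A : {set V}).

Section Pieces.
Variables (c : pred V) (E : {set V * V}) (hd : V * V -> V) (z : V).
Hypothesis sE : sided c E.
Hypothesis hdE : forall p, p \in E -> hd p = p.1 \/ hd p = p.2.

Definition tl (p : V * V) := if hd p == p.1 then p.2 else p.1.

Lemma sided_neq p : p \in E -> p.1 != p.2.
Proof. by move=> /sE /andP [h1 h2]; apply: contraNneq h2 => <-. Qed.

Lemma cutinE X A : X \subset E ->
  cutin hd tl X A = cnt (fun p => (hd p \in A) && ~~ ((p.1 \in A) && (p.2 \in A))) X.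
Proof.
move=> XE; apply: eq_cnt => p pX; have pE := subsetP XE p pX; rewrite /tl.
case: eqP => [->|n1]; first by case: (p.1 \in A).
by have [|->] := hdE pE; [ | case: (p.2 \in A); rewrite ?andbF ?andbT].
Qed.

(** Edge cuts are symmetric, so a set that contains the root is replaced by its complement. *)
Lemma spread_cutin n X : X \subset E -> (forall A, rootless z A -> n <= cutin hd tl X A) -> spread n X.
Proof.
move=> XE h A A0 A1.
have le (B : {set V}) : rootless z B -> n <= edge_cut X B.
  move=> oB; apply: leq_trans (h B oB) _; rewrite cutinE // /edge_cut !cntE; apply: leq_sum => p pX.
  by have [->|->] := hdE (subsetP XE p pX); case: (p.1 \in B); case: (p.2 \in B).
have [zA|zA] := boolP (z \in A); last by apply: le; rewrite /rootless A0.
rewrite -edge_cutC; apply: le; rewrite /rootless inE zA andbT.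
by apply: contra A1 => /eqP h0; rewrite -[A]setCK h0 setC0.
Qed.

(** An edge of [R] at [v] has its head at [v] or is one of the out-edges of [v] in [E]. Combined
    with the in-degree bound this limits the degree in [R] to roughly half of the degree in [E],
    plus the in-degree of [R]. *)
Lemma touch_out (P : pred (V * V)) R v : R \subset E ->
  (forall p, P p -> (p.1 == v) || (p.2 == v)) ->
  cnt P R + indeg hd E v <= indeg hd R v + deg E v.
Proof.
move=> RE hP.
have E1 : indeg hd E v + cnt (fun p => ((p.1 == v) || (p.2 == v)) && (hd p != v)) E = deg E v.
  rewrite /indeg /deg !cntE -big_split /=; apply: eq_bigr => p pE.
  by have [->|->] := hdE pE; case: (p.1 == v); case: (p.2 == v).
have E2 : cnt P R <= indeg hd R v + cnt (fun p => ((p.1 == v) || (p.2 == v)) && (hd p != v)) R.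
  rewrite /indeg !cntE -big_split /=; apply: leq_sum => p _.
  by case Pp: (P p) => //; rewrite (hP p Pp); case: (hd p == v).
have := cnt_mono (fun p => ((p.1 == v) || (p.2 == v)) && (hd p != v)) RE.
by move: E1 E2; clear; lia.
Qed.

Lemma indeg_deg1 X v : X \subset E -> c v -> indeg hd X v = deg1 [set p in X | hd p == p.1] v.
Proof.
move=> XE cv; apply: eq_card => p; rewrite !inE; case pX: (p \in X) => //=.
have pE := subsetP XE p pX; have /andP [_ c2] := sE pE.
have n2 : p.2 == v = false by apply: contraNF c2 => /eqP ->.
have [->|h] := hdE pE; first by rewrite eqxx.
by rewrite h n2 eq_sym (negbTE (sided_neq pE)).
Qed.

Lemma indeg_deg2 X v : X \subset E -> ~~ c v -> indeg hd X v = deg2 [set p in X | hd p != p.1] v.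
Proof.
move=> XE cv; apply: eq_card => p; rewrite !inE; case pX: (p \in X) => //=.
have pE := subsetP XE p pX; have /andP [c1 _] := sE pE.
have n1 : p.1 == v = false by apply: contraNF cv => /eqP <-.
have [h|h] := hdE pE; first by rewrite h n1 eqxx.
by rewrite h [p.2 == p.1]eq_sym (sided_neq pE).
Qed.

End Pieces.

Lemma spread_deg c E r : sided c E -> spread r E -> E != set0 -> forall v, r <= deg E v.
Proof.
move=> sE cE /set0Pn [p0 p0E] v.
have -> : deg E v = edge_cut E [set v].
  apply: eq_cnt => p pE; rewrite !inE; have := sided_neq sE pE.
  by case: (eqVneq p.1 v) => [<-|_]; rewrite //= eq_sym => /negbTE ->.
apply: cE; first by apply/set0Pn; exists v; rewrite inE.
apply/eqP => /setP h; have := sided_neq sE p0E.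
by have := h p0.1; have := h p0.2; rewrite !inE => /eqP -> /eqP ->; rewrite eqxx.
Qed.

Lemma deg_le E v : deg E v <= deg1 E v + deg2 E v.
Proof.
rewrite /deg /deg1 /deg2 !cntE -big_split /=; apply: leq_sum => p _.
by case: (p.1 == v); case: (p.2 == v).
Qed.

(** [T] is the in-degree that [W], [R1] and [R2] may use at a vertex: 3U - 2 for the orientation
    modulo [U], and 3f - 2 for each of the two modulo [f]. In the last hypothesis d is the degree of
    a vertex in [E], dR its degree in the set [R1] or [R2] of its side, and dS the number of
    remaining edges with their head there; the premises are what the balanced orientation
    guarantees. *)
Lemma main_decomposable k l U f c E r : factor_suffices e k l U f -> 1 < f -> f <= U -> U <= 2 * f ->
  sided c E -> inside e E -> U %| #|E| -> spread r E ->
  let T := 3 * U - 2 + 2 * (3 * f - 2) in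
  T < r./2 ->
  (forall d dR dS, r <= d -> dR + d./2 <= 3 * f - 2 + d -> d./2 <= dS + T ->
     U * dR.+1 <= 2 * (U - f) * (dR + dS)) ->
  decomposable e k l E.
Proof.
move=> gad f1 fU Uf sE iE dE cE T hT hnum.
have [->|[p0 p0E]] := set_0Vmem E; first exact: decomposable0.
have U1 : 1 < U by exact: leq_trans fU.
pose z := p0.1.
have degE : forall v, r <= deg E v by apply: spread_deg sE cE _; apply/set0Pn; exists p0.
have [||hd [hdE hdeg hcut]] := @balanced_orientation V E z r./2.
- by move=> p; exact: (sided_neq sE).
- move=> A /andP [A0 zA]; apply: leq_trans (cE A A0 _).
    by have := odd_double_half r; lia.
  by apply: contraNneq zA => ->; rewrite inE.
pose t := tl hd.
have cut0 A : rootless z A -> r./2 <= cutin hd t E A.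
  by move=> oA; rewrite (cutinE hdE) //; exact: hcut.
have [A oA|W [WE cW iW rW]] := @branching_packing _ _ hd t z (3 * U - 2) E (2 * (3 * f - 2)).
  by apply: leq_trans (cut0 A oA); rewrite addnC ltnW.
have [A oA|R1 [R1E cR1 iR1 rR1]] := @branching_packing _ _ hd t z (3 * f - 2) (E :\: W) (3 * f - 2).
  by apply: leq_trans (rW A oA); rewrite mul2n -addnn.
have [A oA|R2 [R2E cR2 iR2 _]] := @branching_packing _ _ hd t z (3 * f - 2) ((E :\: W) :\: R1) 0.
  exact: rR1.
pose S := ((E :\: W) :\: R1) :\: R2.
pose S1 := [set p in S | hd p == p.1].
pose S2 := [set p in S | hd p != p.1].
have R1E' : R1 \subset E by apply: subset_trans R1E (subsetDl _ _).
have R2E' : R2 \subset E by apply: subset_trans R2E _; rewrite !(subset_trans (subsetDl _ _)).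
have SE : S \subset E by rewrite !(subset_trans (subsetDl _ _)).
have iE4 P : cnt P E = cnt P W + cnt P R1 + cnt P R2 + cnt P S.
  by rewrite (cntD P WE) (cntD P R1E) (cntD P R2E) !addnA.
have iSdeg v : (deg E v)./2 <= indeg hd S v + T.
  apply: leq_trans (hdeg v) _; rewrite /indeg iE4 -!/(indeg hd _ v) /T.
  by move: (iW v) (iR1 v) (iR2 v); clear; lia.
have rdeg v : r./2 <= (deg E v)./2 by apply: half_leq.
have sR1 := sided_sub R1E' sE; have sR2 := sided_sub R2E' sE; have sW := sided_sub WE sE.
have S1S : S1 \subset S by apply/subsetP => p; rewrite inE => /andP [].
have S2S : S2 \subset S by apply/subsetP => p; rewrite inE => /andP [].
have sS1 := sided_sub S1S (sided_sub SE sE); have sS2 := sided_sub S2S (sided_sub SE sE).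
have inS p : p \in S -> [/\ p \notin W, p \notin R1 & p \notin R2].
  by rewrite !inE => /and4P [-> -> -> _].
have inR1 p : p \in R1 -> p \notin W by move/(subsetP R1E); rewrite inE => /andP [].
have inR2 p : p \in R2 -> p \notin W /\ p \notin R1.
  by move/(subsetP R2E); rewrite !inE => /and3P [-> -> _].
(* Here [U.-1] stands for -1 modulo [U]: the edges of [W] directed out of [v] have to cancel the
   degree which [v] already has in the part of its side. *)
pose al v := (deg1 R1 v + deg1 S1 v + deg2 R2 v + deg2 S2 v) * U.-1.
have cards : #|E| = #|W| + (#|R1| + #|S1| + #|R2| + #|S2|).
  have cc X : #|X| = cnt predT X by rewrite cnt_all.
  have SS : #|S| = #|S1| + #|S2|.
    rewrite (cc S) (cntD _ S1S) -!cc; congr (_ + _); apply: eq_card => p; rewrite !inE.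
    by case: (hd p == p.1); case: (p \in R2); case: (p \in R1); case: (p \in W); case: (p \in E).
  by rewrite (cc E) iE4 -!cc SS -!addnA; congr (_ + (_ + _)); rewrite addnCA.
have spW := spread_cutin hdE WE cW.
have [||||F FW [hF _]] := @mod_orientation V U c W setT al U1 sW.
- move=> A dA sA; apply: spW; first by apply: contraNneq dA => ->; rewrite -setI_eq0 setI0.
  by apply: contraNneq sA => ->.
- by move=> v; rewrite inE.
- by move=> v; rewrite inE.
(* With d edges outside [W] the sum in question is d(U - 1) - |W| = dU - |E|; this uses that [U]
   divides |E|. *)
- rewrite (eq_bigr al) => [|v _]; last by rewrite inE.
  rewrite -big_distrl /= !big_split /= !sum_deg1 !sum_deg2.
  move: cards dE; set d := #|R1| + #|S1| + #|R2| + #|S2| => ca /dvdnP [q hq].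
  apply/dvdzP; exists (Posz d - Posz q)%R.
  move: ca hq U1; move: d #|E| #|W| => d a b; clear.
  by case: U => [//|u] -> h _ /=; rewrite mulrBl -!PoszM -h mulnS; clear; lia.
have DW P : cnt P W = cnt P F + cnt P (W :\: F) := cntD P FW.
have hF1 v : c v -> U %| deg1 R1 v + deg1 S1 v + deg1 F v.
  move=> cv; have := hF v; rewrite inE /al (deg2_side sR2 cv) (deg2_side sS2 cv).
  rewrite (deg2_side (sided_sub (subsetDl W F) sW) cv) !addn0 => /(_ isT) /dvdzP [q hq].
  suff : (Posz U %| Posz (deg1 R1 v + deg1 S1 v + deg1 F v))%Z by [].
  apply/dvdzP; exists (q + Posz (deg1 R1 v + deg1 S1 v))%R.
  move: hq; move: (deg1 R1 v + deg1 S1 v) (deg1 F v) => a b.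
  by rewrite -[U]prednK ?(ltnW U1) //; move: U.-1 => u /=; clear; nia.
have hF2 v : ~~ c v -> U %| deg2 R2 v + deg2 S2 v + deg2 (W :\: F) v.
  move=> cv; have := hF v; rewrite inE /al (deg1_side sR1 cv) (deg1_side sS1 cv).
  rewrite (deg1_side (sided_sub FW sW) cv) !add0n => /(_ isT) /dvdzP [q hq].
  suff : (Posz U %| Posz (deg2 R2 v + deg2 S2 v + deg2 (W :\: F) v))%Z by [].
  apply/dvdzP; exists (q + Posz (deg2 R2 v + deg2 S2 v))%R.
  move: hq; move: (deg2 R2 v + deg2 S2 v) (deg2 (W :\: F) v) => a b.
  by rewrite -[U]prednK ?(ltnW U1) //; move: U.-1 => u /=; clear; nia.
(* An edge of [W] joins the part that belongs to the side it is directed out of. *)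
have EE : E = (R1 :|: S1 :|: F) :|: (R2 :|: S2 :|: (W :\: F)).
  apply/setP => p; rewrite !in_setU !inE.
  case: (boolP (p \in R1)) => [/(subsetP R1E') -> //|h1].
  case: (boolP (p \in R2)) => [/(subsetP R2E') -> //|h2]; first by rewrite !orbT.
  case: (boolP (p \in F)) => [/(subsetP FW) pW|h3] /=.
    by rewrite (subsetP WE p pW) !orbT.
  case: (boolP (p \in W)) => [/(subsetP WE) ->|h4] /=; first by rewrite ?andbF ?orbT //; case: (_ == _).
  by case: (hd p == p.1); case: (p \in E).
have G1E : R1 :|: S1 :|: F \subset E by apply/subsetP => p pG; rewrite EE in_setU pG.
have G2E : R2 :|: S2 :|: (W :\: F) \subset E by apply/subsetP => p pG; rewrite EE in_setU pG orbT.
have d11 : [disjoint R1 & S1].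
  by apply/disjP => p pR; apply/negP => /(subsetP S1S) /inS [_]; rewrite pR.
have d12 : [disjoint R1 :|: S1 & F].
  apply/disjP => p; rewrite inE => h; apply/negP => /(subsetP FW) pW; case/orP: h => [/inR1|/(subsetP S1S) /inS []]; by rewrite pW.
have d21 : [disjoint R2 & S2].
  by apply/disjP => p pR; apply/negP => /(subsetP S2S) /inS [_ _]; rewrite pR.
have d22 : [disjoint R2 :|: S2 & W :\: F].
  apply/disjP => p; rewrite inE => h; apply/negP; rewrite inE => /andP [_ pW].
  case/orP: h => [/inR2 []|/(subsetP S2S) /inS []]; by rewrite pW.
have dG : [disjoint R1 :|: S1 :|: F & R2 :|: S2 :|: (W :\: F)].
  apply/disjP => p; rewrite !in_setU => h; apply/negP; move: h.
  case/orP => [/orP [pR1|pS1]|pF].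
  - case/orP => [/orP [/inR2 []|/(subsetP S2S) /inS []]|]; rewrite ?pR1 //.
    by rewrite inE (negbTE (inR1 _ pR1)) andbF.
  - have [n1 n2 n3] := inS _ (subsetP S1S _ pS1).
    by rewrite (negbTE n3) !inE (negbTE n1) andbF orbF /=; move: pS1; rewrite inE => /andP [_ ->]; rewrite andbF.
  - have pW := subsetP FW _ pF; case/orP => [/orP [/inR2 []|/(subsetP S2S) /inS []]|]; rewrite ?pW //.
    by rewrite inE pF.
have num v R Sx (P : pred (V * V)) : R \subset E -> (forall p, P p -> (p.1 == v) || (p.2 == v)) ->
    indeg hd R v <= 3 * f - 2 -> (deg E v)./2 <= Sx + T ->
    0 < Sx /\ U * (cnt P R).+1 <= 2 * (U - f) * (cnt P R + Sx).
  move=> RE hP iR hS; split; first by move: hS (rdeg v) hT; clear; lia.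
  apply: (hnum (deg E v)) => //; have := touch_out hdE RE hP.
  by move: (hdeg v) iR; clear; lia.
rewrite EE; apply: (@decomposableU _ _ _ _ c); rewrite -?EE //.
  have num1 v : c v -> 0 < deg1 S1 v /\ U * (deg1 R1 v).+1 <= 2 * (U - f) * (deg1 R1 v + deg1 S1 v).
    move=> cv; apply: (num v R1 (deg1 S1 v) (fun p => p.1 == v)) => // [p ->//|]; rewrite -(indeg_deg1 sE hdE) //; exact: iSdeg.
  apply: (side_decomposable gad f1 fU Uf (c := c)) => //.
  - exact: sided_sub sE.
  - exact: inside_sub iE.
  - move=> v; rewrite /deg1 !cntU // -!/(deg1 _ v); have [cv|cv] := boolP (c v); first exact: hF1.
    by rewrite (deg1_side sR1 cv) (deg1_side sS1 cv) (deg1_side (sided_sub FW sW) cv) dvdn0.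
  - exact: (spread_cutin hdE _ cR1).
  - by move=> v /num1 [].
  - by move=> v /num1 [].
have num2 v : ~~ c v -> 0 < deg2 S2 v /\ U * (deg2 R2 v).+1 <= 2 * (U - f) * (deg2 R2 v + deg2 S2 v).
  move=> cv; apply: (num v R2 (deg2 S2 v) (fun p => p.2 == v)) => // [p ->|]; first by rewrite orbT.
  rewrite -(indeg_deg2 sE hdE) //; exact: iSdeg.
apply: decomposable_swap; rewrite !swapU.
apply: (side_decomposable gad f1 fU Uf (c := predC c)).
- by rewrite -!swapU; apply: sided_swap; exact: sided_sub sE.
- by rewrite -!swapU; apply: inside_swap => //; exact: inside_sub iE.
- exact: disj_swap.
- by rewrite -swapU; exact: disj_swap.
- move=> v; rewrite -!swapU deg1_swap /deg2 !cntU // -!/(deg2 _ v); have [cv|cv] := boolP (c v); last exact: hF2.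
  by rewrite (deg2_side sR2 cv) (deg2_side sS2 cv) (deg2_side (sided_sub (subsetDl _ _) sW) cv) dvdn0.
- by apply: spread_swap; exact: (spread_cutin hdE _ cR2).
- by move=> v /num2 []; rewrite deg1_swap.
- by move=> v /num2 []; rewrite !deg1_swap.
Qed.

End Combination.

(** * Translation from graphs and the numerical bounds *)

Section BipartiteGraph.
Variables (V : finType) (e : rel V) (c : pred V).
Hypothesis esym : symmetric e.
Hypothesis col : forall x y, e x y -> c x != c y.
Implicit Types (E A B : {set V * V}).

Definition arcs := [set p : V * V | [&& e p.1 p.2, c p.1 & ~~ c p.2]].

Lemma sided_arcs : sided c arcs.
Proof. by move=> p; rewrite inE => /and3P [_ -> ->]. Qed.

Lemma inside_arcs : inside e arcs.
Proof. by move=> p; rewrite inE => /and3P []. Qed.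

Lemma arcs_edge x y : e x y -> (x, y) \in arcs \/ (y, x) \in arcs.
Proof.
move=> exy; have := col exy; rewrite !inE /= [e y x]esym exy /=.
by case: (c x); case: (c y); auto.
Qed.

Lemma und_arcs : und arcs = edges e.
Proof.
apply/setP => x; apply/imsetP/imset2P => [[p]|[u v _]].
  by rewrite inE => /and3P [he _ _] ->; exists p.1 p.2; rewrite ?inE.
rewrite inE => /andP [_ euv] ->; have [h|h] := arcs_edge euv; first by exists (u, v).
by exists (v, u) => //; rewrite /ends setUC.
Qed.

Lemma card_arcs : #|arcs| = #|edges e|.
Proof. by rewrite -und_arcs card_in_imset //; exact: ends_inj sided_arcs. Qed.

(** A cut with fewer than [r] edges could be deleted, after which [A] would be closed under
    adjacency although the graph stays connected. *)
Lemma spread_arcs r : edge_connected r e -> spread r arcs.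
Proof.
move=> h A /set0Pn [a aA] nA; rewrite leqNgt; apply/negP => lt.
have [b bA] : exists b, b \notin A.
  by apply/existsP; rewrite -negb_forall; apply: contra nA => /forallP h'; apply/eqP/setP => x; rewrite h' inE.
pose X := [set p in arcs | (p.1 \in A) (+) (p.2 \in A)].
have XE : und X \subset edges e.
  by rewrite -und_arcs; apply: imsetS; apply/subsetP => p; rewrite inE => /andP [].
have cl : closed (del_edges e (und X)) (mem A).
  move=> x y /andP [exy nX]; apply/eqP; apply: contraNT nX => ne.
  have {}ne : (x \in A) != (y \in A) by exact: ne.
  have [hp|hp] := arcs_edge exy; apply/imsetP.
    by exists (x, y) => //; rewrite inE hp /=; move: ne; case: (x \in A); case: (y \in A).
  exists (y, x); last by rewrite /ends setUC.
  by rewrite inE hp /=; move: ne; case: (x \in A); case: (y \in A).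
have := closed_connect cl (h (und X) XE (leq_ltn_trans (leq_imset_card _ _) lt) a b).
by move: bA; rewrite -[a \in mem A]/(a \in A) -[b \in mem A]/(b \in A) aA => /negP nb h1; apply: nb; rewrite -h1.
Qed.

Lemma spread_sub n E A : A \subset E -> spread n E -> spread (n - #|A|) (E :\: A).
Proof.
move=> AE h X X0 X1; rewrite leq_subLR; apply: leq_trans (h X X0 X1) _.
rewrite /edge_cut (cntD _ AE) leq_add2r.
by apply: subset_leq_card; apply/subsetP => p; rewrite inE => /andP [].
Qed.

Lemma spread_weaken n n' E : n' <= n -> spread n E -> spread n' E.
Proof. by move=> le h A A0 A1; apply: leq_trans le (h A A0 A1). Qed.

(** Every degree is at least [n], so enough leaf edges can be chosen at both ends of any edge; the
    colouring keeps the two sets of leaves apart. *)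
Lemma exists_bistar k l n E : 0 < k -> 0 < l -> k <= n -> l <= n -> sided c E -> inside e E ->
  spread n E -> E != set0 ->
  exists2 B : {set V * V}, B \subset E & #|B| = k + l - 1 /\ decomposable e k l B.
Proof.
move=> k0 l0 kn ln sE iE cE E0; have /set0Pn [z zE] := E0.
have degE v := leq_trans (spread_deg sE cE E0 v) (deg_le E v).
have /andP [z1 z2] := sE _ zE.
have d1z : n <= deg1 E z.1 by have := degE z.1; rewrite (deg2_side sE z1) addn0.
have d2z : n <= deg2 E z.2 by have := degE z.2; rewrite (deg1_side sE z2).
have [A sA cA] : exists2 X : {set V * V}, X \subset [set a in E | a.1 == z.1] :\ z & #|X| = k.-1.
  apply: subset_card; have := cardsD1 z [set a in E | a.1 == z.1]; rewrite inE zE eqxx /=.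
  by move: d1z; rewrite /deg1 /cnt; move: #|_| #|_|; clear -k0 kn; lia.
have [B sB cB] : exists2 X : {set V * V}, X \subset [set a in E | a.2 == z.2] :\ z & #|X| = l.-1.
  apply: subset_card; have := cardsD1 z [set a in E | a.2 == z.2]; rewrite inE zE eqxx /=.
  by move: d2z; rewrite /deg2 /cnt; move: #|_| #|_|; clear -l0 ln; lia.
have hA a : a \in A -> [/\ a != z, a \in E & a.1 = z.1].
  by move/(subsetP sA); rewrite !inE => /and3P [? ? /eqP ?].
have hB a : a \in B -> [/\ a != z, a \in E & a.2 = z.2].
  by move/(subsetP sB); rewrite !inE => /and3P [? ? /eqP ?].
have zA : z \notin A by apply/negP => /hA []; rewrite eqxx.
have zB : z \notin B by apply/negP => /hB []; rewrite eqxx.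
have sub : z |: A :|: B \subset E.
  apply/subsetP => a; rewrite !inE => /orP [/orP [/eqP -> //|/hA [] //]|/hB [] //].
have dAB : [disjoint z |: A & B].
  apply/disjP => a; rewrite !inE => /orP [/eqP -> //|/hA [n1 _ e1]]; apply/negP => /hB [_ _ e2].
  by case/eqP: n1; rewrite [a]surjective_pairing e1 e2 -surjective_pairing.
exists (z |: A :|: B) => //; split.
  have := leq_card_setU (z |: A) B; rewrite dAB => /leqifP /eqP ->.
  by rewrite cardsU1 zA cA cB; move: k0 l0; clear; lia.
apply: bistar_decomposable; first by apply/set0Pn; exists z; rewrite !inE eqxx.
have -> : k = k.-1.+1 by rewrite prednK.
have -> : l = l.-1.+1 by rewrite prednK.
apply: (@bistar_und _ _ esym c) => //.
- exact: sided_sub sE.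
- exact: inside_sub iE.
- by move=> a /hA [].
- by move=> a /hB [].
Qed.

Lemma has_bistar_decomposition_arcs k l : decomposable e k l arcs -> has_bistar_decomposition k l e.
Proof. by rewrite /decomposable und_arcs. Qed.

End BipartiteGraph.

Lemma leq_ceil_div a b n : 0 < b -> n * b <= a + b.-1 -> n <= ceil_div a b.
Proof. by move=> b0; rewrite /ceil_div leq_divRL. Qed.

Lemma ceil_div_leq a b n : 0 < b -> a <= n * b -> ceil_div a b <= n.
Proof. by move=> b0 h; rewrite /ceil_div -ltnS ltn_divLR // mulSn; lia. Qed.

Lemma edge_connected_mono (V : finType) (e : rel V) r r' : r <= r' -> edge_connected r' e -> edge_connected r e.
Proof. by move=> le h F FE cF; apply: h => //; exact: leq_trans le. Qed.

Section Cases.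
Variables (V : finType) (e : rel V) (c : pred V).
Hypothesis esym : symmetric e.
Implicit Types (E A B : {set V * V}).

(** The connectivity [72 * k - 10] is the stated bound for k = l with the ceiling replaced by 5. *)
Lemma decomposable_diag k E : 1 < k -> sided c E -> inside e E -> spread (72 * k - 10) E ->
  2 * k - 1 %| #|E| -> decomposable e k k E.
Proof.
move=> k1 sE iE cE dE; have k0 : 0 < k by exact: ltnW.
apply: (main_decomposable esym (factor_suffices_diag esym k0) k1 _ _ sE iE dE cE).
- lia.
- lia.
- by clear -k1; lia.
move=> d dR dS hd hR hS.
have : dR + (2 * k - 1) <= 2 * (k - 1) * dS; last by clear -k1; nia.
have h : 36 * k - 5 <= d./2 by lia.
have : dR <= 3 * k - 1 + d./2 by lia.
move: d./2 h hS => {hd hR} h hh hS hR; nia.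
Qed.

(** The connectivity is 36m + 56, with m = k + l - 1, less the m edges of a bistar that may have
    been removed. *)
Lemma decomposable_off k l E : 1 < k -> k < l -> sided c E -> inside e E ->
  spread (35 * (k + l - 1) + 56) E -> 2 * (k + l - 1) %| #|E| -> decomposable e k l E.
Proof.
move=> k1 kl sE iE cE dE; have k0 : 0 < k by exact: ltnW.
have l0 : 0 < l by lia.
have f1 : 1 < k + l by lia.
apply: (main_decomposable esym (factor_suffices_off esym k0 l0) f1 _ _ sE iE dE cE).
- lia.
- lia.
- by lia.
have -> : k + l = (k + l - 1).+1 by lia.
have : 4 <= k + l - 1 by lia.
rewrite subn1 /=; move: (k + l).-1 => m m4 d dR dS hd hR hS.
have : dR + m <= (m - 1) * dS.
  have h : 17 * m + 28 <= d./2 by lia.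
  have : dR <= 3 * m + 2 + d./2 by lia.
  by move: d./2 h hS => {hd hR} h hh hS hR; nia.
by clear -m4; nia.
Qed.

(** For k < l one has 2l >= m + 2, so 60l + 6m - 4 is at least 36m + 56. If the number of edges is
    an odd multiple of m, removing one bistar makes it an even one. *)
Lemma decomposable_off_odd k l E : 1 < k -> k < l -> sided c E -> inside e E ->
  spread (36 * (k + l - 1) + 56) E -> k + l - 1 %| #|E| -> decomposable e k l E.
Proof.
move=> k1 kl sE iE cE /dvdnP [q hq]; set m := k + l - 1 in cE hq *.
have mE : m = k + l - 1 by [].
have [E0|E0] := eqVneq E set0; first by rewrite E0; exact: decomposable0.
case: (boolP (odd q)) => oq; last first.
  apply: decomposable_off => //; first by apply: spread_weaken cE; rewrite -/m; lia.
  by rewrite hq -/m dvdn_mul // dvdn2.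
have [||||B BE [cB dB]] := @exists_bistar V e c esym k l (36 * m + 56) E _ _ _ _ sE iE cE E0.
- lia.
- lia.
- by rewrite mE; clear -k1 kl; lia.
- by rewrite mE; clear -k1 kl; lia.
rewrite -(setD_union BE); apply: (@decomposableU _ _ _ _ c) => //.
- by rewrite setD_union.
- exact: disjD.
apply: decomposable_off => //.
- exact: sided_sub (subsetDl _ _) sE.
- exact: inside_sub (subsetDl _ _) iE.
- by have := spread_sub BE cE; apply: spread_weaken; rewrite cB -/m; lia.
have := cntD predT BE; rewrite !cnt_all // hq cB -/m; move: #|_| => x hx.
have -> : x = q.-1 * m by case: q oq hx {hq} => //= q _; rewrite mulSn => /addnI.
by rewrite dvdn_mul // dvdn2; case: q oq {hq hx} => //= q.
Qed.

End Cases.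

Lemma bistar_decomposition_exists k l (V : finType) (e : rel V) : 1 < k -> k <= l ->
  simple_graph e -> bipartite e ->
  edge_connected (12 * l * ceil_div (2 * (k + l - 1)) (k - 1) + 6 * (k + l - 1) - 4) e ->
  k + l - 1 %| #|edges e| -> has_bistar_decomposition k l e.
Proof.
move=> k1 kl [esym _] [c col] ec dE; apply: (has_bistar_decomposition_arcs esym col).
(* From l >= k the numerator is at least 4(k - 1) + 2, so the quotient exceeds 4. *)
have c5 : 5 <= ceil_div (2 * (k + l - 1)) (k - 1) by apply: leq_ceil_div; lia.
have r60 : 60 * l <= 12 * l * ceil_div (2 * (k + l - 1)) (k - 1).
  by apply: leq_trans (leq_mul (leqnn _) c5); rewrite mulnAC.
have sp := spread_arcs esym col ec.
move: kl; rewrite leq_eqVlt => /orP [/eqP kl|kl].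
  subst l; apply: (@decomposable_diag _ _ c esym) => //.
  - exact: sided_arcs.
  - exact: inside_arcs.
  - by apply: spread_weaken sp; move: r60; move: (12 * _ * _) => x; clear -k1; lia.
  - by rewrite (card_arcs esym col) mul2n -addnn.
apply: (@decomposable_off_odd _ _ c esym) => //.
- exact: sided_arcs.
- exact: inside_arcs.
- by apply: spread_weaken sp; move: r60; move: (12 * _ * _) => x; clear -k1 kl; lia.
- by rewrite (card_arcs esym col).
Qed.

Theorem theorem20 :
  (forall (k l : nat), 1 < k -> k <= l ->
   forall (V : finType) (e : rel V), simple_graph e -> bipartite e ->
   edge_connected (12 * l * ceil_div (2 * (k + l - 1)) (k - 1) + 6 * (k + l - 1) - 4) e ->
   (k + l - 1) %| #|edges e| ->
   has_bistar_decomposition k l e)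
  /\
  (forall (k : nat), 1 < k ->
   forall (V : finType) (e : rel V), simple_graph e -> bipartite e ->
   edge_connected (72 * k + 236) e ->
   (2 * k) %| #|edges e| ->
   has_bistar_decomposition k k.+1 e).
Proof.
split=> [k l k1 kl V e|k k1 V e sg bp ec dE]; first exact: bistar_decomposition_exists.
have k2 : k + k.+1 - 1 = 2 * k by lia.
apply: bistar_decomposition_exists => //; rewrite k2 //.
apply: edge_connected_mono ec.
(* For k >= 5 the ceiling is at most 5, so connectivity 72k + 56 is enough. For k = 2, 3, 4 the
   ceiling is 8, 6, 6, and the values 308, 320, 404 required lie below the available 380, 452,
   524. *)
have [k5|k5] := leqP 5 k.
  have : ceil_div (2 * (2 * k)) (k - 1) <= 5 by apply: ceil_div_leq; lia.
  by move: (ceil_div _ _) => x hx; nia.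
by move: k1 k5 {dE k2}; do 5 case: k => [//|k].
Qed.
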